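(* The problem $(k,c,\ell)$-MULT (determine whether $\mathbf M$ is equivalent to a $k$-multiplicative $(c,\ell+1)$-CA model) can be solved in $O(n^2)$ time for any PCA model $\mathbf M$ with $n$ arcs, any integer $k$ with $1\le k<\omega(\mathbf M)$, and $c,\ell\in\mathbb N$. The algorithm outputs either a $k$-multiplicative $(c,\ell+1)$-CA model equivalent to $\mathbf M$ or a minimal family of difference constraints of $\mathbf S^k$ with no feasible solution.
   Context: **PCA models.** Arcs are open arcs of a circle. Every circle $C$ (of length $|C|$) has a special point $0$, and each point $p$ is identified with the length of the clockwise segment from $0$ to $p$; so $p<q$ iff $p$ appears before $q$ in a clockwise traversal from $0$. For points $s\ne t$, $(s,t)$ is the arc going clockwise from $s$ to $t$; an arc $A=(s,t)$ has beginning point $s(A)=s$ and ending point $t(A)=t$, its extremes. $A$ is external if $A\cup\{t(A)\}$ contains $0$ (in other words, $t(A)<s(A)$) and internal otherwise. $A<B$ means $s(A)<s(B)$. A proper circular-arc (PCA) model is a pair $\mathbf M=(C,\mathcal A)$ where $C$ is a circle and $\mathcal A=\mathcal A(\mathbf M)$ is a family of inclusion-free arcs of $C$, no two of which share an extreme. Its arcs are $A_0<\dots<A_{n-1}$; $A_0$ is the initial arc. $\mathbf M$ is PIG if it has no external arcs. PCA models $\mathbf M,\mathbf M'$ are equivalent if there is a bijection $f:\mathcal A(\mathbf M)\to\mathcal A(\mathbf M')$ such that $e(A)<e'(B)$ if and only if $e(f(A))<e'(f(B))$, for $e,e'\in\{s,t\}$; that is, their extremes appear in the same order when the circles are traversed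 clockwise from their $0$ points. **Functions on arcs** (subindices mod $n$). A sequence $A_i,A_{i+1},\dots,A_{i+m}$ is contiguous, with leftmost arc $A_i$ and rightmost arc $A_{i+m}$. $L(A_i)=A_{i-1}$, $R(A_i)=A_{i+1}$. $F_l(A_i)$ is the leftmost arc of the contiguous sequence of arcs with ending point in $A_i\cup\{t(A_i)\}$ that has $A_i$ as its rightmost arc; $F_r(A_i)$ is the rightmost arc of the contiguous sequence of arcs with beginning point in $A_i\cup\{s(A_i)\}$ that has $A_i$ as its leftmost arc. $H_l(A_i)$ is the unique arc $A$ such that $F_r(A)=A_i$ and $F_r(R(A))\ne A_i$, and $H_l(A_i)=\bot$ if such $A$ does not exist; $H_r(A_i)$ is the unique arc $A$ such that $F_l(A)=A_i$ and $F_l(L(A))\ne A_i$, and $H_r(A_i)=\bot$ if such $A$ does not exist. $f^j$ is the $j$-th iterate of $f$ ($f^0(A)=A$, and $f^{j+1}(A)=\bot$ if $f^j(A)=\bot$). **Powers.** For $j\ge0$, $A^j=(s(A),\,s(F_r^j(A))+\varepsilon(x+1))$, where $x$ is the number of arcs $B$ with $s(A)\in B$ and $F_r^j(B)=F_r^j(A)$, and the positive number $\varepsilon<1/n$ is small enough so that $t(A^j)\notin R(F_r^j(A))$. $\mathbf M^j=(C,\{A^j:A\in\mathcal A\})$. $\omega(\mathbf M)$ is $n$ if $\mathbf M$ is PIG, and otherwise it is the minimum $\omega>1$ for which there is an arc $A$ with $A^\omega\subset A$. **Multiplicative models.** A UCA model is a PCA model whose arcs all have the same length. A $(c,\ell+1)$-CA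 model is a UCA model whose circle has length $c$ and whose arcs have length $\ell+1$, where $c$, $\ell$ and all the extremes are integers. For such a model $\mathbf U$ and $i\ge0$, $i\times\mathbf U$ has the same circle and the arcs $(s(A),\,s(A)+i\ell+1 \bmod c)$ for $A\in\mathcal A(\mathbf U)$. $\mathbf U$ is $k$-multiplicative when $i\times\mathbf U$ is a UCA model equivalent to $\mathbf U^i$ for every $0\le i\le k$. **Synthetic graph.** $\beta\{P\}$ is $1$ if $P$ is true and $0$ otherwise. A $1$-hollow is an edge $B\to A$ for arcs $A,B$ with $s(B)\in A^1$, $B=F_r(A)$ and $A=F_l(B)$; its weight is $\mathrm{sep}_{c,\ell}(B\to A)=-\ell+c\,\beta\{A\ge B\}$. An $i$-nose ($i\ge0$) is an edge $A\to B$ for arcs $A,B$ with $s(B)\notin A^i$ and $A=H_l^i(L(B))$; its weight is $\mathrm{sep}_{c,\ell}(A\to B)=i\ell+2-c\,\beta\{A\ge B\}$. $\mathbf S_*^k$ is the directed multigraph with vertex set $\mathcal A(\mathbf M)$ whose edges are the $1$-hollows and the $i$-noses for $0\le i\le k$. An $i$-nose $A\to B$ is short when $i<k$ and either $H_l(A)\ne\bot$ or $H_r(B)\ne\bot$. $\mathbf S^k$ is obtained from $\mathbf S_*^k$ by removing all the short noses. **Difference constraints.** Each edge $X\to Y$ of $\mathbf S^k$ corresponds to the difference constraint $x_Y\ge x_X+\mathrm{sep}_{c,\ell}(X\to Y)$ in indeterminates $x_A$, $A\in\mathcal A(\mathbf M)$; these are the difference constraints of $\mathbf S^k$. Minimality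 of an infeasible family means that removing any nonempty subfamily leaves a feasible family. **Computation.** $\mathbf M$ is given by any reasonable representation, from which $L,R,F_l,F_r,H_l,H_r$ can be computed for all arcs in $O(n)$ time.
   Formalization: Proved for PCA models with no ending point between 0 and s(A_0); in A^j, x counts the B with s(A) in B^j; H_l(A_i)=A_i when F_r is constantly A_i (likewise H_r); the arcs of i×U must have length iℓ+1<c. *)

(* Defs.v *)
(* MathComp world (with the real numbers of MathComp-Analysis). *)
From mathcomp Require Import all_boot all_order all_algebra.
From mathcomp Require Import reals.
Set Implicit Arguments.
Unset Strict Implicit.
Unset Printing Implicit Defensive.
Import Order.TTheory GRing.Theory Num.Theory.
Local Open Scope ring_scope.

(* A circle with finitely many arcs.  A point is its clockwise distance from
   the special point 0, and arc i is the open arc from beg i to fin i. *)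
Record model (R : realType) := Model {
  len : R;
  narcs : nat;
  beg : 'I_narcs -> R;
  fin : 'I_narcs -> R }.

Section Models.
Variable R : realType.
Implicit Types (M U : model R) (e : R).

(* Length of the clockwise segment from p to q. *)
Definition cw M (p q : R) : R := if p <= q then q - p else q - p + len M.

(* Reduction to [0, len) of a point of [0, 2 len). *)
Definition wrap M (p : R) : R := if p < len M then p else p - len M.

Definition on_circle M (p : R) : bool := (0 <= p) && (p < len M).

Definition in_arc M (s t p : R) : bool := (0 < cw M s p) && (cw M s p < cw M s t).

Definition arc M (i : 'I_(narcs M)) (p : R) : bool := in_arc M (beg i) (fin i) p.

(* Arcs are indexed in the order A_0 < ... < A_{n-1} of their beginnings. *)
Definition is_pca M : Prop :=
  [/\ 0 < len M,
      (forall i : 'I_(narcs M), on_circle M (beg i) /\ on_circle M (fin i)),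
      (forall i j : 'I_(narcs M), (i < j)%N -> beg i < beg j),
      (injective (@fin R M) /\ forall i j : 'I_(narcs M), beg i <> fin j) &
      (forall i j : 'I_(narcs M), i <> j ->
         ~ (forall p, on_circle M p -> arc i p -> arc j p))].

Definition external M (i : 'I_(narcs M)) : bool := fin i < beg i.

Definition is_pig M : Prop := forall i : 'I_(narcs M), ~~ external i.

(* The special point 0 lies just before, or at, the beginning of the initial
   arc: no ending point lies between 0 and beg A_0. Every PCA model satisfies
   this after moving 0 along the circle. Without it a power (whose ending points
   closely follow beginning points) can differ from the model it comes from only
   because some ending point lies on the other side of 0, so that even M^1 need
   not be equivalent to M. *)
Definition zero_at_initial M : Prop :=
  forall i : 'I_(narcs M), exists j : 'I_(narcs M), beg j < fin i.

Definition equivalent M M' : Prop :=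
  exists2 f : 'I_(narcs M) -> 'I_(narcs M'), bijective f &
    forall a b : 'I_(narcs M),
      [/\ (beg a < beg b) = (beg (f a) < beg (f b)),
          (beg a < fin b) = (beg (f a) < fin (f b)),
          (fin a < beg b) = (fin (f a) < beg (f b)) &
          (fin a < fin b) = (fin (f a) < fin (f b))].

Definition Lf M (i : 'I_(narcs M)) : 'I_(narcs M) := ord_pred i.
Definition Rt M (i : 'I_(narcs M)) : 'I_(narcs M) := ordS i.

Definition Fl M (i : 'I_(narcs M)) : 'I_(narcs M) :=
  iter (\max_(m < narcs M | [forall j : 'I_(narcs M), (j <= m)%N ==>
          (let t := fin (iter j (@Lf M) i) in arc i t || (t == fin i))]) m)
    (@Lf M) i.

Definition Fr M (i : 'I_(narcs M)) : 'I_(narcs M) :=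
  iter (\max_(m < narcs M | [forall j : 'I_(narcs M), (j <= m)%N ==>
          (let s := beg (iter j (@Rt M) i) in arc i s || (s == beg i))]) m)
    (@Rt M) i.

(* The arcs a with Fr a = i form a contiguous sequence and Hl i is its rightmost
   arc.  The disjunct a == i matters only when Fr is constant, equal to i: then
   every arc is in the sequence, whose rightmost arc is i itself, although
   Fr (Rt i) = i.  Likewise for Hr.  The value None is bottom. *)
Definition Hl M (i : 'I_(narcs M)) : option 'I_(narcs M) :=
  [pick a | (Fr a == i) && ((Fr (Rt a) != i) || (a == i))].

Definition Hr M (i : 'I_(narcs M)) : option 'I_(narcs M) :=
  [pick a | (Fl a == i) && ((Fl (Lf a) != i) || (a == i))].

Definition Hl_iter M (j : nat) (i : 'I_(narcs M)) : option 'I_(narcs M) :=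
  iter j (obind (@Hl M)) (Some i).

Definition Fr_iter M (j : nat) (i : 'I_(narcs M)) : 'I_(narcs M) :=
  iter j (@Fr M) i.

(* The number of arcs b with Fr^j b = Fr^j a whose power b^j contains beg a.
   For j = 1 these are the b with Fr b = Fr a that contain beg a; for j > 1
   counting only the b that contain beg a would give two powers the same end. *)
Definition rank_in_fiber M (j : nat) (a : 'I_(narcs M)) : nat :=
  #|[set b : 'I_(narcs M) | (Fr_iter j b == Fr_iter j a) &&
      (0 < cw M (beg b) (beg a) <= cw M (beg b) (beg (Fr_iter j b)))]|.

(* M^j for a given epsilon. *)
Definition power M (j : nat) e : model R :=
  @Model R (len M) (narcs M) (@beg R M)
    (fun a => wrap M (beg (Fr_iter j a) + e * (rank_in_fiber j a).+1%:R)).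

(* Powers depend on epsilon only through its being small enough (in particular
   less than 1/n, and such that the end of A^j does not reach R(Fr^j A)). *)
Definition for_small_eps (P : R -> Prop) : Prop :=
  exists2 d : R, 0 < d & forall e, 0 < e < d -> P e.

Definition in_power M (j : nat) (a : 'I_(narcs M)) (p : R) : Prop :=
  for_small_eps (fun e => @arc (power M j e) a p).

Definition notin_power M (j : nat) (a : 'I_(narcs M)) (p : R) : Prop :=
  for_small_eps (fun e => ~~ @arc (power M j e) a p).

Definition power_shrinks M (w : nat) : Prop :=
  exists a : 'I_(narcs M), for_small_eps (fun e =>
    forall p, on_circle M p -> @arc (power M w e) a p -> arc a p).

Definition is_omega M (w : nat) : Prop :=
  (is_pig M -> w = narcs M) /\
  (~ is_pig M ->
     [/\ (1 < w)%N, power_shrinks M w &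
         forall v : nat, (1 < v)%N -> power_shrinks M v -> (w <= v)%N]).

Definition arc_len M (i : 'I_(narcs M)) : R := cw M (beg i) (fin i).

Definition is_uca M : Prop :=
  is_pca M /\ forall i j : 'I_(narcs M), arc_len i = arc_len j.

(* (c, l+1)-CA model. *)
Definition is_ca (c l : nat) U : Prop :=
  [/\ is_uca U, len U = c%:R &
      forall i : 'I_(narcs U),
        [/\ arc_len i = l.+1%:R, beg i \is a Num.int & fin i \is a Num.int]].

Definition times (l i : nat) U : model R :=
  @Model R (len U) (narcs U) (@beg R U)
    (fun a => wrap U (beg a + (i * l + 1)%:R)).

(* The arcs of i x U must have length i * l + 1, hence i * l + 1 < c. *)
Definition multiplicative (k c l : nat) U : Prop :=
  forall i : nat, (i <= k)%N ->
    is_ca c (i * l) (times l i U) /\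
    for_small_eps (fun e => equivalent (times l i U) (power U i e)).

Definition mult_solution M (k c l : nat) U : Prop :=
  [/\ is_ca c l U, multiplicative k c l U & equivalent M U].

(* (None, X, Y) is a 1-hollow X -> Y and (Some i, X, Y) is an i-nose X -> Y. *)
Definition edge M : Type := (option nat * 'I_(narcs M) * 'I_(narcs M))%type.

Definition is_hollow M (b a : 'I_(narcs M)) : Prop :=
  [/\ in_power 1 a (beg b), b = Fr a & a = Fl b].

Definition is_nose M (i : nat) (a b : 'I_(narcs M)) : Prop :=
  notin_power i a (beg b) /\ Some a = Hl_iter i (Lf b).

Definition is_short M (k i : nat) (a b : 'I_(narcs M)) : Prop :=
  (i < k)%N /\ (Hl a <> None \/ Hr b <> None).

Definition synthetic_full M (k : nat) (x : edge M) : Prop :=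
  match x with
  | (None, b, a) => is_hollow b a
  | (Some i, a, b) => (i <= k)%N /\ is_nose i a b
  end.

Definition synthetic M (k : nat) (x : edge M) : Prop :=
  synthetic_full k x /\
  match x with
  | (None, _, _) => True
  | (Some i, a, b) => ~ is_short k i a b
  end.

Definition sep M (c l : nat) (x : edge M) : int :=
  match x with
  | (None, b, a) => - l%:Z + (if beg b <= beg a then c%:Z else 0)
  | (Some i, a, b) => (i * l)%N%:Z + 2 - (if beg b <= beg a then c%:Z else 0)
  end.

Definition feasible M (c l : nat) (F : seq (edge M)) : Prop :=
  exists x : 'I_(narcs M) -> R, forall f : edge M, f \in F ->
    x f.2 >= x f.1.2 + (sep c l f)%:~R.

Definition minimal_infeasible M (c l : nat) (F : seq (edge M)) : Prop :=
  ~ feasible c l F /\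
  forall G : seq (edge M), {subset G <= F} -> G <> [::] ->
    feasible c l [seq f <- F | f \notin G].

End Models.

(* Structured random access machine.  A program uses finitely many named arrays
   of integers, indexed by integers; it has indirect addressing, addition,
   subtraction and sign tests, but no multiplication.  Each assignment and each
   test costs 1 (the sizes of the expressions are bounded by a constant of the
   program). *)
Inductive expr :=
  | Cst of int
  | Get of nat & expr
  | Add of expr & expr
  | Sub of expr & expr.

Inductive cmd :=
  | Skip
  | Put of nat & expr & expr
  | Seq of cmd & cmd
  | IfPos of expr & cmd & cmd
  | WhilePos of expr & cmd.

Definition memory := nat -> int -> int.

Fixpoint eval (m : memory) (x : expr) : int :=
  match x with
  | Cst z => z
  | Get a y => m a (eval m y)
  | Add y z => eval m y + eval m z
  | Sub y z => eval m y - eval m z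
  end.

Definition update (m : memory) (a : nat) (i v : int) : memory :=
  fun b j => if (b == a) && (j == i) then v else m b j.

(* exec p m t m': from memory m, program p halts with memory m' at cost t. *)
Inductive exec : cmd -> memory -> nat -> memory -> Prop :=
  | ExSkip m : exec Skip m 1 m
  | ExPut a x y m : exec (Put a x y) m 1%N (update m a (eval m x) (eval m y))
  | ExSeq p q m t m' t' m'' :
      exec p m t m' -> exec q m' t' m'' -> exec (Seq p q) m (t + t') m''
  | ExIfTrue x p q m t m' :
      0 < eval m x -> exec p m t m' -> exec (IfPos x p q) m t.+1 m'
  | ExIfFalse x p q m t m' :
      eval m x <= 0 -> exec q m t m' -> exec (IfPos x p q) m t.+1 m'
  | ExWhileTrue x p m t m' t' m'' :
      0 < eval m x -> exec p m t m' -> exec (WhilePos x p) m' t' m'' ->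
      exec (WhilePos x p) m (t + t').+1 m''
  | ExWhileFalse x p m : eval m x <= 0 -> exec (WhilePos x p) m 1%N m.

(* Array 0 holds k, c, l; array 1 holds the representation of the model. *)
Definition params (k c l : nat) : int -> int :=
  fun i => nth 0 [:: k%:Z; c%:Z; l%:Z] (absz i).

Definition input (k c l : nat) (r : int -> int) : memory :=
  fun a => match a with 0%N => params k c l | 1%N => r | _ => fun=> 0 end.

Definition code n (i : 'I_n) : int := (i : nat)%:Z.
Definition code_opt n (o : option 'I_n) : int := oapp (@code n) (-1) o.

Definition holds_tables (R : realType) (M : model R) (m : memory) : Prop :=
  m 2%N 0 = (narcs M)%:Z /\
  forall i : 'I_(narcs M),
    [/\ m 3%N (code i) = code (Lf i), m 4%N (code i) = code (Rt i) &
        [/\ m 5%N (code i) = code (Fl i), m 6%N (code i) = code (Fr i),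
            m 7%N (code i) = code_opt (Hl i) & m 8%N (code i) = code_opt (Hr i)]].

(* A representation of PCA models by integer arrays is reasonable if some program
   computes the six functions, for all arcs, in O(n) time (without losing the
   remaining input). *)
Definition reasonable (R : realType) (rep : model R -> int -> int) : Prop :=
  exists (p : cmd) (K : nat), forall (M : model R) (k c l : nat), is_pca M ->
    exists (t : nat) (m : memory),
      [/\ exec p (input k c l (rep M)) t m,
          (t <= K * (narcs M).+1)%N,
          (forall i : nat, (i < 3)%N -> m 0%N i%:Z = params k c l i%:Z) &
          holds_tables M m].

Definition outputs_model (R : realType) (U : model R) (m : memory) : Prop :=
  forall i : 'I_(narcs U),
    beg i = (m 10%N (code i))%:~R /\ fin i = (m 11%N (code i))%:~R.

(* The kind of an i-nose is written i, that of a hollow -1. *)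
Definition outputs_family (R : realType) (M : model R) (F : seq (edge M))
    (m : memory) : Prop :=
  m 10%N 0 = (size F)%:Z /\
  forall (j : nat) (x : edge M), (j < size F)%N ->
    let f := nth x F j in
    [/\ m 11%N j%:Z = oapp Posz (-1) f.1.1,
        m 12%N j%:Z = code f.1.2 & m 13%N j%:Z = code f.2].

Definition correct_output (R : realType) (M : model R) (k c l : nat)
    (m : memory) : Prop :=
  (m 9%N 0 = 1 /\ exists U : model R, mult_solution M k c l U /\ outputs_model U m)
  \/
  [/\ m 9%N 0 = 0, ~ (exists U : model R, mult_solution M k c l U) &
      exists F : seq (edge M),
        [/\ uniq F, (forall f : edge M, f \in F -> synthetic k f),
            minimal_infeasible c l F & outputs_family F m]].

(* Main.v *)
Require Import Defs.
From mathcomp Require Import all_boot all_order all_algebra.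
From mathcomp Require Import reals.
From mathcomp Require Import zify lra.
(* Again: mathcomp has its own [arc]. *)
Import Defs.

(* Unroll the circle: points become reals, arcs become integers, and F_r, F_l
   become monotone maps F, G : int -> int that commute with the shift by n and
   are adjoint (G z <= q iff z <= F q). Two models with 0 just before the initial
   arc are equivalent iff they have the same F, and k < omega says that F^i z < z + n
   for i <= k, so that the power M^i has lift F^i. Hence a k-multiplicative model
   is an integer map X with X (z + n) = X z + c and, for all i <= k,
   X (F^i z) <= X z + i l and X (F^i z + 1) >= X z + i l + 2.
   These inequalities follow from the constraints of S^k. The delicate ones are
   X (p + 1) >= X p + 2 when F p = F (p + 1): a short 0-nose is bounded below by a
   long nose minus 1-hollows, leaving the gaps of some fibers of F, and every such
   gap is charged at most once; summing over all bad gaps gives a contradiction.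
   Every vertex is entered by at most one 1-hollow and one nose of S^k, so the
   longest walks of at most n edges take O(n^2) time. If the last layer improves
   some vertex, then the layers improve strictly all along the walk traced back from
   it, so any repetition on it gives a cycle of positive weight, and the first
   repetition gives a simple one, whose edges are a minimal infeasible family. *)

Set Implicit Arguments.
Unset Strict Implicit.
Unset Printing Implicit Defensive.
Import Order.TTheory GRing.Theory Num.Theory.
Local Open Scope ring_scope.

(** * Difference constraints on the lifted arcs *)

(** The constants come from integrality: the arcs of i x U have length i l + 1, and F^i z is the
    last beginning before the end of arc z, so integer positions satisfy X (F^i z) < X z + i l + 1 <
    X (F^i z + 1), that is, the bounds i l and i l + 2. The obstacle is a circularity. A short nose
    should follow from a longer nose by going back along 1-hollows. But a hollow ends at the first
    arc of a fiber of F, whereas the prolonged nose starts at the last one, and the distance between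
    the two is a sum of gaps that are themselves bounded only by 0-noses, possibly short. Instead of
    an induction on the gaps, all bad gaps of one period are therefore estimated at once. Charging
    each of them at most once is enough because a bad gap is an integer at most 1, while the bound
    sought is 2. Once the gaps inside the fibers of F, and by reflection those inside the fibers of
    G, are known to be positive, the other noses follow by descending induction on their length. *)

Lemma mulz_small (n : nat) (t : int) : - n%:Z < t * n%:Z < n%:Z -> t = 0.
Proof.
move=> h; have [t1|[t0|t1]] : t <= -1 \/ t = 0 \/ 1 <= t by lia.
- by nia.
- by [].
by nia.
Qed.

(** [G] is constrained only through the adjunction: its period and its bounds are consequences
    ([circ_dual], [circ_G]). The bound [F z < z + n] says that an arc never reaches its own
    beginning again. *)
Definition circ (n : nat) (F G : int -> int) : Prop :=
  [/\ (0 < n)%N, (forall z, F (z + n%:Z) = F z + n%:Z),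
      (forall z, z <= F z < z + n%:Z) &
      (forall z q, (G z <= q) = (z <= F q))].

(** Conjugation by the reflection z |-> - z: [gdual G] is the forward map of the mirrored circle,
    with adjoint [gdual F]. *)
Definition gdual (F : int -> int) (z : int) : int := - F (- z).

Section Circ.
Variables (n : nat) (F G : int -> int).
Hypothesis hFG : circ n F G.

Lemma circ_n : (0 < n)%N. Proof. by case: hFG. Qed.
Lemma circ_FD z : F (z + n%:Z) = F z + n%:Z. Proof. by case: hFG. Qed.
Lemma circ_F z : z <= F z < z + n%:Z. Proof. by case: hFG. Qed.
Lemma circ_adj z q : (G z <= q) = (z <= F q). Proof. by case: hFG. Qed.

Lemma circ_Fmono a b : a <= b -> F a <= F b.
Proof.
move=> ab; rewrite -circ_adj; apply: le_trans ab.
by rewrite circ_adj.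
Qed.

Lemma circ_GF z : z <= F (G z). Proof. by rewrite -circ_adj. Qed.

Lemma circ_FG z : G (F z) <= z. Proof. by rewrite circ_adj. Qed.

Lemma circ_Gmono a b : a <= b -> G a <= G b.
Proof. by move=> ab; rewrite circ_adj; apply: le_trans ab (circ_GF b). Qed.

Lemma circ_G z : G z <= z /\ z - n%:Z < G z.
Proof.
split; first by rewrite circ_adj; case/andP: (circ_F z).
by move: (circ_F (G z)) (circ_GF z); lia.
Qed.

Lemma circ_FDM z (t : int) : F (z + t * n%:Z) = F z + t * n%:Z.
Proof.
have nat_case (u : int) (m : nat) : F (u + m%:Z * n%:Z) = F u + m%:Z * n%:Z.
  elim: m => [|m IH]; first by rewrite mul0r !addr0.
  by rewrite -addn1 PoszD mulrDl mul1r addrA circ_FD IH addrA.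
case: t => m; first exact: nat_case.
rewrite NegzE; move: (nat_case (z + - (m.+1%:Z) * n%:Z) m.+1).
by rewrite mulNr subrK => ->; rewrite addrK.
Qed.

Lemma circ_dual : circ n (gdual G) (gdual F).
Proof.
have n0 := circ_n.
have h z : G z <= z /\ z - n%:Z < G z := circ_G z.
split=> // [z|z|z q]; rewrite /gdual.
(* The period of [G] is obtained from that of [F], one inequality for each direction of the
   adjunction. *)
- have e : G (- (z + n%:Z)) = G (- z) - n%:Z.
    apply/eqP; rewrite eq_le circ_adj.
    have -> : G (- z) - n%:Z = G (- z) + (- 1) * n%:Z by lia.
    rewrite circ_FDM.
    have := circ_GF (- z) => h1; apply/andP; split; first lia.
    suff : G (- z) <= G (- (z + n%:Z)) + 1 * n%:Z by lia.
    rewrite circ_adj circ_FDM; move: (circ_GF (- (z + n%:Z))); lia.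
  by rewrite e; lia.
- by move: (h (- z)); lia.
by move: (circ_adj (- q) (- z)); lia.
Qed.

(** [G (F a + 1) = a + 1] says that a is the last point of its fiber of [F], that is, H_l(F a) = a.
    So [gc i a p] lifts H_l^i(p) = a, read from a upwards along [F]. *)
Fixpoint gc (i : nat) (a p : int) : Prop :=
  if i is i'.+1 then G (F a + 1) = a + 1 /\ gc i' (F a) p else a = p.

Lemma gc_rcons i a p : gc i a p -> G (F p + 1) = p + 1 -> gc i.+1 a (F p).
Proof.
elim: i a => [|i IH] a /=; first by move=> ->.
by case=> h1 h2 h3; split=> //; apply: IH.
Qed.

Lemma gc_iter i a p : gc i a p -> p = iter i F a.
Proof. by elim: i a => [|i IH] a //= [_ /IH ->]; rewrite -iterSr. Qed.

Lemma circ_iterDM i z (t : int) : iter i F (z + t * n%:Z) = iter i F z + t * n%:Z.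
Proof. by elim: i => //= i ->; exact: circ_FDM. Qed.

Lemma iter_ge i z : z <= iter i F z.
Proof. by elim: i => //= i IH; move: (circ_F (iter i F z)); lia. Qed.

End Circ.

(** The reflection reverses the chain, so the step peeled off at one end is appended at the other by
    [gc_rcons]. The nose from a to p + 1 in the mirrored circle becomes one from -(p + 1) to -a,
    which explains the shifts by 1. *)
Lemma gc_dual n F G i a p : circ n F G -> gc (gdual G) (gdual F) i a p ->
  gc F G i (- (p + 1)) (- (a + 1)).
Proof.
move=> hFG; elim: i a => [|i IH] a /=; first by move=> ->.
case; rewrite /gdual => h1 /IH h2.
have e1 : - (- G (- a) + 1) = G (- a) - 1 by lia.
rewrite e1 in h1 h2.
have h3 : F (G (- a) - 1) = - (a + 1) by lia.
have := gc_rcons h2; rewrite /= h3; apply.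
have -> : - (a + 1) + 1 = - a by lia.
by lia.
Qed.

(** [G (F a) = a] makes a the first point of its fiber of [F]; with [F a != a] this describes the
    1-hollow from F a to a. Its head is the smaller point, hence an upper bound for X (F a). *)
Definition hollows (F G X : int -> int) (l : nat) : Prop :=
  forall a, F a != a -> G (F a) = a -> X (F a) <= X a + l%:Z.

(* [gc i a p] encodes the i-nose from a to p + 1; it is short iff i < k and
   [G a < G (a + 1)] (H_l(a) exists) or [F p < F (p + 1)] (H_r(p+1) exists). *)
Definition long_noses (F G X : int -> int) (l k : nat) : Prop :=
  forall i a p, (i <= k)%N -> gc F G i a p ->
    i = k \/ G a = G (a + 1) /\ F p = F (p + 1) ->
    X a + (i * l)%N%:Z + 2 <= X (p + 1).

Definition shifts (n c : nat) (X : int -> int) : Prop :=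
  forall z : int, X (z + n%:Z) = X z + c%:Z.

Lemma hollows_dual n F G X l : circ n F G -> hollows F G X l ->
  hollows (gdual G) (gdual F) (fun z => - X (- z)) l.
Proof.
move=> hFG hX a; rewrite /gdual => h1 h2.
have e : F (G (- a)) = - a by move: h2; rewrite opprK; lia.
have := hX (G (- a)); rewrite e => h.
rewrite !opprK; suff: X (- a) <= X (G (- a)) + l%:Z by lia.
by apply: h => //; lia.
Qed.

Lemma long_noses_dual n F G X l k : circ n F G -> long_noses F G X l k ->
  long_noses (gdual G) (gdual F) (fun z => - X (- z)) l k.
Proof.
move=> hFG hX i a p ik /(gc_dual hFG) g h.
have := hX i _ _ ik g; rewrite /gdual in h.
have -> : - (a + 1) + 1 = - a by lia.
have -> : - (p + 1) + 1 = - p by lia.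
move=> {}hX; have : X (- (p + 1)) + (i * l)%N%:Z + 2 <= X (- a).
  by apply: hX; case: h => [->|[h1 h2]]; [left|right; split; lia].
lia.
Qed.

Lemma shifts_dual n c X : shifts n c X -> shifts n c (fun z => - X (- z)).
Proof.
by move=> h z; have := h (- (z + n%:Z)); rewrite opprD subrK => ->; lia.
Qed.

Lemma sum_shift n (h : int -> int) (g : int) :
  (forall z : int, h (z + n%:Z) = h z) ->
  \sum_(r < n) h (g + (r : nat)%:Z) = \sum_(r < n) h (r : nat)%:Z.
Proof.
case: n => [|n] hper; first by rewrite !big_ord0.
have step (u : int) : \sum_(r < n.+1) h (u + 1 + (r : nat)%:Z) =
              \sum_(r < n.+1) h (u + (r : nat)%:Z).
  rewrite big_ord_recr big_ord_recl /= addrC; congr (_ + _).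
    by rewrite addr0 -(hper u); congr h; lia.
  by apply: eq_bigr => r _; congr h; rewrite /bump leq0n; lia.
have pos (m : nat) (u : int) : \sum_(r < n.+1) h (u + m%:Z + (r : nat)%:Z) =
                       \sum_(r < n.+1) h (u + (r : nat)%:Z).
  elim: m => [|m IH]; first by under eq_bigr do rewrite addr0.
  by rewrite -IH -(step (u + m%:Z)); apply: eq_bigr => r _; congr h; lia.
case: g => m; first by rewrite -(pos m 0); apply: eq_bigr => r _; rewrite add0r.
rewrite -(pos m.+1); apply: eq_bigr => r _; congr h; lia.
Qed.

Section Fiber.
Variables (n c l k : nat) (F G X : int -> int).
Hypothesis hFG : circ n F G.
Hypothesis hX : shifts n c X.
Hypothesis hh : hollows F G X l.
Hypothesis hn : long_noses F G X l k.

(** The lift of H_l when the fiber of [F] over z is nonempty, which is the condition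
    [G z < G (z + 1)] below. The points [q j p] are then the tails of the noses into p + 1. *)
Let hl (z : int) := G (z + 1) - 1.
Let q (j : nat) (p : int) := iter j hl p.
Let y (z : int) := X (z + 1) - X z.
Let fib (z : int) := F z == F (z + 1).
(** How often the 0-nose into p + 1 can be prolonged by H_l, capped at k: [find] returns the size k
    of the list if the fiber over every [q j p] is nonempty. If moreover F p = F (p + 1), the nose
    of this length is long. *)
Let stop (p : int) := find (fun j => G (q j p) == G (q j p + 1)) (iota 0 k).
Let bad (z : int) := fib z && (y z < 2).

Let F_hl z : G z < G (z + 1) -> F (hl z) = z /\ F (hl z + 1) > z.
Proof.
rewrite /hl => h; have := circ_adj hFG z (G (z + 1) - 1).
have := circ_adj hFG (z + 1) (G (z + 1) - 1).
by move: (circ_GF hFG (z + 1)); rewrite subrK; lia.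
Qed.

Let stop_le p : (stop p <= k)%N.
Proof. by rewrite /stop -[X in (_ <= X)%N](size_iota 0 k) find_size. Qed.

Let stop_lt p j : (j < stop p)%N -> G (q j p) < G (q j p + 1).
Proof.
move=> js; have := @before_find _ 0%N (fun j => G (q j p) == G (q j p + 1)) _ _ js.
rewrite nth_iota ?add0n => [h|]; last exact: leq_trans (stop_le p).
have l1 : q j p <= q j p + 1 by lia.
by have := circ_Gmono hFG l1; move/eqP: h; lia.
Qed.

Let stop_end p : stop p = k \/ G (q (stop p) p) = G (q (stop p) p + 1).
Proof.
have [lt|] := ltnP (stop p) k; last by move: (stop_le p); lia.
right; have hs : has (fun j => G (q j p) == G (q j p + 1)) (iota 0 k).
  by rewrite has_find size_iota.
by have := nth_find 0%N hs; rewrite -/(stop p) nth_iota // add0n => /eqP.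
Qed.

Let gc_q i p : (i <= stop p)%N -> gc F G i (q i p) p.
Proof.
elim: i => [|i IH] // lt /=; have [h1 h2] := F_hl (stop_lt lt).
by rewrite h1 /hl subrK; split=> //; apply: IH; apply: ltnW.
Qed.

Let iter_q j p : (j <= stop p)%N -> iter j F (q j p) = p.
Proof. by move=> h; rewrite -(gc_iter (gc_q h)). Qed.

(** The fiber over z is nonempty and starts at G z, so the 1-hollow into G z applies. If G z = z
    there is no such edge, but then the inequality is trivial. *)
Let hollow_le z : G z < G (z + 1) -> X z <= X (G z) + l%:Z.
Proof.
move=> h; have e : F (G z) = z.
  have := circ_adj hFG (z + 1) (G z); move: (circ_GF hFG z); lia.
case: (F (G z) =P G z) => [e2|/eqP ne].
  by rewrite -e2 e; lia.
by have := hh ne; rewrite e; apply.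
Qed.

Let y_per (z : int) : y (z + n%:Z) = y z.
Proof.
have e : z + n%:Z + 1 = z + 1 + n%:Z by lia.
by rewrite /y e !hX; lia.
Qed.

Let fib_per (z : int) : fib (z + n%:Z) = fib z.
Proof. by rewrite /fib (addrAC z) !(circ_FD hFG) (inj_eq (addIr _)). Qed.

Let bad_per (z : int) : bad (z + n%:Z) = bad z.
Proof. by rewrite /bad y_per fib_per. Qed.

Let cong (a b : int) := (n%:Z %| a - b)%Z.

(** The fiber of [F] over z is the interval from G z to [hl z], and the difference of X at its ends
    telescopes into the gaps in between. Those that are not bad are at least 2, so leaving them out
    only decreases the sum. *)
Let fiber_sum z : G z < G (z + 1) ->
  \sum_(r < n | bad (r : nat)%:Z && cong (F (r : nat)%:Z) z) y (r : nat)%:Z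
  <= X (hl z) - X (G z).
Proof.
move=> hz; pose h u := if bad u && cong (F u) z then y u else 0.
have hper u : h (u + n%:Z) = h u.
  rewrite /h bad_per y_per (circ_FD hFG) /cong addrAC.
  by rewrite rpredDr // dvdzz.
(* The period of summation is moved to start at G z: the gaps of the fiber are then its first d
   indices. *)
rewrite big_mkcond /= -/(h _) -(sum_shift (G z) hper).
have [d hd] : exists d : nat, hl z = G z + d%:Z.
  by exists `|hl z - G z|%N; rewrite /hl in hz *; lia.
have [e1 e2] := F_hl hz.
have dn : (d <= n)%N.
  by move: (circ_F hFG (hl z)) (circ_G hFG z); lia.
rewrite -(big_mkord xpredT (fun r => h (G z + r%:Z))) (big_cat_nat (n := d)) //=.
(* No other index contributes: at [hl z] itself [F] jumps, and beyond it the values of [F] lie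
   strictly between z and z + n. *)
rewrite [X in _ + X]big_nat_cond [X in _ + X]big1 ?addr0; last first.
  move=> r /andP[/andP[dr rn] _]; rewrite /h; case: ifP => // /andP[/andP[f _] g].
  have [er|lt] : r = d \/ (d < r)%N by lia.
    by move: f; rewrite /fib er -hd; lia.
  have l1 : F (hl z + 1) <= F (G z + r%:Z) by apply: (circ_Fmono hFG); lia.
  have l2 : F (G z + r%:Z) <= F (G z - 1 + n%:Z) by apply: (circ_Fmono hFG); lia.
  have l3 : F (G z - 1) < z by have := circ_adj hFG z (G z - 1); lia.
  rewrite (circ_FD hFG) in l2.
  have lo : 0 < F (G z + r%:Z) - z by lia.
  have hi : F (G z + r%:Z) - z < n%:Z by lia.
  case/dvdzP: g => t ht; have t0 := @mulz_small n t ltac:(lia).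
  by rewrite t0 in ht; lia.
rewrite hd; have : forall d', (d' <= d)%N ->
    \sum_(0 <= r < d') h (G z + r%:Z) <= X (G z + d'%:Z) - X (G z).
  elim=> [|d' IH] lt; first by rewrite big_nil addr0 subrr.
  rewrite big_nat_recr //=; have := IH (ltnW lt).
  have fr : F (G z + d'%:Z) = F (G z + d'%:Z + 1).
    have a1 : F (G z) <= F (G z + d'%:Z) by apply: (circ_Fmono hFG); lia.
    have a2 : F (G z + d'%:Z) <= F (G z + d'%:Z + 1) by apply: (circ_Fmono hFG); lia.
    have a3 : F (G z + d'%:Z + 1) <= F (hl z) by apply: (circ_Fmono hFG); lia.
    by move: (circ_GF hFG z); lia.
  have : h (G z + d'%:Z) <= y (G z + d'%:Z).
    rewrite /h /bad /fib fr eqxx /=.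
    have -> : cong (F (G z + d'%:Z + 1)) z.
      rewrite -fr; suff -> : F (G z + d'%:Z) = z by rewrite /cong subrr dvdz0.
      have a1 : F (G z) <= F (G z + d'%:Z) by apply: (circ_Fmono hFG); lia.
      have a3 : F (G z + d'%:Z) <= F (hl z) by apply: (circ_Fmono hFG); lia.
      by move: (circ_GF hFG z); lia.
    by rewrite andbT; case: ifP; lia.
  rewrite /y; have -> : G z + d'%:Z + 1 = G z + d'.+1%:Z by lia.
  by move=> a b; apply: le_trans (lerD b a) _; lia.
by apply.
Qed.

(** Go back from p to [q (stop p) p]: a 1-hollow leads from [q j p] to G (q j p), at most l below,
    and from there to [q j.+1 p] one stays inside a fiber. Against the long nose from [q (stop p) p]
    to p + 1 the multiples of l cancel, which leaves the 2. *)
Let chain_sum p : fib p ->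
  \sum_(j < stop p) (X (hl (q j p)) - X (G (q j p))) <= y p - 2.
Proof.
move=> fp; have := hn (stop_le p) (gc_q (leqnn _)).
have -> : (stop p = k \/ G (q (stop p) p) = G (q (stop p) p + 1) /\ F p = F (p + 1)) <-> True.
  split=> // _; case: (stop_end p) => ?; [by left|right; split=> //; exact/eqP].
move=> /(_ I); rewrite /y.
suff : forall i, (i <= stop p)%N ->
    \sum_(j < i) (X (hl (q j p)) - X (G (q j p))) <= X (q i p) + (i * l)%N%:Z - X p.
  by move=> /(_ _ (leqnn _)); lia.
elim=> [|i IH] lt; first by rewrite big_ord0 /= mul0n addr0 subrr.
rewrite big_ord_recr /=.
have h1 := hollow_le (stop_lt lt).
by apply: le_trans (lerD (IH (ltnW lt)) (lexx _)) _; rewrite -/(q i p) -/(hl _); lia.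
Qed.

(** Apply F^j to both points. If j = j' this gives p = p' modulo n. If j < j' it says that p is,
    modulo n, some [hl z], the last point of its fiber, which contradicts F p = F (p + 1). *)
Let q_inj (p p' : 'I_n) j j' : fib (p : nat)%:Z -> fib (p' : nat)%:Z ->
  (j < stop (p : nat)%:Z)%N -> (j' < stop (p' : nat)%:Z)%N -> (j <= j')%N ->
  cong (q j (p : nat)%:Z) (q j' (p' : nat)%:Z) -> p = p' /\ j = j'.
Proof.
move=> fp fp' hj hj' jj' /dvdzP[t ht].
have e : q j' (p' : nat)%:Z = q j (p : nat)%:Z + (- t) * n%:Z by lia.
have := iter_q (ltnW hj); rewrite -[in RHS](addrK (- t * n%:Z) p%:Z).
move=> e1.
have e2 : iter j F (q j' (p' : nat)%:Z) = (p : nat)%:Z + (- t) * n%:Z.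
  by rewrite e (circ_iterDM hFG) e1 addrK.
have [d dE] : exists d, j' = (j + d)%N by exists (j' - j)%N; lia.
have e3 : iter j F (q j' (p' : nat)%:Z) = q d (p' : nat)%:Z.
  rewrite dE; have : (j + d <= stop (p' : nat)%:Z)%N by lia.
  elim: (j) => //= i IH h; rewrite -iterS iterSr.
  have [h1 _] := F_hl (stop_lt h).
  by rewrite [q _ _]/= h1; apply: IH; lia.
case: d dE e3 => [|d] dE e3.
  rewrite e2 /= in e3; split; last by lia.
  apply/val_inj => /=; have lp := ltn_ord p; have lp' := ltn_ord p'.
  have t0 : - t = 0 by apply: (@mulz_small n); lia.
  by rewrite t0 mul0r in e3; lia.
have [h1 h2] := F_hl (stop_lt (p := (p' : nat)%:Z) (j := d) ltac:(lia)).
rewrite e2 in e3; rewrite -/(q d.+1 _) in h1 h2.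
move: fp; rewrite /fib => /eqP fp.
have : F ((p : nat)%:Z + - t * n%:Z) = F ((p : nat)%:Z + 1 + - t * n%:Z).
  by rewrite !(circ_FDM hFG) fp.
have e4 : (p : nat)%:Z + 1 + - t * n%:Z = hl (q d (p' : nat)%:Z) + 1.
  by rewrite -[hl _]e3; lia.
by rewrite e4 e3 -[q d.+1 _]/(hl (q d _)); lia.
Qed.

(* Sum over the set B of bad gaps: p in B is charged the bad gaps of the fibers of
   the q_j(p), and (p, j) |-> q_j(p) is injective modulo n on B. *)
Lemma fiber_gap p : F p = F (p + 1) -> X p + 2 <= X (p + 1).
Proof.
have n0 := circ_n hFG.
suff base (i : 'I_n) : ~~ bad (i : nat)%:Z.
  move=> fp; suff: ~~ bad p by rewrite /bad /fib fp eqxx /= /y; lia.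
  have badM (t z : int) : bad (z + t * n%:Z) = bad z.
    have pos (m : nat) (u : int) : bad (u + m%:Z * n%:Z) = bad u.
      elim: m => [|m IH]; first by rewrite mul0r addr0.
      by rewrite -addn1 PoszD mulrDl mul1r addrA bad_per.
    case: t => m; first exact: pos.
    by rewrite -(pos m.+1 (z + _)) NegzE mulNr subrK.
  have hi : (`|(p %% n%:Z)%Z| < n)%N by lia.
  have := base (Ordinal hi); rewrite -(badM (p %/ n%:Z)%Z) /=.
  by congr (~~ bad _); rewrite {3}(divz_eq p n%:Z); lia.
apply/negP => bi; pose B (r : 'I_n) := bad (r : nat)%:Z.
have : \sum_(p < n | B p) (y (p : nat)%:Z - 2) <
       \sum_(p < n | B p) (y (p : nat)%:Z - 2) => //; last by rewrite ltxx.
pose C (r : 'I_n) (pj : 'I_n * 'I_k) :=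
  [&& B pj.1, (pj.2 < stop (pj.1 : nat)%:Z)%N &
      cong (F (r : nat)%:Z) (q pj.2 (pj.1 : nat)%:Z)].
(* Exchange of summation: a bad r is counted once for every pair (p, j) that is charged its
   fiber. *)
have le1 : \sum_(r < n | B r) (y (r : nat)%:Z *+ #|[pred pj | C r pj]|) <=
           \sum_(p < n | B p) (y (p : nat)%:Z - 2).
  apply: (@le_trans _ _ (\sum_(p < n | B p) \sum_(j < k | (j < stop (p : nat)%:Z)%N)
     \sum_(r < n | B r && cong (F (r : nat)%:Z) (q j (p : nat)%:Z)) y (r : nat)%:Z)).
    rewrite pair_big_dep /= (exchange_big_dep B) /=; last by move=> ? ? _ /andP[].
    apply: ler_sum => r Br; rewrite sumr_const.
    rewrite le_eqVlt; apply/orP; left; apply/eqP; congr (_ *+ _).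
    by apply: eq_card => pj; rewrite /C !inE unfold_in /= Br /= andbA.
  apply: ler_sum => p' Bp'; have fp : fib p'%:Z by case/andP: Bp'.
  have := chain_sum fp.
  apply: le_trans.
  rewrite (big_ord_widen_cond k xpredT (fun j => X (hl (q j p'%:Z)) - X (G (q j p'%:Z)))) //=.
  apply: ler_sum => j hj; apply: fiber_sum; exact: stop_lt.
apply: lt_le_trans le1.
(* A bad gap y satisfies y <= 1, so m y >= y - 1 both for m = 0 and for m = 1; the difference
   between y - 1 and y - 2 gives the contradiction. *)
apply: (@lt_le_trans _ _ (\sum_(p < n | B p) (y (p : nat)%:Z - 1))).
  rewrite (bigD1 i) //= [ltRHS](bigD1 i) //=.
  rewrite ltr_leD ?ler_sum // => [|? _]; lia.
apply: ler_sum => r Br.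
have yr : y (r : nat)%:Z < 2 by case/andP: Br.
suff : (#|[pred pj | C r pj]| <= 1)%N by case: (#|_|) => [|[|//]] _; rewrite ?mulr0n ?mulr1n; lia.
apply/card_le1_eqP => -[p1 j1] [p2 j2] /and3P[/= /andP[b1 _] s1 c1] /and3P[/= /andP[b2 _] s2 c2].
have cc (a b d : int) : cong a b -> cong a d -> cong b d.
  move=> h1 h2; rewrite /cong; have -> : b - d = (a - d) - (a - b) by lia.
  exact: rpredB.
case: (leqP j1 j2) => h.
  by have [-> /val_inj ->] := q_inj b1 b2 s1 s2 h (cc _ _ _ c1 c2).
by have [-> /val_inj ->] := q_inj b2 b1 s2 s1 (ltnW h) (cc _ _ _ c2 c1).
Qed.

End Fiber.


(** * All noses and all iterates of F from the constraints of S^k *)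

Section Noses.
Variables (n c l k : nat) (F G X : int -> int).
Hypothesis hFG : circ n F G.
Hypothesis hX : shifts n c X.
Hypothesis hh : hollows F G X l.
Hypothesis hn : long_noses F G X l k.

(* The constraints are invariant under the reflection z |-> - z, which exchanges
   F and G. *)
Lemma cofiber_gap p : G p = G (p + 1) -> X p + 2 <= X (p + 1).
Proof.
move=> e; have := fiber_gap (circ_dual hFG) (shifts_dual hX)
  (hollows_dual hFG hh) (long_noses_dual hFG hn) (p := - (p + 1)).
rewrite /gdual.
have -> : - (- (p + 1) + 1) = p by lia.
have -> : - - (p + 1) = p + 1 by lia.
by rewrite e => /(_ erefl); lia.
Qed.

Let interval_le (a b : int) : a <= b ->
  (forall r : int, a <= r < b -> X r <= X (r + 1)) -> X a <= X b.
Proof.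
move=> ab h; have [d hd] : exists d : nat, b = a + d%:Z.
  by exists `|b - a|%N; lia.
rewrite hd; have : (d%:Z <= b - a) by lia.
elim: d {hd} => [|d IH] hd; first by rewrite addr0.
have hr : a <= a + d%:Z < b by lia.
have := h _ hr; have -> : a + d%:Z + 1 = a + d.+1%:Z by lia.
by have := IH ltac:(lia); lia.
Qed.

(** G (F a) is the first point of the fiber of a, so a 1-hollow bounds X (F a) by X (G (F a)) + l,
    and from there to a the gaps lie inside the fiber, where [fiber_gap] makes X increasing. *)
Lemma forward_le a : X (F a) <= X a + l%:Z.
Proof.
have Ga := circ_FG hFG a; have Gb := circ_GF hFG (F a).
have Fa : F (G (F a)) = F a by have := circ_Fmono hFG Ga; lia.
have l1 : X (G (F a)) <= X a.
  apply: interval_le => // r hr.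
  suff /fiber_gap : F r = F (r + 1) by move=> /(_ n c l k G X hFG hX hh hn); lia.
  have r1 := circ_Fmono hFG (a := G (F a)) (b := r) ltac:(lia).
  have r2 := circ_Fmono hFG (a := r) (b := r + 1) ltac:(lia).
  by have := circ_Fmono hFG (a := r + 1) (b := a) ltac:(lia); lia.
case: (F (G (F a)) =P G (F a)) => [e|/eqP ne]; first by rewrite -e Fa in l1; lia.
by have := hh ne; rewrite Fa => /(_ erefl); lia.
Qed.

(** Mirror image: a and F (G a) lie in one fiber of [G], where [cofiber_gap] makes X increasing, and
    F (G a), unless it equals G a, is the tail of the 1-hollow into G a. *)
Lemma backward_le a : X a <= X (G a) + l%:Z.
Proof.
have Ga := circ_FG hFG (G a); have Gb := circ_GF hFG a.
have Fa : G (F (G a)) = G a by have := circ_Gmono hFG Gb; lia.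
have l1 : X a <= X (F (G a)).
  apply: interval_le => // r hr.
  suff /cofiber_gap : G r = G (r + 1) by lia.
  have r1 := circ_Gmono hFG (a := a) (b := r) ltac:(lia).
  have r2 := circ_Gmono hFG (a := r) (b := r + 1) ltac:(lia).
  by have := circ_Gmono hFG (a := r + 1) (b := F (G a)) ltac:(lia); lia.
case: (F (G a) =P G a) => [e|/eqP ne]; first by rewrite e in l1; lia.
by have := hh ne Fa; lia.
Qed.

(* A short nose is implied by the (i+1)-nose that extends it at either end. *)
Lemma all_noses i a p : (i <= k)%N -> gc F G i a p ->
  X a + (i * l)%N%:Z + 2 <= X (p + 1).
Proof.
move=> ik; have [d dE] : exists d, k = (i + d)%N by exists (k - i)%N; lia.
elim: d i ik dE a p => [|d IH] i ik dE a p g.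
  by apply: hn => //; left; lia.
have step b q : gc F G i.+1 b q -> X b + (i.+1 * l)%N%:Z + 2 <= X (q + 1).
  by move=> h; have := IH i.+1 ltac:(lia) ltac:(lia) _ _ h.
have G1 := circ_Gmono hFG (a := a) (b := a + 1) ltac:(lia).
have F1 := circ_Fmono hFG (a := p) (b := p + 1) ltac:(lia).
case: (G a =P G (a + 1)) => [eG|nG]; last first.
  have e : F (G (a + 1) - 1) = a.
    have := circ_adj hFG a (G (a + 1) - 1).
    by have := circ_adj hFG (a + 1) (G (a + 1) - 1); lia.
  have := @step (G (a + 1) - 1) p; rewrite /= e subrK => /(_ (conj erefl g)).
  by have := forward_le (G (a + 1) - 1); rewrite e mulSn; lia.
case: (F p =P F (p + 1)) => [eF|nF]; first by apply: hn => //; right.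
have e : G (F p + 1) = p + 1.
  have := circ_adj hFG (F p + 1) (p + 1).
  by have := circ_adj hFG (F p + 1) p; lia.
have := @step _ _ (gc_rcons g e).
by have := backward_le (F p + 1); rewrite e mulSn; lia.
Qed.

Lemma gap_ge2 p : X p + 2 <= X (p + 1).
Proof. by have := @all_noses 0 p p isT erefl; rewrite mul0n addr0. Qed.

Lemma solution_mono (a b : int) : a <= b -> X a <= X b.
Proof. by move=> ab; apply: interval_le => // r _; have := gap_ge2 r; lia. Qed.

Lemma iter_forward_le i a : X (iter i F a) <= X a + (i * l)%N%:Z.
Proof.
elim: i => [|i IH]; first by rewrite mul0n addr0.
by have := forward_le (iter i F a); rewrite [iter i.+1 _ _]/= mulSn; lia.
Qed.

(** The i-nose into F^i a + 1 may not exist, and if it does it may start beyond a. The chain that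
    goes back from F^i a by H_l stays at or beyond the orbit of a. While it is on the orbit it can
    be prolonged, because the fiber is not empty; once it is strictly beyond, after j steps, its
    j-nose is joined to the inequality for i - j. *)
Lemma iter_gap i a : (i <= k)%N ->
  X a + (i * l)%N%:Z + 2 <= X (iter i F a + 1).
Proof.
elim/ltn_ind: i a => i IH a ik.
suff back j : (j <= i)%N ->
    X a + (i * l)%N%:Z + 2 <= X (iter i F a + 1) \/
    exists2 q, iter (i - j) F a <= q & gc F G j q (iter i F a).
  have [//|[q]] := back i (leqnn i).
  rewrite subnn /= => aq /(all_noses ik).
  by have := solution_mono aq; lia.
elim: j => [|j IHj] ji.
  by right; exists (iter i F a); rewrite ?subn0.
have [|[q]] := IHj (ltnW ji); first by left.
have eI : iter (i - j) F a = F (iter (i - j.+1) F a) by rewrite -iterS; congr iter; lia.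
rewrite eI => aq gq; set b := iter (i - j.+1) F a in eI aq *.
have [eq|lt] : q = F b \/ F b + 1 <= q by lia.
  right; have FG1 : b <= G (q + 1) - 1.
    have := circ_adj hFG (q + 1) b; rewrite eq; lia.
  exists (G (q + 1) - 1) => //=; rewrite subrK.
  have -> : F (G (q + 1) - 1) = q by
    have := circ_Fmono hFG FG1; have := circ_adj hFG (q + 1) (G (q + 1) - 1); lia.
  by [].
(* After 0 steps the chain is still at F^i a itself, so j > 0 and the induction hypothesis applies
   to i - j. *)
have [j0|j0] : j = 0%N \/ (0 < j)%N by lia.
  by move: gq eI aq lt; rewrite j0 subn0 /= => -> ->; lia.
left; have := IH (i - j)%N ltac:(lia) a ltac:(lia).
rewrite eI => h1; have h2 := all_noses (leq_trans (ltnW ji) ik) gq.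
have h3 := solution_mono lt.
have -> : (i * l = (i - j) * l + j * l)%N by rewrite -mulnDl subnK // ltnW.
lia.
Qed.

End Noses.

(** * Lifting the circle to the line *)

Section Residues.
Variables (n : nat) (n0 : (0 < n)%N).

Lemma res_subproof (z : int) : (`|(z %% n%:Z)%Z| < n)%N.
Proof. by have := n0; lia. Qed.

Definition res (z : int) : 'I_n := Ordinal (res_subproof z).

Lemma resE (z : int) : z = (res z : nat)%:Z + (z %/ n%:Z)%Z * n%:Z.
Proof. by have := divz_eq z n%:Z; have := n0; rewrite /=; lia. Qed.

Lemma res_unique (z t : int) (i : 'I_n) :
  z = (i : nat)%:Z + t * n%:Z -> res z = i /\ (z %/ n%:Z)%Z = t.
Proof.
move=> e; have e2 := resE z.
have h1 := ltn_ord i; have h2 := ltn_ord (res z).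
have t0 : (z %/ n%:Z)%Z - t = 0 by apply: (@mulz_small n); lia.
have t1 : (z %/ n%:Z)%Z = t by lia.
by split=> //; apply/val_inj; rewrite t1 in e2; move: e2 e => /=; lia.
Qed.

Lemma res_id (i : 'I_n) : res (i : nat)%:Z = i.
Proof. by have [] := @res_unique (i : nat)%:Z 0 i ltac:(lia). Qed.

Lemma div_id (i : 'I_n) : ((i : nat)%:Z %/ n%:Z)%Z = 0.
Proof. by have [] := @res_unique (i : nat)%:Z 0 i ltac:(lia). Qed.

Lemma resDM (z t : int) : res (z + t * n%:Z) = res z.
Proof.
by have [] := @res_unique (z + t * n%:Z) ((z %/ n%:Z)%Z + t) (res z)
  ltac:(have := resE z; lia).
Qed.

Lemma divDM (z t : int) : ((z + t * n%:Z) %/ n%:Z)%Z = (z %/ n%:Z)%Z + t.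
Proof.
by have [] := @res_unique (z + t * n%:Z) ((z %/ n%:Z)%Z + t) (res z)
  ltac:(have := resE z; lia).
Qed.

Lemma resD z : res (z + n%:Z) = res z.
Proof. by have := resDM z 1; rewrite mul1r. Qed.

Lemma divD z : ((z + n%:Z) %/ n%:Z)%Z = (z %/ n%:Z)%Z + 1.
Proof. by have := divDM z 1; rewrite mul1r. Qed.

Lemma res_eqP (a b : int) : res a = res b -> exists t : int, a = b + t * n%:Z.
Proof.
move=> e; exists ((a %/ n%:Z)%Z - (b %/ n%:Z)%Z).
by have := resE a; have := resE b; rewrite e; lia.
Qed.

Lemma res_succ (z : int) : ordS (res z) = res (z + 1).
Proof.
have h := ltn_ord (res z); have e := resE z; apply/esym.
have [lt|eq] : ((res z).+1 < n)%N \/ (res z).+1 = n :> nat by lia.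
  have e2 : z + 1 = (ordS (res z) : nat)%:Z + (z %/ n%:Z)%Z * n%:Z.
    by rewrite [nat_of_ord (ordS _)]/= modn_small //; lia.
  by have [->] := res_unique e2.
have e2 : z + 1 = (ordS (res z) : nat)%:Z + ((z %/ n%:Z)%Z + 1) * n%:Z.
  by rewrite [nat_of_ord (ordS _)]/= eq modnn; lia.
by have [->] := res_unique e2.
Qed.

Lemma res_pred (z : int) : ord_pred (res z) = res (z - 1).
Proof.
by have := res_succ (z - 1); rewrite subrK => <-; rewrite ordSK.
Qed.

Lemma iter_succ j z : iter j (@ordS n) (res z) = res (z + j%:Z).
Proof.
elim: j => [|j IH]; first by rewrite addr0.
by rewrite iterS IH res_succ; congr res; lia.
Qed.

Lemma iter_pred j z : iter j (@ord_pred n) (res z) = res (z - j%:Z).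
Proof.
elim: j => [|j IH]; first by rewrite subr0.
by rewrite iterS IH res_pred; congr res; lia.
Qed.

(** This is the form of the maxima in [Fl] and [Fr]: they end the longest initial run of [Q], cut
    off at n - 1. By [Q 0] the maximum is attained. *)
Lemma bigmax_prefix (Q : nat -> bool) : Q 0%N ->
  let m := (\max_(m < n | [forall j : 'I_n, (j <= m)%N ==> Q j]) m)%N in
  [/\ (m < n)%N, (forall j, (j <= m)%N -> Q j) & (m.+1 < n)%N -> ~~ Q m.+1].
Proof.
move=> Q0 m; pose C (i : 'I_n) := [forall j : 'I_n, (j <= i)%N ==> Q j].
have C0 : C (Ordinal n0).
  by apply/forallP => j; apply/implyP => /=; rewrite leqn0 => /eqP ->.
have [i Ci mi] : {i | C i & m = i}.
  by apply: eq_bigmax_cond; apply/card_gt0P; exists (Ordinal n0).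
have le j : (j <= m)%N -> Q j.
  move=> jm; have jn : (j < n)%N by rewrite mi in jm; have := ltn_ord i; lia.
  by move/forallP: Ci => /(_ (Ordinal jn)) /implyP; apply; rewrite -mi.
split=> //; first by rewrite mi ltn_ord.
move=> mn; apply/negP => Qm.
suff Cm : C (Ordinal mn).
  by have := @leq_bigmax_cond _ C (fun i => i : nat) _ Cm; rewrite -/m /= ltnn.
apply/forallP => j; apply/implyP => /=; rewrite leq_eqVlt => /orP[/eqP ->//|].
by rewrite ltnS; exact: le.
Qed.

End Residues.

Section Lift.
Variables (R : realType) (M : model R).
Hypothesis hM : is_pca M.
Hypothesis n0 : (0 < narcs M)%N.
Local Notation n := (narcs M).
Local Notation rs := (res n0).

Definition lbeg (z : int) : R := beg (rs z) + len M * (z %/ n%:Z)%Z%:~R.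
Definition lfin (z : int) : R := lbeg z + arc_len (rs z).

Lemma len_gt0 : 0 < len M. Proof. by case: hM. Qed.
Lemma beg_circle (i : 'I_n) : on_circle M (beg i). Proof. by case: hM => _ /(_ i) []. Qed.
Lemma fin_circle (i : 'I_n) : on_circle M (fin i). Proof. by case: hM => _ /(_ i) []. Qed.

Lemma cw_unique (p q d : R) (t : int) : on_circle M p -> on_circle M q ->
  0 <= d < len M -> d = q - p + len M * t%:~R -> cw M p q = d.
Proof.
move=> /andP[p0 p1] /andP[q0 q1] /andP[d0 d1] e; have l0 := len_gt0.
have [t1 t2] : -1 < t < 2 /\ true.
  rewrite -!(ltr_int R); split=> //; apply/andP; split; nra.
have [t0|t0] : t = 0 \/ t = 1 by lia.
  by rewrite /cw; case: (lerP p q) => h; rewrite t0 in e; lra.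
by rewrite /cw; case: (lerP p q) => h; rewrite t0 in e; lra.
Qed.

Lemma cw_range (p q : R) : on_circle M p -> on_circle M q -> 0 <= cw M p q < len M.
Proof.
move=> /andP[p0 p1] /andP[q0 q1]; have l0 := len_gt0.
by rewrite /cw; case: (lerP p q) => h; apply/andP; split; lra.
Qed.

Lemma cw_eq (p q : R) : exists t : int, cw M p q = q - p + len M * t%:~R.
Proof.
rewrite /cw; case: (lerP p q) => h.
  by exists 0; rewrite mulr0z mulr0 addr0.
by exists 1; rewrite mulr1z mulr1.
Qed.

Lemma lbegE (i : 'I_n) : lbeg (i : nat)%:Z = beg i.
Proof. by rewrite /lbeg res_id div_id // mulr0z mulr0 addr0. Qed.

Lemma lbegDM (z t : int) : lbeg (z + t * n%:Z) = lbeg z + len M * t%:~R.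
Proof. by rewrite /lbeg resDM divDM // intrD mulrDr addrA. Qed.

Lemma lbegD (z : int) : lbeg (z + n%:Z) = lbeg z + len M.
Proof. by have := lbegDM z 1; rewrite mul1r mulr1. Qed.

Lemma lbeg_succ (z : int) : lbeg z < lbeg (z + 1).
Proof.
have [i [t ->]] : exists (i : 'I_n) (t : int), z = (i : nat)%:Z + t * n%:Z.
  by exists (rs z), (z %/ n%:Z)%Z; exact: resE.
have -> : (i : nat)%:Z + t * n%:Z + 1 = (i : nat)%:Z + 1 + t * n%:Z by lia.
rewrite !lbegDM ltrD2r lbegE; have := ltn_ord i.
rewrite leq_eqVlt => /orP[/eqP e|lt].
  have -> : (i : nat)%:Z + 1 = (Ordinal n0 : nat)%:Z + n%:Z by rewrite /=; lia.
  rewrite lbegD lbegE; have /andP[_ h] := beg_circle i.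
  by have /andP[h2 _] := beg_circle (Ordinal n0); lra.
have -> : (i : nat)%:Z + 1 = (Ordinal lt : nat)%:Z by rewrite /=; lia.
by rewrite lbegE; case: hM => _ _ h _ _; apply: h => /=.
Qed.

Lemma lbeg_lt (a b : int) : (lbeg a < lbeg b) = (a < b).
Proof.
have mono (a' : int) (d : nat) : lbeg a' <= lbeg (a' + d%:Z).
  elim: d => [|d IH]; first by rewrite addr0.
  have -> : a' + d.+1%:Z = a' + d%:Z + 1 by lia.
  by apply: le_trans IH (ltW (lbeg_succ _)).
have le (a' b' : int) : a' <= b' -> lbeg a' <= lbeg b'.
  by move=> h; have := mono a' `|b' - a'|%N; have -> : a' + `|b' - a'|%N%:Z = b' by lia.
case: (ltrP a b) => h; last by apply/negbTE; rewrite -leNgt; exact: le.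
by apply: lt_le_trans (lbeg_succ a) _; apply: le; lia.
Qed.

Lemma lbeg_le (a b : int) : (lbeg a <= lbeg b) = (a <= b).
Proof. by rewrite leNgt lbeg_lt -leNgt. Qed.

Lemma cw_lift (z : int) (q d : R) (t : int) : on_circle M q ->
  0 <= d < len M -> lbeg z + d = q + len M * t%:~R -> cw M (beg (rs z)) q = d.
Proof.
move=> hq hd e.
apply: (@cw_unique _ _ _ (t - (z %/ n%:Z)%Z)) => //; first exact: beg_circle.
by move: e; rewrite /lbeg intrB; lra.
Qed.

Lemma cw_lbeg (a b : int) : a <= b < a + n%:Z ->
  cw M (beg (rs a)) (beg (rs b)) = lbeg b - lbeg a.
Proof.
move=> /andP[ab ba]; apply: (@cw_lift _ _ _ (b %/ n%:Z)%Z).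
- exact: beg_circle.
- by rewrite subr_ge0 lbeg_le ab ltrBlDl -lbegD lbeg_lt.
by rewrite addrC subrK.
Qed.

Lemma arc_len_range (i : 'I_n) : 0 < arc_len i < len M.
Proof.
have := cw_range (beg_circle i) (fin_circle i); rewrite -/(arc_len i).
case/andP => h1 ->; rewrite andbT lt_neqAle h1 andbT eq_sym.
have ne : beg i <> fin i by case: hM => _ _ _ [_ h] _.
have /andP[b0 b1] := beg_circle i; have /andP[f0 f1] := fin_circle i.
by apply/eqP; rewrite /arc_len /cw; case: (lerP (beg i) (fin i)) => h e; [apply: ne|]; lra.
Qed.

Lemma lfinDM (z t : int) : lfin (z + t * n%:Z) = lfin z + len M * t%:~R.
Proof. by rewrite /lfin resDM lbegDM addrAC. Qed.

Lemma lfinD (z : int) : lfin (z + n%:Z) = lfin z + len M.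
Proof. by rewrite /lfin resD // lbegD addrAC. Qed.

Lemma lfin_mod (z : int) : exists t : int, lfin z = fin (rs z) + len M * t%:~R.
Proof.
have [t e] := cw_eq (beg (rs z)) (fin (rs z)).
exists (t + (z %/ n%:Z)%Z); rewrite /lfin /arc_len e /lbeg intrD; lra.
Qed.

Lemma lfin_neq (a b : int) : lbeg a <> lfin b.
Proof.
have [t ->] := lfin_mod b; rewrite /lbeg => e.
have ne : beg (rs a) <> fin (rs b) by case: hM => _ _ _ [_ h] _.
have /andP[b0 b1] := beg_circle (rs a); have /andP[f0 f1] := fin_circle (rs b).
have l0 := len_gt0; set s := (a %/ n%:Z)%Z in e.
have e2 : beg (rs a) - fin (rs b) = len M * (t - s)%:~R by rewrite intrB; lra.
have h1 : -1 < t - s < 1.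
  rewrite -!(ltr_int R); apply/andP; split; nra.
have h2 : t - s = 0 by lia.
by rewrite h2 in e2; apply: ne; lra.
Qed.

(** If the end of arc z + 1 did not come after that of arc z, arc z + 1 would be included in arc z.
    For n = 1 both are the same arc, and the period decides. *)
Lemma lfin_succ (z : int) : lfin z < lfin (z + 1).
Proof.
have l0 := len_gt0.
rewrite ltNge; apply/negP => le.
case: (rs z =P rs (z + 1)) => [e|ne].
  have [t ht] := res_eqP e.
  have e1 : t * n%:Z = -1 by lia.
  have n1 : n = 1%N.
    have [n2|] := ltnP 1 n; last by move: (n0); lia.
    by have t0 := @mulz_small n t ltac:(lia); rewrite t0 in e1; lia.
  by have := lfinD z; rewrite n1 => h; lra.
case: hM => _ _ _ _ /(_ (rs (z + 1)) (rs z) (nesym ne)); apply=> p hp.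
rewrite /arc /in_arc -!/(arc_len _) => /andP[c1 c2].
have [t ht] := cw_eq (beg (rs (z + 1))) p.
have lt := lbeg_succ z; have /andP[_ a1] := arc_len_range (rs z).
have e : cw M (beg (rs z)) p = lbeg (z + 1) - lbeg z + cw M (beg (rs (z + 1))) p.
  apply: (@cw_lift _ _ _ (((z + 1) %/ n%:Z)%Z + t)) => //.
    by move: le; rewrite /lfin; lra.
  have e1 : lbeg (z + 1) = beg (rs (z + 1)) + len M * ((z + 1) %/ n%:Z)%Z%:~R by [].
  by rewrite ht intrD; lra.
by rewrite e; move: le; rewrite /lfin; lra.
Qed.

Lemma lfin_lt (a b : int) : (lfin a < lfin b) = (a < b).
Proof.
have mono (a' : int) (d : nat) : lfin a' <= lfin (a' + d%:Z).
  elim: d => [|d IH]; first by rewrite addr0.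
  have -> : a' + d.+1%:Z = a' + d%:Z + 1 by lia.
  by apply: le_trans IH (ltW (lfin_succ _)).
have le (a' b' : int) : a' <= b' -> lfin a' <= lfin b'.
  by move=> h; have := mono a' `|b' - a'|%N; have -> : a' + `|b' - a'|%N%:Z = b' by lia.
case: (ltrP a b) => h; last by apply/negbTE; rewrite -leNgt; exact: le.
by apply: lt_le_trans (lfin_succ a) _; apply: le; lia.
Qed.

Lemma lfin_le (a b : int) : (lfin a <= lfin b) = (a <= b).
Proof. by rewrite leNgt lfin_lt -leNgt. Qed.

End Lift.

Section LiftedNeighbours.
Variables (R : realType) (M : model R).
Hypothesis hM : is_pca M.
Hypothesis n0 : (0 < narcs M)%N.
Local Notation n := (narcs M).
Local Notation rs := (res n0).
Local Notation P := (lbeg n0).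
Local Notation T := (lfin n0).

Definition mr (i : 'I_n) : nat := (\max_(m < n | [forall j : 'I_n, (j <= m)%N ==>
          (let s := beg (iter j (@Rt R M) i) in arc i s || (s == beg i))]) m)%N.

Definition ml (i : 'I_n) : nat := (\max_(m < n | [forall j : 'I_n, (j <= m)%N ==>
          (let t := fin (iter j (@Lf R M) i) in arc i t || (t == fin i))]) m)%N.

(** [Fr] on the circle forgets full turns; the number of steps [mr] does not, so it determines the
    lift. *)
Definition lF (z : int) : int := z + (mr (rs z))%:Z.
Definition lG (z : int) : int := z - (ml (rs z))%:Z.

Lemma Fr_lift z : Fr (rs z) = rs (lF z).
Proof. exact: (iter_succ n0). Qed.

Lemma Fl_lift z : Fl (rs z) = rs (lG z).
Proof. exact: (iter_pred n0). Qed.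

(** For j < n the point z + j begins within one turn of z, so membership on the circle is an
    inequality on the line. The disjunct [s == beg] contributes only j = 0. *)
Lemma mr_cond z (j : nat) : (j < n)%N ->
  (let s := beg (iter j (@Rt R M) (rs z)) in arc (rs z) s || (s == beg (rs z))) =
  (P (z + j%:Z) < T z).
Proof.
move=> jn; have -> : iter j (@Rt R M) (rs z) = rs (z + j%:Z) by exact: iter_succ.
have c : cw M (beg (rs z)) (beg (rs (z + j%:Z))) = P (z + j%:Z) - P z.
  by apply: cw_lbeg => //; lia.
have /andP[a0 a1] := arc_len_range hM (rs z).
rewrite /arc /in_arc -/(arc_len _) c subr_gt0 lbeg_lt //.
have -> : (P (z + j%:Z) - P z < arc_len (rs z)) = (P (z + j%:Z) < T z).
  by rewrite ltrBlDl.
case: j jn c => [|j] jn c.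
  by rewrite addr0 eqxx orbT /lfin ltrDl a0.
have -> : z < z + j.+1%:Z by lia.
rewrite /=; case: eqP => [e|]; last by rewrite orbF.
have : P z < P (z + j.+1%:Z) by rewrite lbeg_lt //; lia.
suff : P (z + j.+1%:Z) - P z = 0 by lra.
by rewrite -c e /cw lexx subrr.
Qed.

Lemma lF_spec z : P (lF z) < T z < P (lF z + 1).
Proof.
have Q0 : (let s := beg (iter 0 (@Rt R M) (rs z)) in arc (rs z) s || (s == beg (rs z))).
  by rewrite /= eqxx orbT.
have /= [m1 m2 m3] := bigmax_prefix n0 (Q := fun j =>
  let s := beg (iter j (@Rt R M) (rs z)) in arc (rs z) s || (s == beg (rs z))) Q0.
rewrite -/(mr (rs z)) in m1 m2 m3.
apply/andP; split; first by rewrite -mr_cond //; exact: m2.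
rewrite lt_neqAle; apply/andP; split.
  by apply/eqP => e; exact: (@lfin_neq _ _ hM n0 (lF z + 1) z).
have -> : lF z + 1 = z + (mr (rs z)).+1%:Z by rewrite /lF; lia.
have [lt|ge] := ltnP (mr (rs z)).+1 n.
  by rewrite leNgt -mr_cond //; exact: m3.
(* The run was cut off at n - 1; the next beginning is the second copy of that of z, beyond the end
   of the arc. *)
have -> : (mr (rs z)).+1 = n by lia.
rewrite lbegD; have /andP[_ a1] := arc_len_range hM (rs z).
by rewrite /lfin; lra.
Qed.

Lemma lF_unique z q : P q < T z < P (q + 1) -> lF z = q.
Proof.
case/andP=> h1 h2; have /andP[h3 h4] := lF_spec z.
have : P (lF z) < P (q + 1) by apply: lt_trans h3 h2.
have : P q < P (lF z + 1) by apply: lt_trans h1 h4.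
by rewrite !lbeg_lt //; lia.
Qed.

Lemma le_lF z q : (q <= lF z) = (P q < T z).
Proof.
have /andP[h1 h2] := lF_spec z; case: (lerP q (lF z)) => h.
  by apply/esym; apply: le_lt_trans h1; rewrite lbeg_le.
apply/esym/negbTE; rewrite -leNgt; apply: ltW; apply: lt_le_trans h2 _.
by rewrite lbeg_le //; lia.
Qed.

(** The end T (z - j) lies in the last turn up to T z. If it comes before P z, its next copy on the
    line is already beyond T z, so no copy is in the arc. *)
Lemma ml_cond z (j : nat) : (j < n)%N ->
  (let t := fin (iter j (@Lf R M) (rs z)) in arc (rs z) t || (t == fin (rs z))) =
  (P z < T (z - j%:Z)).
Proof.
move=> jn; have -> : iter j (@Lf R M) (rs z) = rs (z - j%:Z) by exact: iter_pred.
have [t ht] := lfin_mod n0 (z - j%:Z).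
have /andP[a0 a1] := arc_len_range hM (rs z).
have /andP[b0 b1] := arc_len_range hM (rs (z - j%:Z)).
have l1 : T (z - j%:Z) <= T z by rewrite lfin_le //; lia.
have l2 : T z < T (z - j%:Z) + len M by rewrite -lfinD lfin_lt //; lia.
have l3 : P z < P (z - j%:Z) + len M by rewrite -lbegD // lbeg_lt //; lia.
rewrite /arc /in_arc -/(arc_len _).
case: (ltrP (P z) (T (z - j%:Z))) => h.
  have c : cw M (beg (rs z)) (fin (rs (z - j%:Z))) = T (z - j%:Z) - P z.
    apply: (cw_lift hM (t := t)); first exact: fin_circle.
      have tl : T z = P z + arc_len (rs z) by [].
      by apply/andP; split; lra.
    by rewrite -ht addrC subrK.
  rewrite c subr_gt0 h ltrBlDl -/(lfin n0 z) lfin_lt //.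
  case: j jn ht b0 b1 l1 l2 l3 h c => [|j] *; last by have -> : z - j.+1%:Z < z by lia.
  by rewrite subr0 eqxx orbT.
have h' : T (z - j%:Z) < P z.
  by rewrite lt_neqAle h andbT; apply/eqP => e; exact: (@lfin_neq _ _ hM n0 z (z - j%:Z)).
have c : cw M (beg (rs z)) (fin (rs (z - j%:Z))) = T (z - j%:Z) + len M - P z.
  apply: (cw_lift hM (t := t + 1)); first exact: fin_circle.
    have tl : T (z - j%:Z) = P (z - j%:Z) + arc_len (rs (z - j%:Z)) by [].
    by apply/andP; split; lra.
  by rewrite intrD mulr1z; lra.
rewrite c; have -> : (T (z - j%:Z) + len M - P z < arc_len (rs z)) = false.
  by apply/negbTE; rewrite -leNgt; move: l2; rewrite /lfin; lra.
rewrite andbF /=; apply/negbTE/eqP => e.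
have e2 : cw M (beg (rs z)) (fin (rs z)) = T (z - j%:Z) + len M - P z by rewrite -e.
by move: l2; rewrite {1}/lfin /arc_len e2; lra.
Qed.

(** Both sides mean P z < T q, since [lG z] is the least w with P z < T w. *)
Lemma lG_adj z q : (lG z <= q) = (z <= lF q).
Proof.
have Q0 : (let t := fin (iter 0 (@Lf R M) (rs z)) in arc (rs z) t || (t == fin (rs z))).
  by rewrite /= eqxx orbT.
have /= [m1 m2 m3] := bigmax_prefix n0 (Q := fun j =>
  let t := fin (iter j (@Lf R M) (rs z)) in arc (rs z) t || (t == fin (rs z))) Q0.
rewrite -/(ml (rs z)) in m1 m2 m3.
have h1 : P z < T (lG z) by rewrite -ml_cond //; exact: m2.
have h2 : T (lG z - 1) <= P z.
  have -> : lG z - 1 = z - (ml (rs z)).+1%:Z by rewrite /lG; lia.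
  have [lt|ge] := ltnP (ml (rs z)).+1 n.
    by rewrite leNgt -ml_cond //; exact: m3.
  have -> : (ml (rs z)).+1 = n by lia.
  have e : T z = T (z - n%:Z) + len M by rewrite -lfinD // subrK.
  have /andP[_ a1] := arc_len_range hM (rs z).
  by move: e; rewrite {1}/lfin; lra.
rewrite le_lF; case: (lerP (lG z) q) => h.
  by apply/esym; apply: lt_le_trans h1 _; rewrite lfin_le.
apply/esym/negbTE; rewrite -leNgt; apply: le_trans h2.
by rewrite lfin_le //; lia.
Qed.

Lemma lift_circ : circ n lF lG.
Proof.
split=> // [z|z|z q]; last exact: lG_adj.
  by rewrite /lF resD; lia.
have Q0 : (let s := beg (iter 0 (@Rt R M) (rs z)) in arc (rs z) s || (s == beg (rs z))).
  by rewrite /= eqxx orbT.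
have /= [m1 _ _] := bigmax_prefix n0 (Q := fun j =>
  let s := beg (iter j (@Rt R M) (rs z)) in arc (rs z) s || (s == beg (rs z))) Q0.
by rewrite -/(mr (rs z)) in m1; rewrite /lF; lia.
Qed.

Lemma Fr_iter_lift j z : Fr_iter j (rs z) = rs (iter j lF z).
Proof. by elim: j => //= j; rewrite /Fr_iter /= => ->; exact: Fr_lift. Qed.

Lemma Hl_lift z :
  Hl (rs z) = if lG z == lG (z + 1) then None else Some (rs (lG (z + 1) - 1)).
Proof.
have hc := lift_circ.
rewrite /Hl; case: pickP => [x /andP[/eqP h1 h2]|none].
  have [u xu] : exists u, x = rs u by exists (x : nat)%:Z; rewrite res_id.
  move: h1; rewrite xu Fr_lift => /(@res_eqP _ n0) [t ht].
  have [w [xw Fw]] : exists w, x = rs w /\ lF w = z.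
    exists (u + (- t) * n%:Z); rewrite resDM; split=> //.
    by rewrite (circ_FDM hc) ht; lia.
  have b1 := circ_F hc w; have b2 := circ_F hc (w + 1).
  have m1 := circ_Fmono hc (a := w) (b := w + 1) ltac:(lia).
  have ne : lF (w + 1) <> z.
    move=> e; move: h2; rewrite xw /Rt res_succ Fr_lift e eqxx /= => /eqP.
    by move=> /(@res_eqP _ n0) [s hs]; have := @mulz_small n s ltac:(lia); move=> s0; rewrite s0 in hs; lia.
  have e1 : lG (z + 1) = w + 1.
    by have := circ_adj hc (z + 1) w; have := circ_adj hc (z + 1) (w + 1); lia.
  have e2 : lG z <= w by have := circ_adj hc z w; lia.
  case: eqP => [|_]; first by lia.
  by rewrite -xu xw e1 addrK.
case: eqP => // ne; exfalso; set q := lG (z + 1) - 1.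
have m1 := circ_Gmono hc (a := z) (b := z + 1) ltac:(lia).
have Fq : lF q = z.
  by have := circ_adj hc z q; have := circ_adj hc (z + 1) q; rewrite /q; lia.
have Fq1 : z + 1 <= lF (q + 1) by have := circ_adj hc (z + 1) (q + 1); rewrite /q; lia.
have := none (rs q); rewrite Fr_lift Fq eqxx /= /Rt res_succ Fr_lift => /negbT.
rewrite negb_or negbK => /andP[/eqP e /eqP ne2].
(* If the point after the fiber has the same image modulo n, then [F] jumps there by at least a full
   turn, which forces q = z: this is the disjunct [a == i] in [Hl]. *)
have [t ht] := res_eqP e; have b1 := circ_F hc q; have b2 := circ_F hc (q + 1).
have t1 : ~ t <= 0 by move=> t0; have := n0; nia.
have t2 : 1 <= t by lia.
apply: ne2; congr res; suff : n%:Z <= t * n%:Z by lia.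
by nia.
Qed.

(** Only the existence of H_r matters, because H_r enters the constraints only through shortness. *)
Lemma Hr_lift z : Hr (rs z) <> None <-> lF (z - 1) < lF z.
Proof.
have hc := lift_circ.
rewrite /Hr; case: pickP => [x /andP[/eqP h1 h2]|none]; split=> // h.
  have [u xu] : exists u, x = rs u by exists (x : nat)%:Z; rewrite res_id.
  move: h1; rewrite xu Fl_lift => /(@res_eqP _ n0) [t ht].
  have [w [xw Gw]] : exists w, x = rs w /\ lG w = z.
    exists (u + (- t) * n%:Z); rewrite resDM; split=> //.
    have := circ_FDM (circ_dual hc) (- u) t; rewrite /gdual.
    have -> : - (- u + t * n%:Z) = u + - t * n%:Z by lia.
    by rewrite opprK; lia.
  have := circ_adj hc w z; have := circ_adj hc w (z - 1).
  lia.
exfalso; set q := lF (z - 1) + 1.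
have Gq : lG q = z.
  by have := circ_adj hc q z; have := circ_adj hc q (z - 1); rewrite /q; lia.
have Gq1 : lG (q - 1) <= z - 1 by have := circ_adj hc (q - 1) (z - 1); rewrite /q; lia.
have := none (rs q); rewrite Fl_lift Gq eqxx /= /Lf res_pred Fl_lift => /negbT.
rewrite negb_or negbK => /andP[/eqP e /eqP ne2].
have [t ht] := res_eqP e; have b1 := circ_G hc q; have b2 := circ_G hc (q - 1).
have t2 : t <= -1 by have := n0; nia.
apply: ne2; congr res; suff : t * n%:Z <= - n%:Z by lia.
by nia.
Qed.

End LiftedNeighbours.

(** * Equivalence of models read from their lifts *)

Section Equivalence.
Variable R : realType.

(* T is a lift of the ending points of M to the line and F the corresponding
   lift of F_r; the last clause is the lifted form of [zero_at_initial]. *)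
Definition lifts (M : model R) (n0 : (0 < narcs M)%N) (F : int -> int)
    (T : int -> R) : Prop :=
  [/\ (forall a b, (lbeg n0 a < lbeg n0 b) = (a < b)),
      (forall z, lbeg n0 (F z) < T z < lbeg n0 (F z + 1)),
      (forall z, T z < T (z + 1)) /\ (forall z, T (z + (narcs M)%:Z) = T z + len M),
      (forall i : 'I_(narcs M), fin i = wrap M (T (i : nat)%:Z)) &
      (forall i : 'I_(narcs M),
         (F (i : nat)%:Z < (narcs M)%:Z) = (T (i : nat)%:Z < len M))].

Section LiftsTheory.
Variables (M : model R) (n0 : (0 < narcs M)%N) (F : int -> int) (T : int -> R).
Hypothesis hL : lifts n0 F T.
Local Notation n := (narcs M).

Lemma lifts_T (a b : int) : (T a < T b) = (a < b).
Proof.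
case: hL => _ _ [Ts _] _ _.
have mono (a' : int) (d : nat) : T a' <= T (a' + d%:Z).
  elim: d => [|d IH]; first by rewrite addr0.
  have -> : a' + d.+1%:Z = a' + d%:Z + 1 by lia.
  by apply: le_trans IH (ltW (Ts _)).
have le (a' b' : int) : a' <= b' -> T a' <= T b'.
  by move=> h; have := mono a' `|b' - a'|%N; have -> : a' + `|b' - a'|%N%:Z = b' by lia.
case: (ltrP a b) => h; last by apply/negbTE; rewrite -leNgt; exact: le.
by apply: lt_le_trans (Ts a) _; apply: le; lia.
Qed.

Lemma lifts_le q z : (q <= F z) = (lbeg n0 q < T z).
Proof.
case: hL => hb /(_ z) /andP[h1 h2] _ _ _; case: (lerP q (F z)) => h.
  by apply/esym; apply: le_lt_trans h1; rewrite leNgt hb -leNgt.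
apply/esym/negbTE; rewrite -leNgt; apply: ltW; apply: lt_le_trans h2 _.
by rewrite leNgt hb -leNgt; lia.
Qed.

Lemma lifts_FD (z : int) : F (z + n%:Z) = F z + n%:Z.
Proof.
case: hL => hb h [_ TD] _ _; have /andP[h1 h2] := h z; have /andP[h3 h4] := h (z + n%:Z).
have := lbegD n0 (F z); have := lbegD n0 (F z + 1); rewrite TD in h3 h4 => e1 e2.
have l1 : lbeg n0 (F (z + n%:Z)) < lbeg n0 (F z + 1 + n%:Z) by lra.
have l2 : lbeg n0 (F z + n%:Z) < lbeg n0 (F (z + n%:Z) + 1) by lra.
by rewrite !hb in l1 l2; lia.
Qed.

Lemma lifts_beg (i j : 'I_n) : (beg i < beg j) = (i < j)%N.
Proof. by case: hL => hb _ _ _ _; rewrite -!(lbegE n0) hb ltz_nat. Qed.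

(** Whether the end of arc i is pulled back by one turn is decided by [F] alone, through the last
    clause of [lifts]. This lets all comparisons of [equivalent] be expressed by indices and [F],
    without positions. *)
Lemma lifts_finE (i : 'I_n) :
  fin i = T ((i : nat)%:Z - if F (i : nat)%:Z < n%:Z then 0 else n%:Z).
Proof.
case: hL => _ _ [_ TD] /(_ i) -> /(_ i) hz; rewrite /wrap -hz.
case: ifP => _; first by rewrite subr0.
by have := TD ((i : nat)%:Z - n%:Z); rewrite subrK => ->; rewrite addrK.
Qed.

Lemma lifts_FB (z : int) : F (z - n%:Z) = F z - n%:Z.
Proof. by have := lifts_FD (z - n%:Z); rewrite subrK; lia. Qed.

Lemma lifts_beg_fin (i j : 'I_n) : (beg j < fin i) =
  ((j : nat)%:Z + (if F (i : nat)%:Z < n%:Z then 0 else n%:Z) <= F (i : nat)%:Z).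
Proof.
rewrite lifts_finE -(lbegE n0) -lifts_le; case: ifP => _; rewrite ?subr0 ?addr0 //.
by rewrite lifts_FB lerBrDr.
Qed.

Lemma lifts_fin_beg (i j : 'I_n) : (fin i < beg j) = ~~ (beg j < fin i).
Proof.
rewrite -leNgt lt_neqAle; case: eqP => // e /=; exfalso.
have := e; rewrite lifts_finE -(lbegE n0); set z := (i : nat)%:Z - _ => e2.
case: hL => hb /(_ z); rewrite e2 !hb => /andP[]; lia.
Qed.

Lemma lifts_fin (i j : 'I_n) : (fin i < fin j) =
  ((i : nat)%:Z - (if F (i : nat)%:Z < n%:Z then 0 else n%:Z) <
   (j : nat)%:Z - (if F (j : nat)%:Z < n%:Z then 0 else n%:Z)).
Proof. by rewrite !lifts_finE lifts_T. Qed.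

End LiftsTheory.

Lemma lifts_equivalent (M M' : model R) (n0 : (0 < narcs M)%N)
    (n0' : (0 < narcs M')%N) F T T' (e : narcs M = narcs M') :
  lifts n0 F T -> lifts n0' F T' -> equivalent M M'.
Proof.
move=> hL hL'; exists (cast_ord e); first by exists (cast_ord (esym e)) => i; rewrite ?cast_ordK ?cast_ordKV.
move=> a b; rewrite (lifts_beg hL) (lifts_beg hL') /=.
rewrite (lifts_fin_beg hL) (lifts_fin_beg hL') (lifts_beg_fin hL) (lifts_beg_fin hL').
rewrite (lifts_beg_fin hL) (lifts_beg_fin hL').
have ez : (narcs M)%:Z = (narcs M')%:Z :> int by congr Posz.
by rewrite (lifts_fin hL) (lifts_fin hL') /= ez.
Qed.

Lemma increasing_ord n m (h : 'I_n -> 'I_m) :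
  (forall a b : 'I_n, (a < b)%N -> (h a < h b)%N) -> forall a : 'I_n, (a <= h a)%N.
Proof.
move=> hh [a an] /=; elim: a an => [|a IH] an //.
by apply: leq_ltn_trans (IH (ltnW an)) _; apply: hh.
Qed.

(** An equivalence and its inverse both preserve the order of the beginnings, that is, of the
    indices, and an increasing map of indices lies above the identity. *)
Lemma equivalent_index (M M' : model R) (n0 : (0 < narcs M)%N)
    (n0' : (0 < narcs M')%N) F F' T T' (f : 'I_(narcs M) -> 'I_(narcs M')) :
  lifts n0 F T -> lifts n0' F' T' -> bijective f ->
  (forall a b, (beg a < beg b) = (beg (f a) < beg (f b))) ->
  narcs M = narcs M' /\ forall a, f a = a :> nat.
Proof.
move=> hL hL' bf hb; split; first by have := bij_eq_card bf; rewrite !card_ord.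
case: bf => g fK gK a.
apply/eqP; rewrite eqn_leq; apply/andP; split; last first.
  apply: increasing_ord => x y; move: (hb x y).
  by rewrite (lifts_beg hL) (lifts_beg hL') => ->.
rewrite -{2}(fK a); apply: increasing_ord => x y; move: (hb (g x) (g y)).
by rewrite (lifts_beg hL) (lifts_beg hL') !gK => ->.
Qed.

(** The beginnings that precede the end of arc i form an initial segment of the indices, which ends
    at F i or at F i - n. The index i belongs to it exactly when F i < n, so the segment determines
    F i. *)
Lemma equivalent_lifts (M M' : model R) (n0 : (0 < narcs M)%N)
    (n0' : (0 < narcs M')%N) F F' T T' :
  lifts n0 F T -> lifts n0' F' T' ->
  (forall z, z <= F z < z + (narcs M)%:Z) ->
  (forall z, z <= F' z < z + (narcs M')%:Z) ->
  equivalent M M' -> narcs M = narcs M' /\ F =1 F'.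
Proof.
move=> hL hL' hF hF' [f bf hf].
have [en fE] := equivalent_index hL hL' bf (fun a b => let: And4 h _ _ _ := hf a b in h).
split=> // z; set n := narcs M in en hF *.
have base (i : 'I_n) : F (i : nat)%:Z = F' (i : nat)%:Z.
  have hfE := fE i; have b1 := hF (i : nat)%:Z; have b2 := hF' (i : nat)%:Z.
  have cmp (j : 'I_n) :
      ((j : nat)%:Z + (if F (i : nat)%:Z < n%:Z then 0 else n%:Z) <= F (i : nat)%:Z) =
      ((j : nat)%:Z + (if F' (i : nat)%:Z < n%:Z then 0 else n%:Z) <= F' (i : nat)%:Z).
    have [_ h _ _] := hf j i.
    by move: h; rewrite (lifts_beg_fin hL) (lifts_beg_fin hL') !fE -en.
  rewrite -en in b2; have hi := ltn_ord i; have := cmp i.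
  have onx (x : int) : 0 <= x < n%:Z -> exists j : 'I_n, x = (j : nat)%:Z.
    move=> hx; have xn : (`|x| < n)%N by lia.
    by exists (Ordinal xn) => /=; lia.
  case: ifP => c1; case: ifP => c2 => h; try lia.
    have [j hj] := onx (F (i : nat)%:Z) ltac:(lia).
    have [j' hj'] := onx (F' (i : nat)%:Z) ltac:(lia).
    by move: (cmp j) (cmp j'); rewrite c1 c2; lia.
  have [j hj] := onx (F (i : nat)%:Z - n%:Z) ltac:(lia).
  have [j' hj'] := onx (F' (i : nat)%:Z - n%:Z) ltac:(lia).
  by move: (cmp j) (cmp j'); rewrite c1 c2; lia.
have FM G (hG : forall z : int, G (z + n%:Z) = G z + n%:Z) (t u : int) :
    G (u + t * n%:Z) = G u + t * n%:Z.
  have nat_case (v : int) (m : nat) : G (v + m%:Z * n%:Z) = G v + m%:Z * n%:Z.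
    elim: m => [|m IH]; first by rewrite mul0r !addr0.
    by rewrite -addn1 PoszD mulrDl mul1r addrA hG IH addrA.
  case: t => m; first exact: nat_case.
  rewrite NegzE; move: (nat_case (u + - (m.+1%:Z) * n%:Z) m.+1).
  by rewrite mulNr subrK => ->; rewrite addrK.
rewrite (resE n0 z) (FM F (lifts_FD hL)) (FM F') ?base // => u.
by rewrite en; exact: (lifts_FD hL').
Qed.

Lemma zero_equivalent (M M' : model R) :
  zero_at_initial M -> equivalent M M' -> zero_at_initial M'.
Proof.
move=> hz [f [g fK gK] hf] i; have [j hj] := hz (g i); exists (f j).
by have [_ h _ _] := hf j (g i); rewrite gK in h; rewrite -h.
Qed.

Lemma lifts_zero (M : model R) (n0 : (0 < narcs M)%N) F T :
  lifts n0 F T -> (forall z, z <= F z < z + (narcs M)%:Z) -> zero_at_initial M.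
Proof.
move=> hL hF i; exists (Ordinal n0); rewrite (lifts_beg_fin hL) /=.
by have := hF (i : nat)%:Z; case: ifP; lia.
Qed.

Lemma wrap_unique (M : model R) (x p : R) (t : int) : 0 <= p < len M ->
  0 <= x < len M + len M -> x = p + len M * t%:~R -> wrap M x = p.
Proof.
move=> /andP[p0 p1] /andP[x0 x1] e.
have l0 : 0 < len M by lra.
have t1 : -1 < t < 2.
  by rewrite -!(ltr_int R); apply/andP; split; nra.
have [t0|t0] : t = 0 \/ t = 1 by lia.
  rewrite /wrap; rewrite t0 mulr0z mulr0 addr0 in e.
  by case: (ltrP x (len M)) => h; lra.
rewrite /wrap; rewrite t0 mulr1z mulr1 in e.
by case: (ltrP x (len M)) => h; lra.
Qed.

(** The last clause is where the position of 0 matters: F i < n compares T i with the second copy of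
    the beginning of A_0 and not with [len M], and [zero_at_initial] rules out an end between the
    two. *)
Lemma pca_lifts (M : model R) (n0 : (0 < narcs M)%N) :
  is_pca M -> zero_at_initial M -> lifts n0 (lF n0) (lfin n0).
Proof.
move=> hM hz; split; first exact: lbeg_lt.
- exact: lF_spec.
- split=> z; [exact: lfin_succ|exact: lfinD].
- move=> i; have [t ht] := lfin_mod n0 (i : nat)%:Z; rewrite res_id in ht.
  have /andP[f0 f1] := fin_circle hM i; have /andP[b0 b1] := beg_circle hM i.
  have /andP[a0 a1] := arc_len_range hM i.
  apply/esym/(@wrap_unique _ _ _ t) => //; first by apply/andP.
  by rewrite /lfin lbegE res_id; apply/andP; split; lra.
move=> i; have nE : lbeg n0 (narcs M)%:Z = beg (Ordinal n0) + len M.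
  by have := lbegD n0 (Ordinal n0 : nat)%:Z; rewrite lbegE add0r.
rewrite -[LHS]negbK -leNgt le_lF // nE -leNgt.
have /andP[b0 _] := beg_circle hM (Ordinal n0).
case: (ltrP (lfin n0 (i : nat)%:Z) (len M)) => h; first by lra.
have [t ht] := lfin_mod n0 (i : nat)%:Z; rewrite res_id in ht.
have /andP[f0 f1] := fin_circle hM i; have /andP[c0 c1] := beg_circle hM i.
have /andP[a0 a1] := arc_len_range hM i.
have e : fin i = lfin n0 (i : nat)%:Z - len M.
  have <- : wrap M (lfin n0 (i : nat)%:Z) = fin i.
    apply: (@wrap_unique _ _ _ t) => //; first by apply/andP.
    by rewrite /lfin lbegE res_id; apply/andP; split; lra.
  by rewrite /wrap ltNge h.
have [j hj] := hz i; have : beg (Ordinal n0) <= beg j.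
  by rewrite -!(lbegE n0) lbeg_le.
by apply: contraTF => h2; lra.
Qed.

End Equivalence.

(** * Powers for small epsilon, and what omega says about the lift *)

Lemma positive_lower_bound (R : realType) (s : seq R) :
  (forall x, x \in s -> 0 < x) -> exists2 g : R, 0 < g & forall x, x \in s -> g <= x.
Proof.
elim: s => [|y s IH] h; first by exists 1.
have [g g0 gs] := IH (fun x xs => h x (mem_behead (s := y :: s) xs)).
exists (Num.min y g); first by rewrite lt_min g0 h ?mem_head.
move=> x; rewrite inE => /orP[/eqP ->|/gs]; first by rewrite ge_min lexx.
by move=> gx; rewrite ge_min gx orbT.
Qed.

Section Powers.
Variables (R : realType) (M : model R).
Hypothesis hM : is_pca M.
Hypothesis n0 : (0 < narcs M)%N.
Local Notation n := (narcs M).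
Local Notation rs := (res n0).
Local Notation P := (lbeg n0).
Local Notation T := (lfin n0).
Local Notation F := (lF n0).

(** A common margin: a beginning with an offset below g reaches neither the next beginning nor 0, so
    [wrap] does not act on the end of a power, and F z with such an offset stays inside arc z.
    Offsets are e times at most n + 1, hence the bound [g / n.+1] on e. *)
Definition gap (g : R) : Prop :=
  [/\ 0 < g, (forall z, P z + g <= P (z + 1)), (forall z, P (F z) + g <= T z) &
      (forall i : 'I_n, beg i + g <= len M)].

Lemma gap_exists : exists g, gap g.
Proof.
pose s := [seq P ((i : nat)%:Z + 1) - P (i : nat)%:Z | i : 'I_n <- enum 'I_n] ++
          [seq T (i : nat)%:Z - P (F (i : nat)%:Z) | i : 'I_n <- enum 'I_n] ++
          [seq len M - beg i | i : 'I_n <- enum 'I_n].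
have [|g g0 gs] := @positive_lower_bound R s.
  move=> x; rewrite !mem_cat => /or3P[] /mapP[i _ ->]; rewrite subr_gt0.
  - exact: lbeg_succ.
  - by have /andP[] := lF_spec hM n0 (i : nat)%:Z.
  by have /andP[] := beg_circle hM i.
have in1 (i : 'I_n) : P ((i : nat)%:Z + 1) - P (i : nat)%:Z \in s.
  by rewrite !mem_cat; apply/or3P/Or31/mapP; exists i; rewrite ?mem_enum.
have in2 (i : 'I_n) : T (i : nat)%:Z - P (F (i : nat)%:Z) \in s.
  by rewrite !mem_cat; apply/or3P/Or32/mapP; exists i; rewrite ?mem_enum.
have in3 (i : 'I_n) : len M - beg i \in s.
  by rewrite !mem_cat; apply/or3P/Or33/mapP; exists i; rewrite ?mem_enum.
exists g; split=> // [z|z|i].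
- have := gs _ (in1 (rs z)).
  rewrite {3 4}(resE n0 z).
  have -> : (rs z : nat)%:Z + (z %/ n%:Z)%Z * n%:Z + 1 =
            (rs z : nat)%:Z + 1 + (z %/ n%:Z)%Z * n%:Z by lia.
  by rewrite !lbegDM; lra.
- have := gs _ (in2 (rs z)).
  rewrite {3 4}(resE n0 z) (circ_FDM (lift_circ hM n0)).
  by rewrite !lbegDM !lfinDM; lra.
by have := gs _ (in3 i); lra.
Qed.

Section SmallEps.
Variables (g e : R).
Hypothesis hg : gap g.
Hypothesis he : 0 < e < g / n.+1%:R.

Definition shift j z : R := e * (rank_in_fiber j (rs z)).+1%:R.

Lemma shift_range j z : 0 < shift j z < g.
Proof.
case/andP: he => e0 e1; apply/andP; split; first by rewrite mulr_gt0.
have r1 : (rank_in_fiber j (rs z) <= n)%N.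
  by rewrite -[X in (_ <= X)%N](card_ord n) max_card.
apply: (@le_lt_trans _ _ (e * n.+1%:R)).
  by rewrite ler_pM2l // ler_nat.
by rewrite -ltr_pdivlMr.
Qed.

Lemma power_fin j a z : rs z = rs (iter j F a) ->
  @fin R (power M j e) (rs a) = beg (rs z) + shift j a /\
  on_circle M (beg (rs z) + shift j a).
Proof.
move=> ez; case: hg => g0 _ _ g3.
have /andP[s0 s1] := shift_range j a; have g4 := g3 (rs z).
have /andP[b0 b1] := beg_circle hM (rs z).
have ok : on_circle M (beg (rs z) + shift j a) by apply/andP; split; lra.
split=> //; rewrite /= (Fr_iter_lift n0) -ez -/(shift j a).
by rewrite /wrap; case/andP: ok => _ ->.
Qed.

Lemma power_cw j (a z : int) : rs z = rs (iter j F a) -> a <= z < a + n%:Z ->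
  cw M (beg (rs a)) (@fin R (power M j e) (rs a)) = P z + shift j a - P a.
Proof.
move=> ez /andP[az za]; have [-> ok] := power_fin ez.
case: hg => g0 g1 _ _; have /andP[s0 s1] := shift_range j a.
have l1 : P a <= P z by rewrite lbeg_le.
have l2 : P (z + 1) <= P (a + n%:Z) by rewrite lbeg_le //; lia.
have l3 := g1 z; rewrite lbegD in l2.
apply: (@cw_lift _ _ hM n0 _ _ _ (z %/ n%:Z)%Z) => //.
  by apply/andP; split; lra.
by rewrite /lbeg; lra.
Qed.

Lemma power_arc j (a z : int) p : rs z = rs (iter j F a) -> a <= z < a + n%:Z ->
  @arc R (power M j e) (rs a) p =
  (0 < cw M (beg (rs a)) p < P z + shift j a - P a).
Proof. by move=> h1 h2; rewrite -(power_cw h1 h2). Qed.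

Lemma power_subarc j (a z : int) p : rs z = rs (iter j F a) -> a <= z <= F a ->
  @arc R (power M j e) (rs a) p -> arc (rs a) p.
Proof.
move=> h1 /andP[h2 h3].
have h4 : a <= z < a + n%:Z by have := circ_F (lift_circ hM n0) a; lia.
rewrite (power_arc _ h1 h4) /arc /in_arc -/(arc_len _) => /andP[-> c2] /=.
apply: lt_le_trans c2 _.
case: hg => g0 g1 g2 _; have /andP[s0 s1] := shift_range j a.
have l1 : P z <= P (F a) by rewrite lbeg_le.
have tE : T a = P a + arc_len (rs a) by [].
by have := g2 a; lra.
Qed.

Section NoWrap.
Variable j : nat.
Hypothesis nowrap : forall z, iter j F z < z + n%:Z.

Let hc := lift_circ hM n0.

(** The bound on b is not strict because a nose may be a loop, lifted from a to a + n; on the circle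
    b is then the arc a, whose beginning is outside its own power. *)
Lemma power_beg (a b : int) : a <= b -> b <= a + n%:Z ->
  @arc R (power M j e) (rs a) (beg (rs b)) = (a < b <= iter j F a).
Proof.
move=> ab ba; have := iter_ge hc j a => ge; have lt := nowrap a.
rewrite (@power_arc _ _ (iter j F a)) //; last by apply/andP.
have /andP[s0 s1] := shift_range j a; case: hg => g0 g1 _ _.
have [lb|eb] : b < a + n%:Z \/ b = a + n%:Z by lia.
  rewrite cw_lbeg //; last by apply/andP.
  rewrite subr_gt0 lbeg_lt // ltrD2r; congr (_ && _).
  case: (lerP b (iter j F a)) => h.
    have : P b <= P (iter j F a) by rewrite lbeg_le.
    by apply: contraTT; rewrite -leNgt; lra.
  have : P (iter j F a + 1) <= P b by rewrite lbeg_le //; lia.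
  by have := g1 (iter j F a) => h1 h2; apply/negbTE; rewrite -leNgt; lra.
rewrite eb resD // /cw lexx subrr ltxx /=.
by apply/esym/negbTE; rewrite negb_and -!ltNge lt orbT.
Qed.

(** On the line the counted arcs are the points that precede z in its fiber of F^j. A point w > z of
    the fiber is not counted: from w one meets z again only after passing the end of the power of
    w. *)
Lemma rank_set (z : int) (b : 'I_n) :
  (Fr_iter j b == Fr_iter j (rs z)) &&
      (0 < cw M (beg b) (beg (rs z)) <= cw M (beg b) (beg (Fr_iter j b))) <->
  exists w, [/\ b = rs w, w < z & iter j F w = iter j F z].
Proof.
split=> [/andP[/eqP h1 /andP[h2 h3]]|[w [-> wz e1]]].
  have [u xu] : exists u, b = rs u by exists (b : nat)%:Z; rewrite res_id.
  move: h1; rewrite xu !Fr_iter_lift => /(@res_eqP _ n0) [t ht].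
  have [w [bw Fw]] : exists w, b = rs w /\ iter j F w = iter j F z.
    exists (u + (- t) * n%:Z); rewrite resDM xu; split=> //.
    by rewrite (circ_iterDM hc) ht; lia.
  exists w; rewrite -?xu; split=> //; rewrite ltNge; apply/negP => zw.
  have w1 := nowrap w; have z1 := nowrap z; have w2 := iter_ge hc j w.
  have z2 := iter_ge hc j z; rewrite Fw in w1 w2.
  move: h2 h3; rewrite bw Fr_iter_lift Fw.
  rewrite (@cw_lbeg _ _ hM n0 w (iter j F z)); last by apply/andP; split; lia.
  have [ez|ne] : w = z \/ z < w by lia.
    by rewrite ez /cw lexx subrr ltxx.
  rewrite -(resD n0 z) cw_lbeg //; last by apply/andP; split; lia.
  by rewrite lerD2r lbeg_le // => _; lia.
have w1 := nowrap w; have w2 := iter_ge hc j z; have z1 := nowrap z.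
rewrite !Fr_iter_lift e1 eqxx /= cw_lbeg //; last by apply/andP; split; lia.
rewrite cw_lbeg //; last by apply/andP; split; lia.
by rewrite subr_gt0 lbeg_lt // wz lerD2r lbeg_le.
Qed.

Lemma rank_succ (z : int) : iter j F z = iter j F (z + 1) ->
  (rank_in_fiber j (rs z) < rank_in_fiber j (rs (z + 1)))%N.
Proof.
move=> eF; apply: proper_card; apply/properP; split.
  apply/subsetP => b; rewrite !inE => /rank_set [w [bw wz ew]].
  by apply/rank_set; exists w; rewrite -eF; split=> //; lia.
exists (rs z); first by rewrite inE; apply/rank_set; exists z; split=> //; lia.
(* z does not count for itself: a copy w < z differs from z by full turns, and so does its image. *)
rewrite inE; apply/negP => /rank_set [w [bw wz]].
have [t ht] := res_eqP bw; rewrite ht (circ_iterDM hc); lia.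
Qed.

Definition power_lfin (z : int) : R := P (iter j F z) + shift j z.

(** The ends increase inside a fiber of F^j because the rank does, and from one fiber to the next
    because an offset is smaller than the margin. *)
Lemma power_lifts :
  @lifts R (power M j e) n0 (iter j F) power_lfin.
Proof.
have /andP[e0 e1] := he; case: (hg) => g0 g1 g2 g3.
have FD (z : int) : iter j F (z + n%:Z) = iter j F z + n%:Z.
  by have := circ_iterDM hc j z 1; rewrite mul1r.
split; first exact: (lbeg_lt hM n0).
- move=> z; have /andP[s0 s1] := shift_range j z; have := g1 (iter j F z).
  rewrite -[lbeg _ (iter j F z)]/(P (iter j F z)).
  rewrite -[lbeg _ (iter j F z + 1)]/(P (iter j F z + 1)).
  by rewrite /power_lfin => h; apply/andP; split; lra.
- split=> z; last by rewrite /power_lfin /shift FD lbegD resD // addrAC.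
  have m1 : iter j F z <= iter j F (z + 1).
    by elim: (j) => /= [|i IH]; [lia|exact: (circ_Fmono hc)].
  have /andP[s0 s1] := shift_range j z; have /andP[s2 s3] := shift_range j (z + 1).
  rewrite /power_lfin.
  have [eq|lt] : iter j F z = iter j F (z + 1) \/ iter j F z + 1 <= iter j F (z + 1) by lia.
    rewrite eq ltrD2l /shift ltr_pM2l // ltr_nat ltnS; exact: rank_succ.
  have l1 : P (iter j F z + 1) <= P (iter j F (z + 1)) by rewrite lbeg_le.
  by have := g1 (iter j F z); lra.
- move=> i; have nw := nowrap (i : nat)%:Z; have ge := iter_ge hc j (i : nat)%:Z.
  set q := iter j F _ in nw ge *.
  have [] := @power_fin j (i : nat)%:Z q erefl; rewrite res_id => -> /andP[o1 o2].
  have hi : (i < n)%N := ltn_ord i.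
  apply/esym/(@wrap_unique _ _ _ _ (q %/ n%:Z)%Z); first by apply/andP.
    have q0 : 0 <= q by lia.
    have q1 : q < n%:Z + n%:Z by lia.
    rewrite /power_lfin -/q; set s := shift j _ in o1 o2 *.
    have /andP[b0 b1] := beg_circle hM (rs q).
    have [lt|le] : q < n%:Z \/ n%:Z <= q by lia.
      have -> : P q = beg (rs q).
        have xn : (`|q| < n)%N by lia.
        have -> : q = (Ordinal xn : nat)%:Z by rewrite /=; lia.
        by rewrite lbegE res_id.
      by have l0 := len_gt0 hM; apply/andP; split=> /=; lra.
    have -> : P q = beg (rs q) + len M.
      have xn : (`|q - n%:Z| < n)%N by lia.
      have -> : q = (Ordinal xn : nat)%:Z + n%:Z by rewrite /=; lia.
      by rewrite lbegD lbegE resD // res_id.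
    by have l0 := len_gt0 hM; apply/andP; split=> /=; lra.
  by rewrite /power_lfin -/q /lbeg /= addrAC.
move=> i; have nw := nowrap (i : nat)%:Z; have ge := iter_ge hc j (i : nat)%:Z.
rewrite /power_lfin; set q := iter j F _ in nw ge *.
have /andP[s0 s1] := shift_range j (i : nat)%:Z; have hi : (i < n)%N := ltn_ord i.
case: (ltrP q n%:Z) => h.
  have xn : (`|q| < n)%N by lia.
  have -> : q = (Ordinal xn : nat)%:Z by rewrite /=; lia.
  by rewrite lbegE; have := g3 (Ordinal xn) => ?; apply/esym; rewrite /=; lra.
apply/esym/negbTE; rewrite -leNgt.
have nE : P n%:Z = beg (Ordinal n0) + len M.
  by have := lbegD n0 (Ordinal n0 : nat)%:Z; rewrite lbegE add0r.
have l1 : P n%:Z <= P q by rewrite lbeg_le.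
by have /andP[b0 _] := beg_circle hM (Ordinal n0); rewrite /=; lra.
Qed.

End NoWrap.
End SmallEps.

Lemma small_eps (Q : R -> Prop) :
  (forall g e, gap g -> 0 < e < g / n.+1%:R -> Q e) -> for_small_eps Q.
Proof.
move=> h; have [g hg] := gap_exists; exists (g / n.+1%:R).
  by case: hg => g0 _ _ _; rewrite divr_gt0.
by move=> e he; apply: h he.
Qed.

Lemma shrinks_lift w (a z : int) : rs z = rs (iter w F a) -> a <= z <= F a ->
  power_shrinks M w.
Proof.
move=> h1 h2; exists (rs a); apply: small_eps => g e hg he p _.
exact: (power_subarc hg he h1 h2).
Qed.

End Powers.

(** Without external arcs [F] maps indices below n to indices below n, so no iterate completes a
    turn, and omega = n. Otherwise let F^(i+1) z be the first iterate to reach z + n: by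
    monotonicity it is at most F z + n, so A^(i+1) is included in A and omega <= i + 1. In that case
    k < n because [F], if it has no fixed point, advances by at least 1 at each step. *)
Lemma omega_nowrap (R : realType) (M : model R) (w k : nat) :
  is_pca M -> zero_at_initial M -> is_omega M w -> (1 <= k < w)%N ->
  exists n0 : (0 < narcs M)%N, (k < narcs M)%N /\
    forall i, (i <= k)%N -> forall z, iter i (lF n0) z < z + (narcs M)%:Z.
Proof.
move=> hM hz [hpig hnot] /andP[k1 kw].
have n0 : (0 < narcs M)%N.
  rewrite lt0n; apply/eqP => e; have : w = narcs M.
    by apply: hpig => i; have := ltn_ord i; rewrite {2}e.
  by lia.
exists n0; have hc := lift_circ hM n0; set n := narcs M in n0 hc *.
case: (boolP [forall i : 'I_n, ~~ external i]) => [/forallP pig|/forallPn [x ext]].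
  have wn := hpig pig; split; first by rewrite /n -wn.
  have Fn (i : 'I_n) : lF n0 (i : nat)%:Z < n%:Z.
    have [_ _ _ _ ->] := pca_lifts n0 hM hz.
    have /andP[f0 f1] := fin_circle hM i; have := pig i.
    rewrite /external -leNgt => le.
    by rewrite /lfin lbegE res_id /arc_len /cw le addrC subrK.
  move=> i ik z; rewrite (resE n0 z) (circ_iterDM hc).
  suff : iter i (lF n0) (res n0 z : nat)%:Z < n%:Z by lia.
  elim: i {ik} => [|i IH] /=; first by have := ltn_ord (res n0 z); lia.
  have ge := iter_ge hc i (res n0 z : nat)%:Z.
  set q := iter i _ _ in IH ge *; have xn : (`|q| < n)%N by lia.
  by have := Fn (Ordinal xn); congr (lF n0 _ < _); rewrite /=; lia.
have npig : ~ is_pig M by move=> pig; move: ext; rewrite (pig x).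
have [w1 _ wmin] := hnot npig.
have n2 : (1 < n)%N.
  rewrite ltnNge; apply/negP => n1; have [y hy] := hz x.
  have yx : y = x by apply/val_inj => /=; have := ltn_ord x; have := ltn_ord y; rewrite -/n; lia.
  by move: ext; rewrite negbK /external -yx; move: hy; rewrite -yx; case: ltrgtP.
have nowrap i : (i < w)%N -> forall z, iter i (lF n0) z < z + n%:Z.
  elim: i => [|i IH] iw z /=; first by lia.
  have [i0|i0] : i = 0%N \/ (0 < i)%N by lia.
    by rewrite i0; have /andP[] := circ_F hc z.
  rewrite ltNge; apply/negP => ge.
  have lt := IH (ltnW iw) z.
  have := circ_Fmono hc (ltW lt); rewrite (circ_FD hc) => le.
  have : power_shrinks M i.+1.
    apply: (@shrinks_lift _ _ hM n0 _ z (lF n0 (iter i (lF n0) z) - n%:Z)); last by apply/andP; split; lia.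
    by rewrite -(resD n0) subrK.
  by move/(wmin i.+1 ltac:(lia)); lia.
split; last by move=> i ik; apply: nowrap; apply: leq_ltn_trans kw.
(* A fixed point of [F] gives omega = 2, hence k = 1 < n. *)
case: (boolP [exists i : 'I_n, lF n0 (i : nat)%:Z == (i : nat)%:Z]) => [/existsP [i /eqP fi]|].
  have : power_shrinks M 2.
    apply: (@shrinks_lift _ _ hM n0 _ (i : nat)%:Z (i : nat)%:Z); rewrite /= ?fi ?lexx //.
  by move/(wmin 2 isT); lia.
rewrite negb_exists => /forallP nofix.
have adv z : z + 1 <= lF n0 z.
  have := nofix (res n0 z); have /andP[h _] := circ_F hc (res n0 z : nat)%:Z.
  move/eqP => ne; rewrite (resE n0 z) (circ_FDM hc); lia.
rewrite -/n; suff : ~ (n < w)%N by lia.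
move=> /nowrap /(_ 0).
suff : forall i, i%:Z <= iter i (lF n0) 0 by move=> /(_ n); lia.
by elim=> [|i IH] //=; have := adv (iter i (lF n0) 0); lia.
Qed.

(** * The edges of the synthetic graph *)

Section Slots.
Variables (n k : nat) (lf fr fl : 'I_n -> 'I_n) (hl hr : 'I_n -> option 'I_n).

Definition hollow_slot (v : 'I_n) : bool := (fl (fr v) == v) && (fr v != v).

Definition walk_step (s : nat * 'I_n) : nat * 'I_n :=
  if hl s.2 is Some a then (s.1.+1, a) else s.

Definition walk (v : 'I_n) : nat * 'I_n := iter k walk_step (0%N, lf v).

(** All noses into v have tails H_l^i(L(v)). One that is not short has i = k, or no H_l at its tail
    and no H_r at v, so its tail is where the walk stops: at most one per vertex. *)
Definition nose_slot (v : 'I_n) : bool :=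
  ((walk v).1 == k) || (hl (walk v).2 == None) && (hr v == None).

Lemma walkP v : let: (j, a) := walk v in
  [/\ iter j (obind hl) (Some (lf v)) = Some a, (j <= k)%N & j = k \/ hl a = None].
Proof.
rewrite /walk; elim: {1 2 3}k => [|t]; first by split=> //; left.
rewrite iterS; case: (iter t _ _) => j a [h1 h2 h3]; rewrite /walk_step /=.
case e: (hl a) => [b|].
  by split; [rewrite iterS h1 /=|lia|left; case: h3 => [->//|]; rewrite e].
by split=> //; [lia|right].
Qed.

End Slots.

Section Edges.
Variables (R : realType) (M : model R).
Hypothesis hM : is_pca M.
Hypothesis n0 : (0 < narcs M)%N.
Local Notation n := (narcs M).
Local Notation rs := (res n0).
Local Notation F := (lF n0).
Local Notation G := (lG n0).
Let hc := lift_circ hM n0.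

(** This identifies the indicator in [sep], a comparison of beginnings on the circle, with the
    change of turn between two lifts. The case b = a + n is that of loops, whose two beginnings are
    equal; hence [<=]. *)
Lemma div_step (a b : int) : a < b <= a + n%:Z ->
  (b %/ n%:Z)%Z = (a %/ n%:Z)%Z + (if beg (rs b) <= beg (rs a) then 1 else 0).
Proof.
move=> h; have ea := resE n0 a; have eb := resE n0 b.
have la := ltn_ord (rs a); have lb := ltn_ord (rs b).
have -> : (beg (rs b) <= beg (rs a)) = (rs b <= rs a)%N.
  by rewrite -!(lbegE n0) lbeg_le.
set qa := (a %/ n%:Z)%Z in ea *; set qb := (b %/ n%:Z)%Z in eb *.
case: ifP => c.
  suff : qb - qa - 1 = 0 by lia.
  by apply: (@mulz_small n); lia.
suff : qb - qa = 0 by lia.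
by apply: (@mulz_small n); lia.
Qed.

Lemma Hl_iter_gc i p x : Hl_iter i (rs p) = Some x ->
  exists2 a, x = rs a & gc F G i a p.
Proof.
elim: i x => [|i IH] x; first by move=> [<-]; exists p.
rewrite /Hl_iter iterS -/(Hl_iter _ _); case: (Hl_iter i (rs p)) IH => //= y IH h.
have [a ya g] := IH _ erefl; move: h; rewrite ya (Hl_lift hM); case: eqP => // ne [<-].
exists (G (a + 1) - 1) => //=.
have G1 := circ_Gmono hc (a := a) (b := a + 1) ltac:(lia).
have -> : F (G (a + 1) - 1) = a.
  have := circ_adj hc a (G (a + 1) - 1).
  by have := circ_adj hc (a + 1) (G (a + 1) - 1); lia.
by rewrite subrK.
Qed.

Lemma gc_Hl_iter i a p : gc F G i a p -> Hl_iter i (rs p) = Some (rs a).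
Proof.
elim: i a => [|i IH] a; first by move=> /= ->.
move=> [g1 /IH h]; rewrite /Hl_iter iterS -/(Hl_iter _ _) h /= (Hl_lift hM) g1 addrK.
case: eqP => // e; have := circ_adj hc (F a) a; lia.
Qed.

Lemma hollow_is_hollow a : F a != a -> G (F a) = a -> is_hollow (rs (F a)) (rs a).
Proof.
move=> ne ga; split; [|by rewrite (Fr_lift n0)|by rewrite (Fl_lift n0) ga].
apply: (small_eps hM (n0 := n0)) => g e hg he.
have /andP[h1 h2] := circ_F hc a.
have nw z : iter 1 F z < z + n%:Z by have /andP[] := circ_F hc z.
by rewrite (power_beg hM hg he nw) //=; lia.
Qed.

Lemma gc_is_nose i a p : (forall z, iter i F z < z + n%:Z) -> gc F G i a p ->
  is_nose i (rs a) (rs (p + 1)).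
Proof.
move=> nw g; have ep := gc_iter g; split.
  have := iter_ge hc i a; have := nw a; rewrite -ep => h1 h2.
  apply: (small_eps hM (n0 := n0)) => d e hg he.
  by rewrite (power_beg hM hg he nw) -?ep; lia.
by rewrite /Lf res_pred addrK (gc_Hl_iter g).
Qed.

Lemma is_hollow_neq (b a : 'I_n) : is_hollow b a -> b != a.
Proof.
case=> [[d d0 hd] _ _]; apply/eqP => e; have := hd (d / 2) ltac:(lra).
by rewrite e /arc /in_arc /cw lexx subrr ltxx.
Qed.

Section Complete.
Variables (k c l : nat) (x : 'I_n -> int).
Hypothesis nowrap : forall i, (i <= k)%N -> forall z, iter i F z < z + n%:Z.

Local Notation wk := (walk k (@Lf R M) (@Hl R M)).
Local Notation hsl := (hollow_slot (@Fr R M) (@Fl R M)).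
Local Notation nsl := (nose_slot k (@Lf R M) (@Hl R M) (@Hr R M)).
Definition hollow_edge (v : 'I_n) : edge M := (None, Fr v, v).
Definition nose_edge (v : 'I_n) : edge M := (Some (wk v).1, (wk v).2, v).

Lemma hollow_edge_synthetic v : hsl v -> synthetic k (hollow_edge v).
Proof.
case/andP=> /eqP h1 /eqP h2; split=> //=.
have [u vu] : exists u, v = rs u by exists (v : nat)%:Z; rewrite res_id.
move: h1 h2; rewrite vu (Fr_lift n0) (Fl_lift n0) => h1 h2.
(* G (F u) and u are less than a turn apart, so their equality modulo n is an equality. *)
have [t ht] := res_eqP h1.
have ne : F u != u by apply/eqP => e; apply: h2; rewrite e.
apply: hollow_is_hollow => //.
have b1 := circ_F hc u; have b2 := circ_G hc (F u).
have b3 := circ_FG hc u; have b4 := circ_GF hc (F u).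
have : t * n%:Z <= 0 by lia.
have : - n%:Z < t * n%:Z by lia.
move=> h3 h4; have t0 : t = 0 by apply: (@mulz_small n); have := n0; lia.
by rewrite ht t0; lia.
Qed.

Lemma nose_edge_synthetic v : nsl v -> synthetic k (nose_edge v).
Proof.
have := walkP k (@Lf R M) (@Hl R M) v; rewrite /nose_slot /nose_edge.
case: (wk v) => j a [h1 h2 h3] /= h4.
have [u vu] : exists u, v = rs u by exists (v : nat)%:Z; rewrite res_id.
have [w aw g] : exists2 w, a = rs w & gc F G j w (u - 1).
  by apply: Hl_iter_gc; rewrite -(res_pred n0) -vu.
split.
  split=> //; rewrite vu aw -(subrK 1 u); apply: gc_is_nose g; exact: nowrap.
case=> lt; case/orP: h4 => [/eqP e|/andP[/eqP e1 /eqP e2]]; first by lia.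
by rewrite e1 e2; case.
Qed.

Hypothesis hol : forall v, hsl v -> x (Fr v) + sep c l (hollow_edge v) <= x v.
Hypothesis nos : forall v, nsl v -> x (wk v).2 + sep c l (nose_edge v) <= x v.

Definition lsol (z : int) : int := x (rs z) + c%:Z * (z %/ n%:Z)%Z.

Lemma lsol_shifts : shifts n c lsol.
Proof. by move=> z; rewrite /lsol resD divD //; lia. Qed.

Lemma lsol_hollows : hollows F G lsol l.
Proof.
move=> a ne ga; have /andP[b1 b2] := circ_F hc a.
have hv : hsl (rs a).
  rewrite /hollow_slot (Fr_lift n0) (Fl_lift n0) ga eqxx /=; apply/eqP => /(@res_eqP _ n0) [t ht].
  have t0 : t = 0 by apply: (@mulz_small n); lia.
  by move/eqP: ne; apply; rewrite ht t0; lia.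
have := hol hv; rewrite /= (Fr_lift n0) /lsol (div_step (a := a) (b := F a)); last by lia.
by case: ifP => _; lia.
Qed.

(** After bottom H_l has no further value, so the walk from p cannot stop before i; being long keeps
    it from going further, by i = k or by an empty fiber over a. Hence this nose is the one in the
    slot of p + 1. *)
Lemma lsol_long_noses : long_noses F G lsol l k.
Proof.
move=> i a p ik g hlong; set v := rs (p + 1).
have ep := gc_iter g; have nw := nowrap ik a; have ge := iter_ge hc i a.
have lfv : Lf v = rs p by rewrite /Lf res_pred addrK.
have hi := gc_Hl_iter g.
have dead j y : Hl_iter j (rs p) = Some y -> Hl y = None -> forall j', (j < j')%N ->
    Hl_iter j' (rs p) = None.
  move=> h1 h2 j' jj'; have -> : j' = (j' - j.+1 + j.+1)%N by lia.
  rewrite /Hl_iter iterD iterS -/(Hl_iter j (rs p)) h1 /= h2.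
  by elim: (_ - _)%N => //= t ->.
have wv : wk v = (i, rs a).
  have := walkP k (@Lf R M) (@Hl R M) v; case: (wk v) => j y [h1 h2 h3].
  rewrite lfv -/(Hl_iter j (rs p)) in h1.
  suff ij : j = i by move: h1; rewrite ij hi => -[<-].
  have [ji|ij|//] := ltngtP j i.
    case: h3 => [|h3]; first by lia.
    by move: hi; rewrite (dead _ _ h1 h3 _ ji).
  case: hlong => [|[e1 e2]]; first by lia.
  have hn : Hl (rs a) = None by rewrite (Hl_lift hM) e1 eqxx.
  by move: h1; rewrite (dead _ _ hi hn _ ij).
have nv : nsl v.
  rewrite /nose_slot wv /=; case: hlong => [->|[e1 e2]]; first by rewrite eqxx.
  rewrite (Hl_lift hM) e1 eqxx eqxx /=; apply/orP; right.
  apply/eqP; case e: (Hr v) => [y|//]; exfalso.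
  have : Hr v <> None by rewrite e.
  by move/(Hr_lift hM); rewrite addrK e2 ltxx.
have := nos nv; rewrite /nose_edge wv /= /lsol.
rewrite (div_step (a := a) (b := p + 1)); last by rewrite -ep in nw ge; lia.
by rewrite -/v; case: ifP => _; lia.
Qed.

End Complete.
End Edges.

(** * Models and solutions of the constraints *)

Lemma lifts_ext (R : realType) (M : model R) (n0 : (0 < narcs M)%N) F F' T :
  F =1 F' -> lifts n0 F T -> lifts n0 F' T.
Proof.
by move=> e [h1 h2 h3 h4 h5]; split=> // => [z|i]; rewrite -e.
Qed.

Lemma iter_ext (F F' : int -> int) i : F =1 F' -> iter i F =1 iter i F'.
Proof. by move=> e z; elim: i => //= i ->. Qed.

Lemma zero_equivalent_r (R : realType) (M M' : model R) :
  zero_at_initial M' -> equivalent M M' -> zero_at_initial M.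
Proof.
move=> hz [f [g fK gK] hf] i; have [j hj] := hz (f i); exists (g j).
by have [_ h _ _] := hf (g j) i; rewrite gK in h; rewrite h.
Qed.

(** Order and distinctness of the extremes come from the lift; what remains is that different arcs
    of one length are not nested. *)
Lemma translates_pca (R : realType) (V : model R) (n0 : (0 < narcs V)%N) F T (L : R) :
  lifts n0 F T -> 0 < L < len V -> (forall i : 'I_(narcs V), on_circle V (beg i)) ->
  (forall i : 'I_(narcs V), fin i = wrap V (beg i + L)) ->
  is_uca V /\ forall i : 'I_(narcs V), arc_len i = L.
Proof.
move=> hL /andP[L0 L1] hb hf.
have l0 : 0 < len V by lra.
have cwE (i : 'I_(narcs V)) (t : R) : 0 <= t < len V ->
    on_circle V (wrap V (beg i + t)) /\ cw V (beg i) (wrap V (beg i + t)) = t.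
  move=> /andP[t0 t1]; have /andP[b0 b1] := hb i.
  rewrite /on_circle /wrap /cw; case: (ltrP (beg i + t) (len V)) => h; split.
  - by apply/andP; split; lra.
  - by case: (lerP (beg i) (beg i + t)) => h'; lra.
  - by apply/andP; split; lra.
  by case: (lerP (beg i) (beg i + t - len V)) => h'; lra.
have al (i : 'I_(narcs V)) : arc_len i = L.
  by rewrite /arc_len hf; have [] := cwE i L ltac:(apply/andP; split; lra).
split=> //; split; last by move=> i j; rewrite !al.
split=> //.
- move=> i; split; first exact: hb.
  by rewrite hf; have [] := cwE i L ltac:(apply/andP; split; lra).
- by move=> i j ij; rewrite (lifts_beg hL).
- split=> [i j e|i j e].
    have := lifts_fin hL i j; have := lifts_fin hL j i; rewrite e ltxx.
    have := ltn_ord i; have := ltn_ord j; move=> h1 h2 h3 h4.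
    by apply/val_inj => /=; move: h3 h4; case: ifP => _; case: ifP => _; lia.
  by have := lifts_fin_beg hL j i; rewrite e ltxx.
move=> i j ij sub.
have nb : beg i <> beg j.
  move=> e; apply: ij; have := lifts_beg hL i j; have := lifts_beg hL j i.
  by rewrite e ltxx => h1 h2; apply/val_inj => /=; lia.
set D := cw V (beg j) (beg i).
have [D0 D1] : 0 < D /\ D < len V.
  have /andP[a0 a1] := hb i; have /andP[b0 b1] := hb j.
  by rewrite /D /cw; case: (lerP (beg j) (beg i)) => h; split; try lra;
    rewrite subr_gt0 lt_neqAle h andbT; apply/eqP => /esym.
(* A point of arc i outside arc j: at distance t from [beg i] it has passed the end of arc j, at L
   from [beg j], but has not come back to [beg j]. *)
have [t [t0 tL Dt]] : exists t, [/\ 0 < t, t < L & L <= D + t < len V].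
  case: (ltrP D L) => h; first by exists (L - D); split; try lra; apply/andP; split; lra.
  case: (lerP L (len V - D)) => h2.
    by exists (L / 2); split; try lra; apply/andP; split; lra.
  by exists ((len V - D) / 2); split; try lra; apply/andP; split; lra.
have [c1 c2] := cwE i t ltac:(apply/andP; split; lra).
have := sub _ c1; rewrite /arc /in_arc -!/(arc_len _) !al c2 t0 tL => /(_ isT).
have -> : cw V (beg j) (wrap V (beg i + t)) = D + t.
  have /andP[a0 a1] := hb i; have /andP[b0 b1] := hb j; case/andP: Dt => Dt0 Dt1.
  move: Dt0 Dt1 c2 D0 D1; rewrite /D /cw /wrap.
  case: (ltrP (beg i + t) (len V)) => h1; case: (lerP (beg j) (beg i)) => h2.
  - by case: (lerP (beg j) (beg i + t)) => h3 *; lra.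
  - by case: (lerP (beg j) (beg i + t)) => h3 *; lra.
  - by case: (lerP (beg j) (beg i + t - len V)) => h3 *; lra.
  by case: (lerP (beg j) (beg i + t - len V)) => h3 *; lra.
by case/andP=> _; case/andP: Dt; lra.
Qed.

Section Solve.
Variables (R : realType) (M : model R) (k c l : nat) (X : int -> int).
Hypothesis hM : is_pca M.
Hypothesis hz : zero_at_initial M.
Hypothesis n0 : (0 < narcs M)%N.
Local Notation n := (narcs M).
Local Notation F := (lF n0).
Local Notation G := (lG n0).
Let hc := lift_circ hM n0.
Hypothesis nowrap : forall i, (i <= k)%N -> forall z, iter i F z < z + n%:Z.
Hypothesis k1 : (1 <= k)%N.
Hypothesis hX : shifts n c X.
Hypothesis hh : hollows F G X l.
Hypothesis hn : long_noses F G X l k.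

(** Subtracting X 0 puts the beginning of A_0 at the point 0, so that all beginnings fall in [0,
    c). *)
Definition solution_beg (i : 'I_n) : int := X (i : nat)%:Z - X 0.
Definition solution_fin (i : 'I_n) : int :=
  let t := solution_beg i + l.+1%:Z in if t < c%:Z then t else t - c%:Z.

Definition solution : model R :=
  @Model R c%:R n (fun i => (solution_beg i)%:~R) (fun i => (solution_fin i)%:~R).

Local Notation U := solution.

(** By [iter_gap] an arc of length i l + 1 from X 0 ends before X (F^i 0 + 1), which [nowrap] keeps
    within one turn of X 0, a turn being c. *)
Let arc_c i : (i <= k)%N -> (i * l + 2 <= c)%N.
Proof.
move=> ik; have := iter_gap hc hX hh hn 0 ik; have := nowrap ik 0.
rewrite add0r => h1 h2.
have := solution_mono hc hX hh hn (a := iter i F 0 + 1) (b := n%:Z) ltac:(lia).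
by have := hX 0; rewrite add0r; lia.
Qed.

Let lbegU (z : int) : @lbeg R U n0 z = (X z - X 0)%:~R.
Proof.
have per (t u : int) : X (u + t * n%:Z) = X u + t * c%:Z.
  have nat_case (v : int) (m : nat) : X (v + m%:Z * n%:Z) = X v + m%:Z * c%:Z.
    elim: m => [|m IH]; first by rewrite !mul0r !addr0.
    by rewrite -addn1 PoszD !mulrDl !mul1r addrA hX IH addrA.
  case: t => m; first exact: nat_case.
  rewrite NegzE; move: (nat_case (u + - (m.+1%:Z) * n%:Z) m.+1).
  by rewrite !mulNr subrK => ->; rewrite addrK.
rewrite {2}(resE n0 z) per /lbeg /= /solution_beg.
by rewrite !intrB !intrD !intrM /= -!pmulrn; lra.
Qed.

Let lfinU i (z : int) : R := lbeg (M := U) n0 z + (i * l + 1)%N%:R.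

Let lfinUE i (z : int) : lfinU i z = (X z - X 0 + (i * l + 1)%N%:Z)%:~R.
Proof. by rewrite /lfinU lbegU [RHS]intrD. Qed.

Lemma solution_times_lifts i : (i <= k)%N ->
  @lifts R (times l i U) n0 (iter i F) (lfinU i).
Proof.
move=> ik.
have cmp (a b : int) : (X a < X b) = (a < b).
  case: (ltrP a b) => h.
    have := gap_ge2 hc hX hh hn a.
    by have := solution_mono hc hX hh hn (a := a + 1) (b := b) ltac:(lia); lia.
  by have := solution_mono hc hX hh hn h; lia.
have bounds z : X (iter i F z) < X z + (i * l + 1)%N%:Z < X (iter i F z + 1).
  have := iter_gap hc hX hh hn z ik; have := iter_forward_le hc hX hh hn i z; lia.
have lbegT z : @lbeg R (times l i U) n0 z = (X z - X 0)%:~R by exact: lbegU.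
split.
- by move=> a b; rewrite !lbegT ltr_int -(cmp a b); lia.
- move=> z; rewrite lfinUE !lbegT !ltr_int; have := bounds z; lia.
- split=> z; last by rewrite /lfinU lbegD addrAC.
  by rewrite !lfinUE ltr_int; have := cmp z (z + 1); lia.
- by move=> a; rewrite /lfinU /= (lbegE (M := U) n0).
move=> a; rewrite lfinUE /= [RHS](_ : _ = (X (a : nat)%:Z - X 0 + (i * l + 1)%N%:Z < c%:Z)); last first.
  by rewrite -(ltr_int R).
have := bounds (a : nat)%:Z; have hXn := hX 0; rewrite add0r in hXn.
case: (ltrP (iter i F (a : nat)%:Z) n%:Z) => h.
  have := solution_mono hc hX hh hn (a := iter i F (a : nat)%:Z + 1) (b := n%:Z) ltac:(lia).
  lia.
by have := solution_mono hc hX hh hn h; lia.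
Qed.

Let fin_solution (a : 'I_n) : @fin R U a = @fin R (times l 1 U) a.
Proof.
rewrite /= /solution_fin /wrap /=; move: (solution_beg a) => s.
have -> : (s%:~R + (1 * l + 1)%:R < c%:R :> R) = (s + l.+1%:Z < c%:Z).
  by rewrite -(ltr_int R) intrD mul1n addn1.
by case: ifP => _; rewrite ?intrB intrD mul1n addn1.
Qed.

Let solution_lifts : @lifts R U n0 F (lfinU 1).
Proof.
have [h1 h2 h3 h4 h5] := solution_times_lifts k1; split=> // i.
by rewrite fin_solution; exact: h4.
Qed.

Let on_circleU (i : 'I_n) : on_circle U (@beg R U i).
Proof.
rewrite -(lbegE (M := U) n0) lbegU /on_circle /=.
have h := ltn_ord i.
have := solution_mono hc hX hh hn (a := 0) (b := (i : nat)%:Z) ltac:(lia).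
have := solution_mono hc hX hh hn (a := (i : nat)%:Z + 1) (b := n%:Z) ltac:(lia).
have := gap_ge2 hc hX hh hn (i : nat)%:Z; have := hX 0; rewrite add0r => h1 h2 h3 h4.
by rewrite ler0z -[c%:R]/(c%:Z%:~R) ltr_int; apply/andP; split; lia.
Qed.

Let times_uca i : (i <= k)%N -> is_uca (times l i U) /\
  forall a : 'I_n, @arc_len R (times l i U) a = (i * l + 1)%N%:R.
Proof.
move=> ik; apply: (translates_pca (solution_times_lifts ik)) => //.
have := arc_c ik => h; apply/andP; split; first by rewrite ltr0n addn1.
by rewrite /= ltr_nat; lia.
Qed.

Let solution_uca : is_uca U /\ forall a : 'I_n, @arc_len R U a = l.+1%:R.
Proof.
apply: (translates_pca solution_lifts) => //.
  have := arc_c k1 => h; apply/andP; split; first by rewrite ltr0n.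
  by rewrite /= ltr_nat; lia.
by move=> i; rewrite fin_solution /= mul1n addn1.
Qed.

(** M and U have the lift F, and each i x U and U^i have the lift F^i, so all equivalences are
    instances of [lifts_equivalent]. *)
Lemma solutionP : mult_solution M k c l U.
Proof.
have Fb z : z <= F z < z + n%:Z by exact: circ_F hc z.
have [ucaU lenU] := solution_uca; have pcaU : is_pca U by case: ucaU.
have zU : zero_at_initial U by apply: (lifts_zero solution_lifts).
have FU : F =1 @lF R U n0.
  move=> z; apply/esym/(lF_unique pcaU); have [_ /(_ z) h _ _ _] := solution_lifts.
  by rewrite /lfin lenU; move: h; rewrite /lfinU mul1n addn1.
split.
- split=> // i; split; [exact: lenU|exact: intr_int|exact: intr_int].
- move=> i ik; split.
    have [u1 u2] := times_uca ik; split=> // a; split.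
    + by rewrite u2 addn1.
    + exact: intr_int.
    rewrite /= /wrap /=; case: ifP => _; rewrite ?rpredB ?rpredD ?intr_int ?natr_int //.
  apply: (small_eps pcaU (n0 := n0)) => g e hg he.
  have nw z : iter i (@lF R U n0) z < z + n%:Z.
    by rewrite -(iter_ext i FU); exact: nowrap.
  have hp := power_lifts pcaU hg he nw.
  have hp' := lifts_ext (iter_ext i (fsym FU)) hp.
  exact: (@lifts_equivalent R (times l i U) (power U i e) n0 n0 _ _ _ erefl
    (solution_times_lifts ik) hp').
exact: (@lifts_equivalent R M U n0 n0 _ _ _ erefl (pca_lifts n0 hM hz) solution_lifts).
Qed.

End Solve.

Section Sound.
Variables (R : realType) (M U : model R) (k c l : nat).
Hypothesis hM : is_pca M.
Hypothesis hz : zero_at_initial M.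
Hypothesis n0 : (0 < narcs M)%N.
Local Notation n := (narcs M).
Local Notation F := (lF n0).
Local Notation G := (lG n0).
Let hc := lift_circ hM n0.
Hypothesis nowrap : forall i, (i <= k)%N -> forall z, iter i F z < z + n%:Z.
Hypothesis k1 : (1 <= k)%N.
Hypothesis hU : mult_solution M k c l U.

(** X is the lift of the beginnings of U. Since i x U is equivalent to a power with lift F^i, its
    own lift is F^i, and [lF_spec] for i x U is the claimed pair of strict inequalities. *)
Lemma solution_lift : exists X : int -> R,
  [/\ (forall z, X (z + n%:Z) = X z + c%:R), (forall z, X z \is a Num.int) &
      forall i, (i <= k)%N -> forall z, X (iter i F z) < X z + (i * l + 1)%:R < X (iter i F z + 1)].
Proof.
case: hU => -[[pcaU _] lenU caU] mul eqv.
have zU := zero_equivalent hz eqv.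
have [f bf _] := eqv.
have m0 : (0 < narcs U)%N by exact: leq_ltn_trans (ltn_ord (f (Ordinal n0))).
have hcU := lift_circ pcaU m0.
have [en FU] := equivalent_lifts (pca_lifts n0 hM hz) (pca_lifts m0 pcaU zU)
  (circ_F hc) (circ_F hcU) eqv.
exists (lbeg m0); split.
- by move=> z; rewrite en lbegD lenU.
- move=> z; rewrite /lbeg lenU rpredD //; first by have [] := caU (res m0 z).
  by rewrite rpredM ?intr_int ?natr_int.
move=> i ik z; have [[[pcaT _] lenT caT] [d d0 hd]] := mul i ik.
have [g hg] := gap_exists pcaU m0.
have nw y : iter i (lF m0) y < y + (narcs U)%:Z.
  by rewrite -(iter_ext i FU) -en; exact: nowrap.
have [e [e0 e1 e2]] : exists e, [/\ 0 < e, e < d & e < g / (narcs U).+1%:R].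
  have g1 : 0 < g / (narcs U).+1%:R by case: hg => g0 _ _ _; rewrite divr_gt0.
  set y := g / _ in g1 *; exists (Num.min d y / 2).
  have m1 : 0 < Num.min d y by rewrite lt_min d0.
  have m2 : Num.min d y <= d by rewrite ge_min lexx.
  have m3 : Num.min d y <= y by rewrite ge_min lexx orbT.
  by split; lra.
have he : 0 < e < g / (narcs U).+1%:R by apply/andP.
have hp := power_lifts pcaU hg he nw.
have eqT := hd e ltac:(apply/andP; split; lra).
have bp y : y <= iter i (lF m0) y < y + (narcs U)%:Z by rewrite (iter_ge hcU) nw.
(* The position of 0 in i x U is inherited from the power. *)
have zT : zero_at_initial (times l i U).
  by apply: zero_equivalent_r eqT; apply: (lifts_zero hp).
have hcT := lift_circ (M := times l i U) pcaT m0.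
have [_ FT] := equivalent_lifts (M := times l i U) (pca_lifts (M := times l i U) m0 pcaT zT) hp
  (circ_F hcT) bp eqT.
have := lF_spec (M := times l i U) pcaT m0 z.
rewrite FT -(iter_ext i FU) /lfin.
have [-> _ _] := caT (res m0 z).
by rewrite -addn1.
Qed.

(** Beginnings are integers, so each strict inequality gains 1: the length i l + 1 yields the
    weights i l + 2 of noses and - l of hollows. Short noses are covered too. *)
Lemma solution_sound : exists x : 'I_n -> R, forall f : edge M,
  synthetic_full k f -> x f.1.2 + (sep c l f)%:~R <= x f.2.
Proof.
have [X [XD Xi Xb]] := solution_lift.
have XDM (z t : int) : X (z + t * n%:Z) = X z + c%:R * t%:~R.
  have nat_case (v : int) (m : nat) : X (v + m%:Z * n%:Z) = X v + c%:R * m%:Z%:~R.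
    elim: m => [|m IH]; first by rewrite mul0r mulr0z mulr0 !addr0.
    by rewrite -addn1 PoszD mulrDl mul1r addrA XD IH intrD mulrDr mulr1 addrA.
  case: t => m; first exact: nat_case.
  rewrite NegzE; move: (nat_case (z + - (m.+1%:Z) * n%:Z) m.+1).
  by rewrite mulNr subrK => ->; rewrite intrN mulrN addrK.
have XE (z : int) : X (res n0 z : nat)%:Z = X z - c%:R * (z %/ n%:Z)%Z%:~R.
  by rewrite {2}(resE n0 z) XDM addrK.
have Xlt (a b : int) (m : nat) : X a < X b + m%:R -> X a + 1 <= X b + m%:R.
  have /intrP [u ->] := Xi a; have /intrP [v ->] := Xi b.
  rewrite -[m%:R]/(m%:Z%:~R) -intrD ltr_int -[1]/(1%:~R) -intrD ler_int; lia.
have Xgt (a b : int) (m : nat) : X a + m%:R < X b -> X a + m%:R + 1 <= X b.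
  have /intrP [u ->] := Xi a; have /intrP [v ->] := Xi b.
  rewrite -[m%:R]/(m%:Z%:~R) -intrD ltr_int -[1]/(1%:~R) -intrD ler_int; lia.
exists (fun i => X (i : nat)%:Z) => -[[[i|] a] b] /=.
  case=> ik [_ hb].
  have [u bu] : exists u, b = res n0 u by exists (b : nat)%:Z; rewrite res_id.
  have [w aw g] : exists2 w, a = res n0 w & gc F G i w (u - 1).
    by apply: (Hl_iter_gc hM); rewrite -(res_pred n0) -bu.
  have ep := gc_iter g; have nw := nowrap ik w; have ge := iter_ge hc i w.
  have /andP[_ /Xgt h] := Xb i ik w; rewrite -ep subrK in h nw ge.
  rewrite bu aw !XE (@div_step _ _ hM n0 w u); last by lia.
  rewrite natrD in h.
  case: ifP => _; rewrite ?subr0 ?addr0 !(intrD, intrN, intrB) /=; rewrite -?pmulrn; lra.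
move=> hol; have ne := is_hollow_neq hol; case: hol => _ h1 h2.
have [u bu] : exists u, b = res n0 u by exists (b : nat)%:Z; rewrite res_id.
have aE : a = res n0 (F u) by rewrite h1 bu (Fr_lift n0).
have nu : F u != u by apply: contraNneq ne => e; rewrite aE bu e.
have /andP[/Xlt h _] := Xb 1%N k1 u; have /andP[b1 b2] := circ_F hc u.
rewrite bu aE !XE (@div_step _ _ hM n0 u (F u)); last by lia.
rewrite mul1n natrD /= in h.
case: ifP => _; rewrite ?subr0 ?addr0 !(intrD, intrN, intrB) /=; rewrite -?pmulrn; lra.
Qed.

End Sound.

(** * Longest walks by layers *)

Section Layers.
Variables (n : nat) (s1 s2 : 'I_n -> 'I_n) (w1 w2 : 'I_n -> int).

Definition relax (x y : int) : int := if 0 < y - x then y else x.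

(* dist j v is the largest weight of a walk of at most j edges ending at v;
   every vertex has exactly two incoming edges, from s1 v and s2 v. *)
Fixpoint dist (j : nat) (v : 'I_n) : int :=
  if j is i.+1 then
    relax (relax (dist i v) (dist i (s1 v) + w1 v)) (dist i (s2 v) + w2 v)
  else 0.

Definition first_edge j v : bool := dist j (s1 v) + w1 v == dist j.+1 v.
Definition pred_vertex j v := if first_edge j v then s1 v else s2 v.
Definition pred_weight j v := if first_edge j v then w1 v else w2 v.

Lemma dist_step j v : [/\ dist j v <= dist j.+1 v,
  dist j (s1 v) + w1 v <= dist j.+1 v & dist j (s2 v) + w2 v <= dist j.+1 v].
Proof. by rewrite /= /relax; split; do 2 case: ifP; lia. Qed.

Lemma dist_mono i j v : (i <= j)%N -> dist i v <= dist j v.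
Proof.
move=> ij; have -> : j = (i + (j - i))%N by lia.
elim: (j - i)%N => [|d IH]; first by rewrite addn0.
by rewrite addnS; have [h _ _] := dist_step (i + d) v; lia.
Qed.

Lemma pred_dist j v : dist j v < dist j.+1 v ->
  dist j.+1 v = dist j (pred_vertex j v) + pred_weight j v.
Proof.
rewrite /pred_vertex /pred_weight /first_edge; case: eqP => [->//|].
by rewrite /= /relax; do 2 case: ifP; lia.
Qed.

(** If the predecessor had not improved at its last layer, its edge would have given v the new value
    one layer earlier. *)
Lemma pred_dist_lt i v : dist i.+1 v < dist i.+2 v ->
  dist i (pred_vertex i.+1 v) < dist i.+1 (pred_vertex i.+1 v).
Proof.
move=> lt; have := pred_dist lt; have [_ h1 h2] := dist_step i v.
by rewrite /pred_vertex /pred_weight; case: ifP => _; lia.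
Qed.

Lemma relaxed_feasible j : (forall v, dist j.+1 v <= dist j v) -> forall v,
  dist j (s1 v) + w1 v <= dist j v /\ dist j (s2 v) + w2 v <= dist j v.
Proof. by move=> h v; have [_ h1 h2] := dist_step j v; have := h v; lia. Qed.

Variable bad : 'I_n.
Hypothesis bad_lt : dist n.-1 bad < dist n bad.

Fixpoint trace (t : nat) : 'I_n :=
  if t is i.+1 then pred_vertex (n - t) (trace i) else bad.

Lemma trace_lt t : (t < n)%N -> dist (n - t.+1) (trace t) < dist (n - t) (trace t).
Proof.
elim: t => [|t IH] tn; first by rewrite subn0 subn1.
have := IH ltac:(lia); have -> : (n - t = (n - t.+2).+2)%N by lia.
have -> : (n - t.+1 = (n - t.+2).+1)%N by lia.
move/pred_dist_lt; rewrite /=.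
by have -> : (n - t.+1 = (n - t.+2).+1)%N by lia.
Qed.

Lemma trace_dist t : (t < n)%N -> dist (n - t) (trace t) =
  dist (n - t.+1) (trace t.+1) + pred_weight (n - t.+1) (trace t).
Proof.
move=> tn; have := trace_lt tn; have -> : (n - t = (n - t.+1).+1)%N by lia.
by move/pred_dist.
Qed.

(** By [trace_dist] the weights along the trace telescope, so this difference of two layers at one
    vertex is the weight of the closed walk. *)
Lemma trace_cycle_pos lo hi : (lo < hi <= n)%N -> trace lo = trace hi ->
  dist (n - hi) (trace hi) < dist (n - lo) (trace lo).
Proof.
move=> /andP[lh hn] <-; apply: le_lt_trans (trace_lt (leq_trans lh hn)).
by apply: dist_mono; lia.
Qed.

End Layers.

(** * Running time bounds for programs *)

Definition runs (p : cmd) (m : memory) (T : nat) (Q : memory -> Prop) : Prop :=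
  exists t m', [/\ exec p m t m', (t <= T)%N & Q m'].

Fixpoint writes (p : cmd) : seq nat :=
  match p with
  | Skip => [::]
  | Put a _ _ => [:: a]
  | Seq p q => writes p ++ writes q
  | IfPos _ p q => writes p ++ writes q
  | WhilePos _ p => writes p
  end.

Definition same_off (s : seq nat) (m m' : memory) : Prop :=
  forall a, a \notin s -> m' a =1 m a.

Lemma exec_writes p m t m' : exec p m t m' -> same_off (writes p) m m'.
Proof.
elim=> {p m t m'} //=.
- by move=> a x y m b; rewrite inE => /negPf h i; rewrite /update h.
- move=> p q m t m' t' m'' _ h1 _ h2 a; rewrite mem_cat negb_or => /andP[a1 a2] i.
  by rewrite h2 // h1.
- move=> x p q m t m' _ _ h a; rewrite mem_cat negb_or => /andP[a1 a2].
  exact: h.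
- move=> x p q m t m' _ _ h a; rewrite mem_cat negb_or => /andP[a1 a2].
  exact: h.
move=> x p m t m' t' m'' _ _ h1 _ h2 a ap i; by rewrite h2 // h1.
Qed.

Lemma runs_weaken p m T T' (Q Q' : memory -> Prop) : (T <= T')%N ->
  (forall m', Q m' -> Q' m') -> runs p m T Q -> runs p m T' Q'.
Proof.
move=> TT QQ [t [m' [h1 h2 h3]]]; exists t, m'; split=> //; last exact: QQ.
exact: leq_trans TT.
Qed.

Lemma runs_writes p m T Q : runs p m T Q ->
  runs p m T (fun m' => Q m' /\ same_off (writes p) m m').
Proof.
move=> [t [m' [h1 h2 h3]]]; exists t, m'; split=> //; split=> //.
exact: exec_writes h1.
Qed.

Lemma runs_skip m (Q : memory -> Prop) : Q m -> runs Skip m 1 Q.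
Proof. by move=> h; exists 1%N, m; split=> //; constructor. Qed.

Lemma runs_put a x y m (Q : memory -> Prop) :
  Q (update m a (eval m x) (eval m y)) -> runs (Put a x y) m 1 Q.
Proof. by move=> h; eexists 1%N, _; split; [constructor| |exact: h]. Qed.

Lemma runs_seq p q m T1 T2 Q :
  runs p m T1 (fun m' => runs q m' T2 Q) -> runs (Seq p q) m (T1 + T2) Q.
Proof.
move=> [t1 [m1 [h1 l1 [t2 [m2 [h2 l2 h]]]]]].
by exists (t1 + t2)%N, m2; split; [exact: ExSeq h1 h2|exact: leq_add|].
Qed.

Lemma runs_if x p q m T1 T2 Q : (0 < eval m x -> runs p m T1 Q) ->
  (eval m x <= 0 -> runs q m T2 Q) -> runs (IfPos x p q) m (maxn T1 T2).+1 Q.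
Proof.
move=> h1 h2; case: (ltrP 0 (eval m x)) => h.
  have [t [m' [e l hQ]]] := h1 h; exists t.+1, m'; split=> //; first exact: ExIfTrue.
  by rewrite ltnS leq_max l.
have [t [m' [e l hQ]]] := h2 h; exists t.+1, m'; split=> //; first exact: ExIfFalse.
by rewrite ltnS leq_max l orbT.
Qed.

Definition IfEq (x y : expr) (p q : cmd) : cmd :=
  IfPos (Sub x y) q (IfPos (Sub y x) q p).

Lemma runs_ifeq x y p q m T1 T2 Q : (eval m x = eval m y -> runs p m T1 Q) ->
  (eval m x <> eval m y -> runs q m T2 Q) ->
  runs (IfEq x y p q) m (maxn T1 T2).+2 Q.
Proof.
move=> h1 h2; apply: (@runs_weaken _ _ (maxn T2 (maxn T2 T1).+1).+1 _ Q Q); [lia|by []|].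
apply: runs_if => /= c1; first by apply: h2; lia.
by apply: runs_if => /= c2; [apply: h2; lia|apply: h1; lia].
Qed.

Definition var (a : nat) : expr := Get a (Cst 0).
Definition set (a : nat) (x : expr) : cmd := Put a (Cst 0) x.

Definition For (v : nat) (N : expr) (body : cmd) : cmd :=
  Seq (set v (Cst 0))
    (WhilePos (Sub N (var v)) (Seq body (set v (Add (var v) (Cst 1))))).

(** The counter lives in memory, so the invariant is asked of the memory after the counter is set. A
    round costs [T + 2], with the test and the increment; the final 2 pays for the initialization
    and the last test. *)
Lemma runs_for (v : nat) N body (m : memory) T (B : nat) (I : nat -> memory -> Prop) :
  v \notin writes body ->
  (forall m' : memory, same_off (v :: writes body) m m' -> eval m' N = B%:Z) ->
  I 0%N (update m v 0 0) ->
  (forall (j : nat) (m' : memory), (j < B)%N -> m' v 0 = j%:Z ->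
     same_off (v :: writes body) m m' -> I j m' ->
     runs body m' T (fun m'' => I j.+1 (update m'' v 0 j.+1%:Z))) ->
  runs (For v N body) m (B * (T + 2) + 2)
    (fun m' => I B m' /\ same_off (v :: writes body) m m').
Proof.
move=> vb hN I0 hb.
have loop (d j : nat) (m1 : memory) : (j + d = B)%N -> m1 v 0 = j%:Z ->
    same_off (v :: writes body) m m1 -> I j m1 ->
    runs (WhilePos (Sub N (var v)) (Seq body (set v (Add (var v) (Cst 1)))))
      m1 (d * (T + 2) + 1) (fun m' => I B m' /\ same_off (v :: writes body) m m').
  elim: d j m1 => [|d IH] j m1 jd mj s1 Ij.
    exists 1%N, m1; split=> //; first by apply: ExWhileFalse; rewrite /= hN // mj; lia.
    by have <- : j = B by lia.
  have := runs_writes (hb j m1 ltac:(lia) mj s1 Ij).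
  case=> [t [m2 [e2 l2 [I2 s2]]]].
  have m2j : m2 v 0 = j%:Z by rewrite s2.
  have s3 : same_off (v :: writes body) m (update m2 v 0 j.+1%:Z).
    move=> a; rewrite inE negb_or => /andP[/negPf h ha] i; rewrite /update h /=.
    by rewrite s2 // s1 // inE negb_or h.
  have mj3 : update m2 v 0 j.+1%:Z v 0 = j.+1%:Z by rewrite /update !eqxx.
  have [t' [m' [e' l' h']]] := IH j.+1 _ ltac:(lia) mj3 s3 I2.
  exists (t + 1 + t').+1, m'; split=> //; last by lia.
  apply: (ExWhileTrue (m' := update m2 v 0 j.+1%:Z)) e'.
    by rewrite /= hN // mj; lia.
  apply: ExSeq e2 _; have -> : j.+1%:Z = eval m2 (Add (var v) (Cst 1)) by rewrite /= m2j; lia.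
  exact: ExPut.
apply: (@runs_weaken _ _ (1 + (B * (T + 2) + 1)) _ _ _ _ (fun _ h => h)); first by lia.
apply: runs_seq; apply: runs_put => /=; apply: (loop B 0%N) => //.
  by rewrite /update !eqxx.
by move=> a; rewrite inE negb_or => /andP[/negPf h _] i; rewrite /update h.
Qed.

(** * The decision program *)

Lemma code_inj n : injective (@code n).
Proof. by move=> i j [/val_inj]. Qed.

Lemma code_eq n (i j : 'I_n) : (code i == code j) = (i == j).
Proof. exact: (inj_eq (@code_inj n)). Qed.

Definition parK : expr := Get 0 (Cst 0).
Definition parC : expr := Get 0 (Cst 1).
Definition parL : expr := Get 0 (Cst 2).
Definition numN : expr := var 2.
Definition curV : expr := var 20.

(* Arrays 30, 31 describe the 1-hollow into v; arrays 32, 33, 34 the nose. *)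
Definition hollow_prog : cmd :=
  let dummy := Seq (Put 30 curV curV) (Put 31 curV (Cst 0)) in
  IfEq (Get 5 (Get 6 curV)) curV
    (IfEq (Get 6 curV) curV dummy
       (Seq (Put 30 curV (Get 6 curV))
          (IfPos (Sub (Get 6 curV) curV) (Put 31 curV (Sub (Cst 0) parL))
             (Put 31 curV (Sub parC parL)))))
    dummy.

(** Without multiplication, variable 23 accumulates [i * l] while variable 22 counts i. Bottom is
    coded by -1, so once it is met the test fails and the remaining rounds change nothing. *)
Definition walk_prog : cmd :=
  Seq (set 21 (Get 3 curV)) (Seq (set 22 (Cst 0)) (Seq (set 23 (Cst 0))
    (For 24 parK
       (IfPos (Add (Get 7 (var 21)) (Cst 1))
          (Seq (set 21 (Get 7 (var 21)))
             (Seq (set 22 (Add (var 22) (Cst 1))) (set 23 (Add (var 23) parL))))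
          Skip)))).

Definition nose_prog : cmd :=
  let dummy := Seq (Put 32 curV curV) (Put 33 curV (Cst 0)) in
  let store := Seq (Put 32 curV (var 21)) (Seq (Put 34 curV (var 22))
    (IfPos (Sub curV (var 21)) (Put 33 curV (Add (var 23) (Cst 2)))
       (Put 33 curV (Sub (Add (var 23) (Cst 2)) parC)))) in
  IfPos (Sub parK (var 22))
    (IfPos (Add (Get 7 (var 21)) (Cst 1)) dummy
       (IfPos (Add (Get 8 curV) (Cst 1)) dummy store))
    store.

Definition slots_prog : cmd :=
  For 20 numN (Seq walk_prog (Seq hollow_prog nose_prog)).

Section Algorithm.
Variables (n k c l : nat) (lf fl fr : 'I_n -> 'I_n) (hl hr : 'I_n -> option 'I_n).

Local Notation wk := (walk k lf hl).
Local Notation hsl := (hollow_slot fr fl).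
Local Notation nsl := (nose_slot k lf hl hr).

(** The machine knows indices, not positions; [beg_le] identifies this comparison with the one in
    [sep]. *)
Definition hollow_weight (v : 'I_n) : int :=
  - l%:Z + (if (fr v <= v)%N then c%:Z else 0).
Definition nose_weight (v : 'I_n) : int :=
  ((wk v).1 * l)%N%:Z + 2 - (if (v <= (wk v).2)%N then c%:Z else 0).
Definition src1 v := if hsl v then fr v else v.
Definition src2 v := if nsl v then (wk v).2 else v.
Definition wt1 v := if hsl v then hollow_weight v else 0.
Definition wt2 v := if nsl v then nose_weight v else 0.

Definition inputs (m : memory) : Prop :=
  [/\ m 0%N 0 = k%:Z, m 0%N 1 = c%:Z, m 0%N 2 = l%:Z, m 2%N 0 = n%:Z &
    forall i : 'I_n,
      [/\ m 3%N (code i) = code (lf i), m 5%N (code i) = code (fl i),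
          m 6%N (code i) = code (fr i), m 7%N (code i) = code_opt (hl i) &
          m 8%N (code i) = code_opt (hr i)]].

Lemma inputs_same s m m' : all (leq 9) s -> same_off s m m' -> inputs m -> inputs m'.
Proof.
move=> hs h [h1 h2 h3 h4 h5].
have hN a : (a < 9)%N -> a \notin s.
  by move=> a9; apply/negP => /(allP hs) /=; lia.
split; rewrite ?h ?hN // => i; have [? ? ? ? ?] := h5 i.
by split; rewrite h ?hN.
Qed.

Lemma code_opt_pos (o : option 'I_n) : (0 < code_opt o + 1) = (o != None).
Proof. by case: o => [i|] //=; rewrite /code; lia. Qed.

Definition slots (m : memory) (v : 'I_n) : Prop :=
  [/\ m 30%N (code v) = code (src1 v), m 31%N (code v) = wt1 v,
      m 32%N (code v) = code (src2 v), m 33%N (code v) = wt2 v &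
      nsl v -> m 34%N (code v) = (wk v).1%:Z].

Lemma walk_runs m v : inputs m -> m 20%N 0 = code v ->
  runs walk_prog m (k * 6 + 5) (fun m' =>
    [/\ m' 21%N 0 = code (wk v).2, m' 22%N 0 = (wk v).1%:Z,
        m' 23%N 0 = ((wk v).1 * l)%N%:Z & same_off [:: 21; 22; 23; 24]%N m m']).
Proof.
move=> hm mv; apply: (@runs_weaken _ _ (1 + (1 + (1 + (k * (4 + 2) + 2)))) _ _ _ _ (fun _ h => h)).
  by lia.
apply: runs_seq; apply: runs_put; apply: runs_seq; apply: runs_put.
apply: runs_seq; apply: runs_put; rewrite /= mv.
have [_ _ _ _ /(_ v) [e3 _ _ _ _]] := hm; rewrite e3.
set m1 := update _ 23 0 0.
have s1 : same_off [:: 21; 22; 23; 24]%N m m1.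
  move=> a; rewrite !inE !negb_or => /and4P[/negPf a1 /negPf a2 /negPf a3 _] i.
  by rewrite /m1 /update a1 a2 a3.
pose I (t : nat) (m' : memory) := let s := iter t (walk_step hl) (0%N, lf v) in
  [/\ m' 21%N 0 = code s.2, m' 22%N 0 = s.1%:Z & m' 23%N 0 = (s.1 * l)%N%:Z].
apply: (@runs_weaken _ _ _ _ (fun m' => I k m' /\ same_off [:: 24; 21; 22; 23]%N m1 m') _ (leqnn _)).
  move=> m' [[h1 h2 h3] h4]; split=> // a ha i.
  by rewrite h4 ?s1 //; move: ha; rewrite !inE !negb_or => /and4P[-> -> -> ->].
apply: runs_for => //.
- move=> m' hs; rewrite /= hs // s1 //; by case: hm.
- move=> j m' jk _ hs [h1 h2 h3].
  have hm' : inputs m' by apply: inputs_same hs _ => //; apply: inputs_same s1 _.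
  case: hm' => _ _ hl2 _ /(_ (iter j (walk_step hl) (0%N, lf v)).2) [_ _ _ e7 _].
  have eI : iter j.+1 (walk_step hl) (0%N, lf v) =
     walk_step hl (iter j (walk_step hl) (0%N, lf v)) by [].
  rewrite /I eI; move: h1 h2 h3 e7 {eI}; case: (iter j _ _) => t a /= h1 h2 h3 e7.
  apply: (@runs_if _ _ _ _ (1 + (1 + 1)) 1) => /=; rewrite h1 e7.
    rewrite code_opt_pos /walk_step /= => hN.
    apply: runs_seq; apply: runs_put; apply: runs_seq; apply: runs_put; apply: runs_put.
    rewrite /update /= h1 h2 h3 e7 hl2.
    case: (hl a) hN => // b _ /=; split=> //; lia.
  rewrite leNgt code_opt_pos negbK /walk_step /= => /eqP ->.
  by apply: runs_skip; rewrite /update /=.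
Qed.


Definition same_but (x : int) (m m' : memory) : Prop :=
  forall a i, i != x -> m' a i = m a i.

Lemma hollow_runs m v : inputs m -> m 20%N 0 = code v ->
  runs hollow_prog m 7 (fun m' =>
    [/\ m' 30%N (code v) = code (src1 v), m' 31%N (code v) = wt1 v &
        same_but (code v) m m']).
Proof.
move=> hm mv; have [_ h1 h2 _ h4] := hm.
have [_ _ e6 _ _] := h4 v; have [_ e5 _ _ _] := h4 (fr v).
have dummy : ~~ hsl v ->
    runs (Seq (Put 30 curV curV) (Put 31 curV (Cst 0))) m (1 + 1) (fun m' =>
    [/\ m' 30%N (code v) = code (src1 v), m' 31%N (code v) = wt1 v &
        same_but (code v) m m']).
  move=> hv; apply: runs_seq; apply: runs_put; apply: runs_put; rewrite /= mv.
  rewrite /src1 /wt1 (negPf hv) /update /= mv; split; rewrite ?eqxx //.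
  by move=> a i /negPf hi; rewrite hi !andbF.
apply: (@runs_ifeq _ _ _ _ _ (maxn 2 (1 + (maxn 1 1).+1)).+2 2) => /=; rewrite mv e6 e5; last first.
  by move=> ne; apply: dummy; apply/negP => /andP[/eqP e _]; apply: ne; rewrite e.
move/code_inj=> e; apply: runs_ifeq => /=; rewrite mv e6.
  by move=> /code_inj f; apply: dummy; rewrite /hollow_slot f eqxx andbF.
move=> ne; have hv : hsl v.
  by rewrite /hollow_slot e eqxx; apply/eqP => f; apply: ne; rewrite f.
apply: runs_seq; apply: runs_put; rewrite /= mv e6.
by apply: runs_if; rewrite /update /= mv e6 => cmp;
  apply: runs_put; rewrite /= mv ?h1 h2 /src1 /wt1 hv /hollow_weight /update /= ?mv ?h1 ?h2;
  (split; [by rewrite eqxx| by rewrite eqxx; case: ifP; move: cmp; rewrite /code; lia |]);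
  move=> a i /negPf hi; rewrite hi !andbF.
Qed.

Lemma nose_runs m v : inputs m -> m 20%N 0 = code v ->
  m 21%N 0 = code (wk v).2 -> m 22%N 0 = (wk v).1%:Z ->
  m 23%N 0 = ((wk v).1 * l)%N%:Z ->
  runs nose_prog m 7 (fun m' =>
    [/\ m' 32%N (code v) = code (src2 v), m' 33%N (code v) = wt2 v,
        nsl v -> m' 34%N (code v) = (wk v).1%:Z & same_but (code v) m m']).
Proof.
move=> hm mv m21 m22 m23; have [h0 h1 h2 _ h4] := hm.
have [_ _ _ _ e8] := h4 v; have [_ _ _ e7 _] := h4 (wk v).2.
have dummy : ~~ nsl v ->
    runs (Seq (Put 32 curV curV) (Put 33 curV (Cst 0))) m (1 + 1) (fun m' =>
    [/\ m' 32%N (code v) = code (src2 v), m' 33%N (code v) = wt2 v,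
        nsl v -> m' 34%N (code v) = (wk v).1%:Z & same_but (code v) m m']).
  move=> hv; apply: runs_seq; apply: runs_put; apply: runs_put; rewrite /= mv.
  rewrite /src2 /wt2 (negPf hv) /update /= mv; split; rewrite ?eqxx //.
  by move=> a i /negPf hi; rewrite hi !andbF.
have store : nsl v -> runs (Seq (Put 32 curV (var 21)) (Seq (Put 34 curV (var 22))
    (IfPos (Sub curV (var 21)) (Put 33 curV (Add (var 23) (Cst 2)))
       (Put 33 curV (Sub (Add (var 23) (Cst 2)) parC))))) m (1 + (1 + (maxn 1 1).+1)) (fun m' =>
    [/\ m' 32%N (code v) = code (src2 v), m' 33%N (code v) = wt2 v,
        nsl v -> m' 34%N (code v) = (wk v).1%:Z & same_but (code v) m m']).
  move=> hv; apply: runs_seq; apply: runs_put; apply: runs_seq; apply: runs_put.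
  rewrite /= mv m21 /update /= ?m22 ?mv.
  by apply: runs_if; rewrite /update /= mv m21 => cmp; apply: runs_put;
    rewrite /= mv m23 ?h1 /src2 /wt2 hv /nose_weight /update /= ?mv ?m23 ?h1;
    (split; [by rewrite eqxx| by rewrite eqxx; case: ifP; move: cmp; rewrite /code; lia
      | by rewrite eqxx|]); move=> a i /negPf hi; rewrite hi !andbF.
have wk_le : ((wk v).1 <= k)%N by have := walkP k lf hl v; case: (wk v) => ? ? [].
apply: (@runs_if _ _ _ _ (maxn 2 (maxn 2 4).+1).+1 4) => /=; rewrite h0 m22 => cmp.
  have ne : ((wk v).1 == k) = false by apply/eqP; lia.
  apply: runs_if => /=; rewrite m21 e7.
    by rewrite code_opt_pos => /negPf hN; apply: dummy; rewrite /nose_slot ne hN.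
  rewrite leNgt code_opt_pos negbK => hN.
  apply: runs_if => /=; rewrite mv e8.
    by rewrite code_opt_pos => /negPf h8; apply: dummy; rewrite /nose_slot ne h8 andbF.
  rewrite leNgt code_opt_pos negbK => h8.
  by apply: store; rewrite /nose_slot hN h8 orbT.
apply: store; rewrite /nose_slot; apply/orP; left; apply/eqP.
by move: wk_le cmp; lia.
Qed.

Lemma slots_runs m : inputs m ->
  runs slots_prog m (n * (k * 6 + 21) + 2) (fun m' => inputs m' /\ forall v, slots m' v).
Proof.
move=> hm.
pose I (j : nat) (m' : memory) := forall v : 'I_n, (v < j)%N -> slots m' v.
pose ws := 20%N :: writes (Seq walk_prog (Seq hollow_prog nose_prog)).
have keep m' : same_off ws m m' -> inputs m' by move=> hs; apply: inputs_same hs hm.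
apply: (@runs_weaken _ _ (n * (k * 6 + 5 + (7 + 7) + 2) + 2) _
  (fun m' => I n m' /\ same_off ws m m')); first by lia.
  by move=> m' [hI hs]; split; [exact: keep|move=> v; apply: hI].
apply: runs_for => //.
  by move=> m' /keep [_ _ _ h _].
move=> j m' jn mj hs hI; pose v := Ordinal jn.
have mv : m' 20%N 0 = code v by rewrite mj.
have hm' := keep _ hs.
apply: runs_seq.
apply: (runs_weaken (leqnn _) _ (walk_runs hm' mv)) => m1 [w1 w2 w3 w4].
have hm1 : inputs m1 by apply: inputs_same w4 hm'.
have mv1 : m1 20%N 0 = code v by rewrite w4.
apply: runs_seq.
apply: (runs_weaken (leqnn _) _ (runs_writes (hollow_runs hm1 mv1))) => m2 [[x1 x2 x3] x4].
have hm2 : inputs m2 by apply: inputs_same x4 hm1.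
have [y1 y2 y3 y4] : [/\ m2 20%N 0 = code v, m2 21%N 0 = code (wk v).2,
  m2 22%N 0 = (wk v).1%:Z & m2 23%N 0 = ((wk v).1 * l)%N%:Z] by rewrite !x4.
apply: (runs_weaken (leqnn _) _ (runs_writes (nose_runs hm2 y1 y2 y3 y4))) => m3 [[z1 z2 z3 z5] z4].
move=> u; rewrite ltnS leq_eqVlt => /orP[/eqP uv|uj].
  have -> : u = v by apply/val_inj.
  by split; rewrite /update //= z4.
have ne : code u != code v.
  by rewrite code_eq; apply: contraTneq uj => -> /=; rewrite ltnn.
have [a1 a2 a3 a4 a5] := hI u uj.
by split; rewrite /update //= ?z5 ?x3 ?w4 // => /a5.
Qed.

End Algorithm.

(* Array 35 holds dist j v at index j * n + v; variable 25 is a multiple of n. *)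
Definition relax_prog : cmd :=
  let y1 := Add (Get 35 (Add (var 25) (Get 30 curV))) (Get 31 curV) in
  let y2 := Add (Get 35 (Add (var 25) (Get 32 curV))) (Get 33 curV) in
  Seq (set 27 (Get 35 (Add (var 25) curV)))
    (Seq (IfPos (Sub y1 (var 27)) (set 27 y1) Skip)
       (Seq (IfPos (Sub y2 (var 27)) (set 27 y2) Skip)
          (Put 35 (Add (Add (var 25) numN) curV) (var 27)))).

Definition dist_prog : cmd :=
  Seq (For 20 numN (Put 35 curV (Cst 0)))
    (Seq (set 25 (Cst 0))
       (For 26 numN (Seq (For 20 numN relax_prog) (set 25 (Add (var 25) numN))))).

Definition check_prog : cmd :=
  Seq (set 28 (Cst (-1)))
    (For 20 numN
       (IfPos (Sub (Get 35 (Add (var 25) curV))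
                   (Get 35 (Add (Sub (var 25) numN) curV)))
          (set 28 curV) Skip)).

Definition model_prog : cmd :=
  let t := Add (Get 10 curV) (Add parL (Cst 1)) in
  Seq (For 20 numN
         (Seq (Put 10 curV (Sub (Get 35 (Add (Sub (var 25) numN) curV))
                                (Get 35 (Sub (var 25) numN))))
            (IfPos (Sub parC t) (Put 11 curV t) (Put 11 curV (Sub t parC)))))
    (set 9 (Cst 1)).

Definition trace_prog : cmd :=
  Seq (Put 36 (Cst 0) (var 28))
    (For 26 numN
       (Seq (set 25 (Sub (var 25) numN))
          (Seq (set 20 (Get 36 (var 26)))
             (IfEq (Add (Get 35 (Add (var 25) (Get 30 curV))) (Get 31 curV))
                   (Get 35 (Add (Add (var 25) numN) curV))
                (Seq (Put 36 (Add (var 26) (Cst 1)) (Get 30 curV))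
                   (Put 37 (var 26) (Cst (-1))))
                (Seq (Put 36 (Add (var 26) (Cst 1)) (Get 32 curV))
                   (Put 37 (var 26) (Get 34 curV))))))).

(* Variables 39 and 29 receive the two ends of the first repetition. *)
Definition cycle_prog : cmd :=
  Seq (For 20 numN (Put 38 curV (Cst (-1))))
    (Seq (set 29 (Cst 0))
       (Seq (set 39 (Cst 0))
          (For 26 (Add numN (Cst 1))
             (IfPos (var 29) Skip
                (IfPos (Add (Get 38 (Get 36 (var 26))) (Cst 1))
                   (Seq (set 29 (var 26)) (set 39 (Get 38 (Get 36 (var 26)))))
                   (Put 38 (Get 36 (var 26)) (var 26))))))).

Definition family_prog : cmd :=
  Seq (For 26 (Sub (var 29) (var 39))
         (Seq (Put 11 (var 26) (Get 37 (Add (var 39) (var 26))))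
            (Seq (Put 12 (var 26) (Get 36 (Add (Add (var 39) (var 26)) (Cst 1))))
               (Put 13 (var 26) (Get 36 (Add (var 39) (var 26)))))))
    (Seq (Put 10 (Cst 0) (Sub (var 29) (var 39))) (set 9 (Cst 0))).

Section Phases.
Variables (n k c l : nat) (lf fl fr : 'I_n -> 'I_n) (hl hr : 'I_n -> option 'I_n).
Local Notation inputs := (inputs k c l lf fl fr hl hr).
Local Notation slots := (slots k c l lf fl fr hl hr).
Local Notation src1 := (src1 fl fr).
Local Notation src2 := (src2 k lf hl hr).
Local Notation wt1 := (wt1 c l fl fr).
Local Notation wt2 := (wt2 k c l lf hl hr).
Local Notation D := (dist src1 src2 wt1 wt2).

Definition ready (m : memory) : Prop := inputs m /\ forall v, slots m v.

(** The phases after [slots_prog] write only arrays of this list, which avoids the inputs 0 to 8 and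
    the slots 30 to 34. *)
Lemma ready_same s m m' :
  all (fun a => (a \in [:: 9; 10; 11; 12; 13; 20]%N) || (24 <= a < 30)%N || (34 < a)%N) s ->
  same_off s m m' -> ready m -> ready m'.
Proof.
move=> hs h [hm hv].
have hN a : ~~ ((a \in [:: 9; 10; 11; 12; 13; 20]%N) || (24 <= a < 30)%N || (34 < a)%N) ->
    a \notin s.
  by apply: contraNN => /(allP hs).
split; first by apply: inputs_same h hm; apply/allP => a /(allP hs); rewrite !inE; lia.
move=> v; have [h1 h2 h3 h4 h5] := hv v.
by split; rewrite ?h ?hN.
Qed.

Definition cell (j : nat) (v : 'I_n) : int := (j * n + v)%N%:Z.

Lemma cell_inj i j (u v : 'I_n) : cell i u = cell j v -> i = j /\ u = v.
Proof.
move=> [e]; have hu := ltn_ord u; have hv := ltn_ord v.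
have n0 : (0 < n)%N by lia.
have := congr1 (fun x => x %/ n)%N e; rewrite !divnMDl // !divn_small // !addn0 => ij.
by split=> //; apply/val_inj; move: e; rewrite ij => /addnI.
Qed.

Definition layer (m : memory) (j : nat) : Prop := forall v, m 35%N (cell j v) = D j v.

Lemma relax_runs m v j : ready m -> m 25%N 0 = (j * n)%N%:Z -> m 20%N 0 = code v ->
  layer m j ->
  runs relax_prog m 6 (fun m' =>
    m' 35%N (cell j.+1 v) = D j.+1 v /\
    forall i, i != cell j.+1 v -> m' 35%N i = m 35%N i).
Proof.
move=> [[h0 h1 h2 h3 h4] hs] mb mv hl0.
have [s1 s2 s3 s4 _] := hs v.
have cE (u : 'I_n) : (j * n)%N%:Z + code u = cell j u by rewrite /cell /code; lia.
have cE1 : (j * n)%N%:Z + n%:Z + code v = cell j.+1 v.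
  by rewrite /cell /code mulSn; lia.
apply: (@runs_weaken _ _ (1 + ((maxn 1 1).+1 + ((maxn 1 1).+1 + 1))) _ _ _ _ (fun _ h => h)) => //.
apply: runs_seq; apply: runs_put; rewrite /= mb mv cE hl0.
apply: runs_seq.
have fin_ (x : int) m1 : x = relax (relax (D j v) (D j (src1 v) + wt1 v)) (D j (src2 v) + wt2 v) ->
   m1 27%N 0 = x -> same_off [:: 27%N] m m1 ->
   runs (Put 35 (Add (Add (var 25) numN) curV) (var 27)) m1 1 (fun m' =>
    m' 35%N (cell j.+1 v) = D j.+1 v /\
    forall i, i != cell j.+1 v -> m' 35%N i = m 35%N i).
  move=> xE m1x so; apply: runs_put; rewrite /= m1x !so // mb mv h3 cE1.
  by split=> [|i /negPf hi]; rewrite /update /= ?eqxx // hi so.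
have second (x : int) m1 : x = relax (D j v) (D j (src1 v) + wt1 v) ->
   m1 27%N 0 = x -> same_off [:: 27%N] m m1 ->
   runs (Seq (IfPos (Sub (Add (Get 35 (Add (var 25) (Get 32 curV))) (Get 33 curV)) (var 27))
      (set 27 (Add (Get 35 (Add (var 25) (Get 32 curV))) (Get 33 curV))) Skip)
      (Put 35 (Add (Add (var 25) numN) curV) (var 27))) m1 ((maxn 1 1).+1 + 1) (fun m' =>
    m' 35%N (cell j.+1 v) = D j.+1 v /\
    forall i, i != cell j.+1 v -> m' 35%N i = m 35%N i).
  move=> xE m1x so; apply: runs_seq.
  have e2 : m1 35%N (m1 25%N 0 + m1 32%N (m1 20%N 0)) + m1 33%N (m1 20%N 0) =
      D j (src2 v) + wt2 v by rewrite !so // mb mv s3 s4 cE hl0.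
  apply: runs_if => /=; rewrite e2 m1x => cmp.
    apply: runs_put; rewrite /= e2; apply: fin_ (erefl _) _ _.
    - by rewrite /update /= ?eqxx -xE /relax cmp.
    move=> a; rewrite inE => /negPf ha i; rewrite /update ha /= so ?inE ?ha //.
  apply: runs_skip; apply: fin_ (erefl _) _ so.
  by rewrite m1x -xE /relax ltNge cmp.
set m1 := update m 27 0 (D j v).
have so : same_off [:: 27%N] m m1.
  by move=> a; rewrite inE => /negPf ha i; rewrite /m1 /update ha.
have m1x : m1 27%N 0 = D j v by rewrite /m1 /update ?eqxx.
have e1 : m1 35%N (m1 25%N 0 + m1 30%N (m1 20%N 0)) + m1 31%N (m1 20%N 0) =
      D j (src1 v) + wt1 v by rewrite !so // mb mv s1 s2 cE hl0.
apply: runs_if => /=; rewrite e1 m1x => cmp.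
  apply: runs_put; rewrite /= e1; apply: second (erefl _) _ _.
  - by rewrite /update /= ?eqxx /relax cmp.
  move=> a; rewrite inE => /negPf ha i; rewrite /update ha /= so ?inE ?ha //.
apply: runs_skip; apply: second (erefl _) _ so.
by rewrite m1x /relax ltNge cmp.
Qed.

Definition tabled (m : memory) : Prop := forall j, (j <= n)%N -> layer m j.

Lemma dist_runs m : ready m ->
  runs dist_prog m (10 * n * n + 10 * n + 10) (fun m' =>
    [/\ ready m', m' 25%N 0 = (n * n)%N%:Z & tabled m']).
Proof.
move=> hm.
apply: (@runs_weaken _ _ ((n * (1 + 2) + 2) +
  (1 + (n * ((n * (6 + 2) + 2 + 1) + 2) + 2))) _ _ _ _ (fun _ h => h)).
  by rewrite ?mulnDr ?mulnDl; nia.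
apply: runs_seq.
pose I0 (j : nat) (m' : memory) := forall v : 'I_n, (v < j)%N -> m' 35%N (code v) = 0.
apply: (runs_weaken (leqnn _) _ (@runs_for 20 numN _ m 1 n I0 _ _ _ _)) => //.
- move=> m1 [hI so1]; apply: runs_seq; apply: runs_put => /=.
  set m2 := update m1 25 0 0.
  have so2 : same_off [:: 20; 25; 35]%N m m2.
    move=> a; rewrite !inE !negb_or => /and3P[a1 /negPf a2 a3] i.
    by rewrite /m2 /update a2 /= so1 // !inE negb_or a1 a3.
  have l0 : layer m2 0 by move=> v; rewrite /cell /m2 /update /= mul0n add0n hI.
  pose I (j : nat) (m' : memory) :=
    m' 25%N 0 = (j * n)%N%:Z /\ forall i, (i <= j)%N -> layer m' i.
  pose ws := 26%N :: writes (Seq (For 20 numN relax_prog) (set 25 (Add (var 25) numN))).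
  have hm2 : ready m2 by apply: ready_same so2 hm.
  have keep m' : same_off ws m2 m' -> ready m' by move=> h; apply: ready_same h hm2.
  apply: (@runs_weaken _ _ _ _ (fun m' => I n m' /\ same_off ws m2 m') _ (leqnn _)).
    by move=> m' [[i1 i2] hs]; split=> //; exact: keep.
  apply: runs_for => //.
  + by move=> m' /keep [[]].
  + by split=> [|i]; rewrite ?mul0n ?leqn0 // => /eqP ->.
  move=> j m' jn _ hs [i1 i2]; have rm' := keep _ hs.
  apply: runs_seq.
  pose J (t : nat) (m3 : memory) := (forall i, (i <= j)%N -> layer m3 i) /\
    forall v : 'I_n, (v < t)%N -> m3 35%N (cell j.+1 v) = D j.+1 v.
  have keep' m3 : same_off (20%N :: writes relax_prog) m' m3 -> ready m3.
    by move=> h; apply: ready_same h rm'.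
  apply: (runs_weaken (leqnn _) _ (@runs_for 20 numN _ m' 6 n J _ _ _ _)) => //.
  + move=> m3 [[j1 j2] so3]; apply: runs_put => /=; split.
      have [[_ _ _ n3 _] _] := keep' _ so3.
      by rewrite /update /= ?eqxx n3 so3 // i1 mulSn; lia.
    move=> i; rewrite leq_eqVlt => /orP[/eqP ->|]; last by rewrite ltnS => /j1.
    by move=> v; rewrite /update /=; apply: j2.
  + by move=> m3 /keep' [[]].
  move=> t m3 tn m3t so3 [j1 j2]; pose v := Ordinal tn.
  have m3v : m3 20%N 0 = code v by rewrite m3t.
  have m3b : m3 25%N 0 = (j * n)%N%:Z by rewrite so3.
  apply: (runs_weaken (leqnn _) _ (relax_runs (keep' _ so3) m3b m3v (j1 j (leqnn j)))).
  move=> m4 [e1 e2]; split.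
    move=> i ij u; rewrite /update /= e2; first exact: j1.
    by apply/eqP => /cell_inj [] ; lia.
  move=> u; rewrite ltnS leq_eqVlt => /orP[/eqP uv|ut].
    by have -> : u = v by [apply/val_inj]; rewrite /update /=.
  rewrite /update /= e2; first exact: j2.
  by apply/eqP => /cell_inj [_ uv]; move: ut; rewrite uv /= ltnn.
- by move=> m' hs; rewrite /= hs //; case: hm => -[].
move=> j m' jn m'j hs hI; apply: runs_put => /= v; rewrite m'j.
rewrite ltnS leq_eqVlt => /orP[/eqP vj|vj].
  by rewrite /update /= /code vj eqxx.
rewrite /update /=; case: eqP => [//|_]; exact: hI.
Qed.

Hypothesis n0 : (0 < n)%N.

Lemma pred_cell (v : 'I_n) (m : memory) : m 25%N 0 = (n * n)%N%:Z -> m 2%N 0 = n%:Z ->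
  m 25%N 0 - m 2%N 0 + code v = cell n.-1 v /\ m 25%N 0 + code v = cell n v.
Proof.
move=> -> ->; rewrite /cell /code; split; last by lia.
have -> : (n * n = n.-1 * n + n)%N by rewrite -{1}(prednK n0) mulSn addnC.
by lia.
Qed.

Lemma check_runs m : ready m -> m 25%N 0 = (n * n)%N%:Z -> tabled m ->
  runs check_prog m (5 * n + 5) (fun m' =>
    [/\ ready m', m' 25%N 0 = (n * n)%N%:Z, tabled m' &
     m' 28%N 0 = -1 /\ (forall v, D n v <= D n.-1 v) \/
     exists v, m' 28%N 0 = code v /\ D n.-1 v < D n v]).
Proof.
move=> hm mb ht.
apply: (@runs_weaken _ _ (1 + (n * ((maxn 1 1).+1 + 2) + 2)) _ _ _ _ (fun _ h => h)); first by lia.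
apply: runs_seq; apply: runs_put => /=.
set m1 := update m 28 0 (-1).
have so1 : same_off [:: 28%N] m m1.
  by move=> a; rewrite inE => /negPf ha i; rewrite /m1 /update ha.
pose I (j : nat) (m' : memory) :=
  m' 28%N 0 = -1 /\ (forall v : 'I_n, (v < j)%N -> D n v <= D n.-1 v) \/
  exists v, m' 28%N 0 = code v /\ D n.-1 v < D n v.
pose ws := [:: 20; 28]%N.
have keep m' : same_off ws m1 m' -> [/\ ready m', m' 25%N 0 = (n * n)%N%:Z & tabled m'].
  move=> hs; split.
  - by apply: ready_same hs _ => //; apply: ready_same so1 hm.
  - by rewrite hs // so1.
  by move=> j jn v; rewrite hs // so1 // ht.
apply: (@runs_weaken _ _ _ _ (fun m' => I n m' /\ same_off ws m1 m') _ (leqnn _)).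
  move=> m' [hI /keep [? ? ?]]; split=> //; case: hI => [[h1 h2]|h]; [left|by right].
  by split=> // v; apply: h2.
apply: runs_for => //.
- by move=> m' /keep [[[]]].
- by left; rewrite /update /= /m1 /update /= ?eqxx.
move=> j m' jn m'j /keep [r1 b1 t1] hI; pose v := Ordinal jn.
have m'v : m' 20%N 0 = code v by rewrite m'j.
have [[_ _ _ n2 _] _] := r1; have [c1 c2] := pred_cell v b1 n2.
have e1 := t1 n.-1 (leq_pred n) v; have e2 := t1 n (leqnn n) v.
apply: runs_if => /=; rewrite m'v c1 c2 e1 e2 ?subr_gt0 ?subr_le0 => cmp.
  by apply: runs_put; right; exists v; rewrite /update /= m'v.
apply: runs_skip; case: hI => [[h1 h2]|h]; last by right.
left; split=> // u; rewrite ltnS leq_eqVlt => /orP[/eqP uv|uj]; last exact: h2.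
by have -> : u = v by apply/val_inj.
Qed.

Lemma model_runs m : ready m -> m 25%N 0 = (n * n)%N%:Z -> tabled m ->
  runs model_prog m (6 * n + 5) (fun m' => m' 9%N 0 = 1 /\ forall v : 'I_n,
     let b := D n.-1 v - D n.-1 (Ordinal n0) in let t := b + l.+1%:Z in
     m' 10%N (code v) = b /\
     m' 11%N (code v) = if t < c%:Z then t else t - c%:Z).
Proof.
move=> hm mb ht.
pose b v := D n.-1 v - D n.-1 (Ordinal n0).
pose e v := if b v + l.+1%:Z < c%:Z then b v + l.+1%:Z else b v + l.+1%:Z - c%:Z.
apply: (@runs_weaken _ _ (n * ((1 + (maxn 1 1).+1) + 2) + 2 + 1) _ _ _ _ (fun _ h => h)); first by lia.
apply: runs_seq.
pose I (j : nat) (m' : memory) := forall v : 'I_n, (v < j)%N ->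
  m' 10%N (code v) = b v /\ m' 11%N (code v) = e v.
pose ws := [:: 20; 10; 11; 11]%N.
have keep m' : same_off ws m m' -> [/\ ready m', m' 25%N 0 = (n * n)%N%:Z & tabled m'].
  move=> hs; split.
  - by apply: ready_same hs hm.
  - by rewrite hs.
  by move=> j jn v; rewrite hs // ht.
apply: (@runs_weaken _ _ _ _ (fun m' => I n m' /\ same_off ws m m') _ (leqnn _)).
  move=> m' [hI _]; apply: runs_put => /=; split=> [|v]; first by rewrite /update /= ?eqxx.
  by rewrite /update /=; apply: hI.
apply: runs_for => //.
  by move=> m' /keep [[[]]].
move=> j m' jn m'j /keep [r1 b1 t1] hI; pose v := Ordinal jn.
have m'v : m' 20%N 0 = code v by rewrite m'j.
have [[_ k1 k2 n2 _] _] := r1; have [c1 c2] := pred_cell v b1 n2.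
have [c3 _] := pred_cell (Ordinal n0) b1 n2; rewrite /code /= addr0 in c3.
apply: runs_seq; apply: runs_put; rewrite /= m'v c1 c3 !(t1 n.-1 (leq_pred n)) -/(b v).
have other (u : 'I_n) : (u < j.+1)%N -> u = v \/ (u < j)%N /\ (code u == code v) = false.
  rewrite ltnS leq_eqVlt => /orP[/eqP uv|uj]; [left; exact/val_inj|right; split=> //].
  by rewrite code_eq; apply: contraTF uj => /eqP ->; rewrite ltnn.
apply: runs_if; rewrite /update /= m'v ?eqxx k1 k2 => cmp; apply: runs_put;
  rewrite /update /= m'v ?eqxx ?k1 k2 => u /other [->|[uj ne]]; rewrite ?ne ?eqxx;
  (try exact: hI); split=> //=; rewrite /e; case: ifP; lia.
Qed.

End Phases.

(** * Extraction of a simple cycle from the layers *)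

Section CyclePhases.
Variables (n k c l : nat) (lf fl fr : 'I_n -> 'I_n) (hl hr : 'I_n -> option 'I_n).
Local Notation sr1 := (src1 fl fr).
Local Notation sr2 := (src2 k lf hl hr).
Local Notation wg1 := (wt1 c l fl fr).
Local Notation wg2 := (wt2 k c l lf hl hr).
Local Notation ready := (ready k c l lf fl fr hl hr).
Local Notation tabled := (tabled k c l lf fl fr hl hr).
Local Notation D := (dist sr1 sr2 wg1 wg2).
Local Notation wk := (walk k lf hl).
Local Notation nsl := (nose_slot k lf hl hr).

Variable bad : 'I_n.
Local Notation tr := (trace sr1 sr2 wg1 wg2 bad).
Local Notation first := (first_edge sr1 sr2 wg1 wg2).

(* The kind, in the output encoding, of the edge from tr t.+1 to tr t. *)
Definition kind (t : nat) : int :=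
  if first (n - t.+1) (tr t) then -1 else (wk (tr t)).1%:Z.

(* An unused slot is a loop of weight 0, which never improves a distance. *)
Lemma used_nose t : D n.-1 bad < D n bad -> (t < n)%N -> ~~ first (n - t.+1) (tr t) -> nsl (tr t).
Proof.
move=> bad_lt tn nf; have lt := trace_lt bad_lt tn; have e := trace_dist bad_lt tn.
apply/negPn/negP => /negPf h.
have es : sr2 (tr t) = tr t by rewrite /src2 h.
have ew : wg2 (tr t) = 0 by rewrite /wt2 h.
by move: e lt; rewrite /= /pred_weight /pred_vertex (negPf nf) es ew addr0 => ->; rewrite ltxx.
Qed.

Lemma used_hollow t : D n.-1 bad < D n bad -> (t < n)%N -> first (n - t.+1) (tr t) ->
  hollow_slot fr fl (tr t).
Proof.
move=> bad_lt tn nf; have lt := trace_lt bad_lt tn; have e := trace_dist bad_lt tn.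
apply/negPn/negP => /negPf h.
have es : sr1 (tr t) = tr t by rewrite /src1 h.
have ew : wg1 (tr t) = 0 by rewrite /wt1 h.
by move: e lt; rewrite /= /pred_weight /pred_vertex nf es ew addr0 => ->; rewrite ltxx.
Qed.

Definition traced (m : memory) : Prop :=
  (forall t, (t <= n)%N -> m 36%N t%:Z = code (tr t)) /\
  (forall t, (t < n)%N -> m 37%N t%:Z = kind t).

Lemma trace_runs m : D n.-1 bad < D n bad -> ready m -> m 25%N 0 = (n * n)%N%:Z -> tabled m ->
  m 28%N 0 = code bad ->
  runs trace_prog m (10 * n + 5) (fun m' => ready m' /\ traced m').
Proof.
move=> bad_lt hm mb ht m28.
apply: (@runs_weaken _ _ (1 + (n * ((1 + (1 + (maxn (1 + 1) (1 + 1)).+2)) + 2) + 2)) _ _ _ _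
  (fun _ h => h)); first by lia.
apply: runs_seq; apply: runs_put; rewrite /= m28.
set m1 := update m 36 0 _.
have so1 : same_off [:: 36%N] m m1.
  by move=> a; rewrite inE => /negPf ha i; rewrite /m1 /update ha.
pose I (j : nat) (m' : memory) := [/\ m' 25%N 0 = ((n - j) * n)%N%:Z,
  forall t, (t <= j)%N -> m' 36%N t%:Z = code (tr t) &
  forall t, (t < j)%N -> m' 37%N t%:Z = kind t].
pose ws := [:: 26; 25; 20; 36; 37; 36; 37; 36; 37]%N.
have keep m' : same_off ws m1 m' -> ready m' /\ tabled m'.
  move=> hs; split.
    by apply: ready_same hs _ => //; apply: ready_same so1 hm.
  by move=> j jn v; rewrite hs // so1 // ht.
apply: (@runs_weaken _ _ _ _ (fun m' => I n m' /\ same_off ws m1 m') _ (leqnn _)).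
  by move=> m' [[i1 i2 i3] /keep []]; split.
apply: runs_for => //.
- by move=> m' /keep [[[]]].
- split=> [|t|t //]; first by rewrite /update /= so1 // subn0.
  by rewrite leqn0 => /eqP ->; rewrite /update /= /m1 /update /= ?eqxx.
move=> j m' jn m'j /keep [[[_ _ _ n2 _] r2] t1] [i1 i2 i3].
set v := tr j; have [s1 _ s3 _ s5] := r2 v; have [_ w2 _ _ _] := r2 v.
have eb : m' 25%N 0 - m' 2%N 0 = ((n - j.+1) * n)%N%:Z.
  rewrite i1 n2; have -> : (n - j = (n - j.+1).+1)%N by lia.
  by rewrite mulSn; lia.
have cE (u : 'I_n) : ((n - j.+1) * n)%N%:Z + code u = cell (n - j.+1) u.
  by rewrite /cell /code; lia.
have cE1 : ((n - j.+1) * n)%N%:Z + n%:Z + code v = cell (n - j.+1).+1 v.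
  by rewrite /cell /code mulSn; lia.
have t36 := i2 j (leqnn j).
have l1 := t1 (n - j.+1)%N ltac:(lia); have l2 := t1 (n - j.+1).+1 ltac:(lia).
have upd (b : bool) (x y : int) m3 :
    b = first (n - j.+1) v ->
    x = code (if b then sr1 v else sr2 v) ->
    y = (if b then -1 else (wk v).1%:Z) ->
    m3 25%N 0 = ((n - j.+1) * n)%N%:Z ->
    (forall i, m3 36%N i = if i == j%:Z + 1 then x else m' 36%N i) ->
    (forall i, m3 37%N i = if i == j%:Z then y else m' 37%N i) -> I j.+1 (update m3 26 0 j.+1%:Z).
  move=> bE xE yE h25 h36 h37; split; first by rewrite /update /=.
    move=> t; rewrite leq_eqVlt => /orP[/eqP ->|tj]; rewrite /update /= h36.
      by rewrite -addn1 PoszD eqxx xE bE addn1.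
    by case: eqP => [|_]; [lia|exact: i2].
  move=> t; rewrite ltnS leq_eqVlt => /orP[/eqP ->|tj]; rewrite /update /= h37.
    by rewrite eqxx yE bE.
  by case: eqP => [|_]; [lia|exact: i3].
apply: runs_seq; apply: runs_put; rewrite /= eb.
apply: runs_seq; apply: runs_put; rewrite /= /update /= m'j t36.
apply: runs_ifeq; rewrite /= s1 n2 cE cE1 l1 l2 w2 => cmp.
  apply: runs_seq; apply: runs_put; rewrite /update /=; apply: runs_put; rewrite /update /=.
  apply: (upd true _ _ _ _ (erefl _) (erefl _)) => /=.
  - by apply/esym/eqP.
  - by [].
  - by move=> i; rewrite m'j ?andbT ?s1.
  by move=> i; rewrite m'j.
have nf : ~~ first (n - j.+1) v by apply/eqP.
apply: runs_seq; apply: runs_put; rewrite /update /=; apply: runs_put; rewrite /update /=.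
apply: (upd false _ _ _ _ (erefl _) (erefl _)) => /=.
- by apply/esym/negbTE.
- by [].
- by move=> i; rewrite m'j ?s3.
by move=> i; rewrite m'j s5 //; exact: used_nose bad_lt jn nf.
Qed.

Definition first_cycle (lo hi : nat) : Prop :=
  [/\ (lo < hi <= n)%N, tr lo = tr hi &
      forall s t, (s < hi)%N -> (t < hi)%N -> tr s = tr t -> s = t].

Lemma cycle_runs m : ready m -> traced m ->
  runs cycle_prog m (10 * n + 20) (fun m' => [/\ ready m', traced m' &
    exists lo hi, [/\ m' 39%N 0 = lo%:Z, m' 29%N 0 = hi%:Z & first_cycle lo hi]]).
Proof.
move=> hm ht.
apply: (@runs_weaken _ _ ((n * (1 + 2) + 2) +
  (1 + (1 + (n.+1 * ((maxn 1 (maxn (1 + 1) 1).+1).+1 + 2) + 2)))) _ _ _ _ (fun _ h => h)).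
  by rewrite /=; lia.
apply: runs_seq.
pose I0 (j : nat) (m' : memory) := forall v : 'I_n, (v < j)%N -> m' 38%N (code v) = -1.
apply: (runs_weaken (leqnn _) _ (@runs_for 20 numN _ m 1 n I0 _ _ _ _)) => //; first last.
- move=> j m' jn m'j hs hI; apply: runs_put => /= v; rewrite m'j.
  rewrite ltnS leq_eqVlt => /orP[/eqP vj|vj]; rewrite /update /=.
    by rewrite /code vj eqxx.
  case: eqP => [//|_]; exact: hI.
- by move=> m' hs; rewrite /= hs //; case: hm => -[].
move=> m1 [hI so1]; apply: runs_seq; apply: runs_put; apply: runs_seq; apply: runs_put => /=.
set m2 := update (update m1 29 0 0) 39 0 0.
have so2 : same_off [:: 20; 38; 29; 39]%N m m2.
  move=> a; rewrite !inE !negb_or => /and4P[a1 a2 /negPf a3 /negPf a4] i.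
  by rewrite /m2 /update a3 a4 /= so1 // !inE negb_or a1 a2.
pose I (j : nat) (m' : memory) :=
  [/\ m' 29%N 0 = 0, forall s t, (s < j)%N -> (t < j)%N -> tr s = tr t -> s = t &
      forall v, m' 38%N (code v) = -1 /\ (forall s, (s < j)%N -> tr s <> v) \/
        exists s, [/\ (s < j)%N, tr s = v & m' 38%N (code v) = s%:Z]] \/
  exists lo hi, [/\ m' 39%N 0 = lo%:Z, m' 29%N 0 = hi%:Z & first_cycle lo hi].
pose ws := [:: 26; 29; 39; 38]%N.
have keep m' : same_off ws m2 m' -> ready m' /\ traced m'.
  move=> hs; split; first by apply: ready_same hs _ => //; apply: ready_same so2 hm.
  by case: ht => h1 h2; split=> t tn; rewrite hs // so2 // ?h1 ?h2.
apply: (@runs_weaken _ _ _ _ (fun m' => I n.+1 m' /\ same_off ws m2 m') _ (leqnn _)).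
  (* Without a repetition the n + 1 traced vertices would be distinct elements of ['I_n]. *)
  move=> m' [hJ /keep [? ?]]; split=> //; case: hJ => // -[_ inj _]; exfalso.
  have : injective (fun i : 'I_n.+1 => tr i).
    by move=> x y e; apply/val_inj; apply: inj e; exact: ltn_ord.
  by move/leq_card; rewrite !card_ord ltnn.
apply: runs_for => //.
- by move=> m' /keep [[[_ _ _ h _] _] _]; rewrite /= h; lia.
- left; rewrite /m2 /update /=; split=> // v; left; split=> //.
  by apply: hI; exact: ltn_ord.
move=> j m' jn m'j /keep [r1 [t1 t2]] hJ.
apply: runs_if => /= c29.
  apply: runs_skip; right; case: hJ => [[h _ _]|h]; first by rewrite h in c29.
  by case: h => lo [hi h]; exists lo, hi; rewrite /update /=.
case: hJ => [[h29 inj h38]|[lo [hi [_ h [/andP[h1 _] _ _]]]]]; last by rewrite h in c29; lia.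
have t36 := t1 j ltac:(lia).
apply: runs_if; rewrite /= m'j t36 => c38.
  case: (h38 (tr j)) => [[h _]|[s [sj es h]]]; first by rewrite h in c38.
  apply: runs_seq; apply: runs_put; apply: runs_put.
  rewrite /update /= m'j t36 h; right; exists s, j; split=> //; split=> //.
  by rewrite sj; lia.
apply: runs_put; rewrite /= m'j t36; left; rewrite /update /=.
have new s : (s < j)%N -> tr s <> tr j.
  case: (h38 (tr j)) => [[_ h]|[s' [_ _ h]]]; first exact: h.
  by rewrite h in c38; lia.
split=> //.
  move=> s t sj tj e.
  have [sj'|sj'] : s = j \/ (s < j)%N by lia.
    have [tj'|tj'] : t = j \/ (t < j)%N by lia.
      by rewrite sj' tj'.
    by case: (new t tj'); rewrite -e sj'.
  have [tj'|tj'] : t = j \/ (t < j)%N by lia.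
    by case: (new s sj'); rewrite e tj'.
  exact: inj e.
move=> v; rewrite code_eq; case: eqP => [->|ne].
  by right; exists j; split.
case: (h38 v) => [[h1 h2]|[s [sj es h]]].
  left; split=> // s; rewrite ltnS leq_eqVlt => /orP[/eqP -> e|]; last exact: h2.
  by apply: ne.
by right; exists s; split=> //; lia.
Qed.

Lemma family_runs m lo hi : traced m -> m 39%N 0 = lo%:Z -> m 29%N 0 = hi%:Z ->
  first_cycle lo hi ->
  runs family_prog m (6 * n + 10) (fun m' =>
    [/\ m' 9%N 0 = 0, m' 10%N 0 = (hi - lo)%N%:Z &
      forall t, (t < hi - lo)%N -> [/\ m' 11%N t%:Z = kind (lo + t),
        m' 12%N t%:Z = code (tr (lo + t).+1) & m' 13%N t%:Z = code (tr (lo + t))]]).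
Proof.
move=> [t1 t2] mlo mhi [/andP[lh hn] _ _].
apply: (@runs_weaken _ _ (((hi - lo) * ((1 + (1 + 1)) + 2) + 2) + (1 + 1)) _ _ _ _ (fun _ h => h)).
  have hl' : (hi - lo <= n)%N by lia.
  by lia.
apply: runs_seq.
pose I (j : nat) (m' : memory) := forall t, (t < j)%N -> [/\ m' 11%N t%:Z = kind (lo + t),
        m' 12%N t%:Z = code (tr (lo + t).+1) & m' 13%N t%:Z = code (tr (lo + t))].
pose ws := [:: 26; 11; 12; 13]%N.
apply: (@runs_weaken _ _ _ _ (fun m' => I (hi - lo)%N m' /\ same_off ws m m') _ (leqnn _)).
  move=> m' [hI hs]; apply: runs_seq; apply: runs_put; apply: runs_put => /=.
  split; first by rewrite /update /= ?eqxx.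
    by rewrite /update /= ?eqxx !hs // mlo mhi; lia.
  by move=> t /hI; rewrite /update /=.
apply: runs_for => //.
  by move=> m' hs; rewrite /= !hs // mlo mhi; lia.
move=> j m' jn m'j hs hI.
apply: runs_seq; apply: runs_put; apply: runs_seq; apply: runs_put; apply: runs_put.
rewrite /update /= m'j !hs // mlo.
have -> : lo%:Z + j%:Z = (lo + j)%N%:Z by lia.
have -> : (lo + j)%N%:Z + 1 = (lo + j).+1%:Z by lia.
rewrite !t1 ?t2; try lia.
move=> t; rewrite ltnS leq_eqVlt => /orP[/eqP ->|tj]; rewrite /= ?eqxx //.
have -> : (t%:Z == j%:Z) = false by apply/eqP; lia.
exact: hI.
Qed.

End CyclePhases.

(** * Correctness and complexity *)

(* Without its t0-th edge the cycle is a path, along which the potential d,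
   raised by d lo - d hi after t0, satisfies all constraints with equality. *)
Lemma cycle_minimal (R : realType) (M : model R) (c l : nat) (e : nat -> edge M)
    (v : nat -> 'I_(narcs M)) (d : nat -> int) (lo hi : nat) :
  (forall t, (lo <= t < hi)%N ->
     [/\ (e t).1.2 = v t.+1, (e t).2 = v t & sep c l (e t) = d t - d t.+1]) ->
  (lo < hi)%N -> d hi < d lo -> v lo = v hi ->
  (forall s t, (s < hi)%N -> (t < hi)%N -> v s = v t -> s = t) ->
  let E := [seq e t | t <- iota lo (hi - lo)] in uniq E /\ minimal_infeasible c l E.
Proof.
move=> he lh dlt vv inj E.
have inE t : (t \in iota lo (hi - lo)) = (lo <= t < hi)%N by rewrite mem_iota; lia.
split.
  rewrite map_inj_in_uniq ?iota_uniq // => s t; rewrite !inE => hs ht est.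
  have [_ e1 _] := he s hs; have [_ e2 _] := he t ht.
  by apply: inj; rewrite -?e1 -?e2 ?est //; lia.
split.
  case=> x hx; have step t : (lo <= t < hi)%N -> x (v t) >= x (v t.+1) + (d t - d t.+1)%:~R.
    move=> ht; have [<- <- <-] := he t ht; apply: hx; apply: map_f; by rewrite inE.
  have tele i : (lo + i <= hi)%N -> x (v lo) >= x (v (lo + i)%N) + (d lo - d (lo + i)%N)%:~R.
    elim: i => [|i IH] hi'; first by rewrite addn0 subrr mulr0z addr0.
    have := IH ltac:(lia); have := step (lo + i)%N ltac:(lia).
    by rewrite addnS !intrB; lra.
  have := tele (hi - lo)%N ltac:(lia); have -> : (lo + (hi - lo) = hi)%N by lia.
  rewrite -vv gerDl -[0]/(0%:~R) ler_int; lia.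
case=> [|g G] sub // _; have : g \in E by apply: sub; rewrite mem_head.
case/mapP=> t0; rewrite inE => ht0 gE.
pose idx u := (lo + index u [seq v t | t <- iota lo (hi - lo)])%N.
have idxE t : (lo <= t < hi)%N -> idx (v t) = t.
  move=> ht; pose s := [seq v t | t <- iota lo (hi - lo)].
  have us : uniq s.
    rewrite map_inj_in_uniq ?iota_uniq // => a b; rewrite !inE => ha hb.
    by apply: inj; lia.
  have nt : nth (v lo) s (t - lo) = v t.
    by rewrite (nth_map 0%N) ?size_iota ?nth_iota; first congr v; lia.
  by rewrite /idx -/s -nt index_uniq // ?size_map ?size_iota; lia.
exists (fun u => (d (idx u) + if (t0 < idx u)%N then d lo - d hi else 0)%:~R) => f.
rewrite mem_filter => /andP[fG /mapP [t]]; rewrite inE => ht fE.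
have tt0 : t <> t0 by move=> tt0; move: fG; rewrite fE tt0 -gE mem_head.
have [h1 h2 h3] := he t ht; rewrite fE h1 h2 h3 -intrD ler_int (idxE t ht).
have [lt|eq] : (t.+1 < hi)%N \/ t.+1 = hi by lia.
  by rewrite idxE; [case: ifP; case: ifP; lia|lia].
by rewrite eq -vv idxE; [case: ifP; case: ifP; lia|lia].
Qed.

Definition decision_prog : cmd :=
  Seq slots_prog (Seq dist_prog (Seq check_prog
    (IfPos (Add (var 28) (Cst 1)) (Seq trace_prog (Seq cycle_prog family_prog))
       model_prog))).

Section Decision.
Variables (R : realType) (M : model R) (k c l : nat).
Hypothesis hM : is_pca M.
Hypothesis hz : zero_at_initial M.
Variable n0 : (0 < narcs M)%N.
Local Notation n := (narcs M).
Hypothesis kn : (k < n)%N.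
Hypothesis k1 : (1 <= k)%N.
Hypothesis nowrap : forall i, (i <= k)%N -> forall z, iter i (lF n0) z < z + n%:Z.

Local Notation lf := (@Lf R M).
Local Notation fl := (@Fl R M).
Local Notation fr := (@Fr R M).
Local Notation hl := (@Hl R M).
Local Notation hr := (@Hr R M).
Local Notation s1 := (src1 fl fr).
Local Notation s2 := (src2 k lf hl hr).
Local Notation u1 := (wt1 c l fl fr).
Local Notation u2 := (wt2 k c l lf hl hr).
Local Notation D := (dist s1 s2 u1 u2).
Local Notation hsl := (hollow_slot fr fl).
Local Notation nsl := (nose_slot k lf hl hr).

Lemma beg_le (i j : 'I_n) : (beg i <= beg j) = (i <= j)%N.
Proof. by rewrite -!(lbegE n0) lbeg_le. Qed.

Lemma sep_hollow v : sep c l (hollow_edge v) = hollow_weight c l fr v.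
Proof. by rewrite /= /hollow_weight beg_le. Qed.

Lemma sep_nose v : sep c l (nose_edge k v) = nose_weight k c l lf hl v.
Proof. by rewrite /= /nose_weight beg_le. Qed.

(** If layer n improves nothing, layer n - 1 satisfies the constraints of all slots, which is what
    [lsol_hollows] and [lsol_long_noses] need. *)
Lemma decision_model : (forall v, D n v <= D n.-1 v) ->
  mult_solution M k c l (solution M c l (lsol n0 c (D n.-1))).
Proof.
move=> h; have nE : n = n.-1.+1 by rewrite prednK.
have rf := @relaxed_feasible n s1 s2 u1 u2 n.-1.
rewrite -nE in rf; have {}rf := rf h.
apply: (solutionP hM hz (n0 := n0)) => //.
- exact: lsol_shifts.
- apply: lsol_hollows => // v hv; have [h1 _] := rf v.
  by move: h1; rewrite sep_hollow /src1 /wt1 hv.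
apply: lsol_long_noses nowrap _ => // v hv; have [_ h1] := rf v.
by move: h1; rewrite sep_nose /src2 /wt2 hv.
Qed.

Section Infeasible.
Variables (bad : 'I_n) (lo hi : nat).
Hypothesis bad_lt : D n.-1 bad < D n bad.
Local Notation tr := (trace s1 s2 u1 u2 bad).
Hypothesis hcyc : first_cycle k c l lf fl fr hl hr bad lo hi.

Definition cycle_edge (t : nat) : edge M :=
  if first_edge s1 s2 u1 u2 (n - t.+1) (tr t) then hollow_edge (tr t)
  else nose_edge k (tr t).

Lemma cycle_edgeP t : (t < n)%N -> [/\ (cycle_edge t).1.2 = tr t.+1,
  (cycle_edge t).2 = tr t, synthetic k (cycle_edge t),
  oapp Posz (-1) (cycle_edge t).1.1 = kind k c l lf fl fr hl hr bad t &
  sep c l (cycle_edge t) = D (n - t) (tr t) - D (n - t.+1) (tr t.+1)].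
Proof.
move=> tn; rewrite (trace_dist bad_lt tn) addrAC subrr add0r /cycle_edge /kind.
rewrite [tr t.+1]/= /pred_vertex /pred_weight; case: ifP => [h|/negbT h].
  have hs := used_hollow bad_lt tn h.
  rewrite sep_hollow /src1 /wt1 hs; split=> //.
  exact: hollow_edge_synthetic.
have hs := used_nose bad_lt tn h.
rewrite sep_nose /src2 /wt2 hs; split=> //.
exact: (nose_edge_synthetic hM nowrap).
Qed.

Definition cycle_family := [seq cycle_edge t | t <- iota lo (hi - lo)].

Lemma cycle_family_synthetic f : f \in cycle_family -> synthetic k f.
Proof.
case/mapP=> t; rewrite mem_iota => ht ->; case: hcyc => /andP[? ?] _ _.
by have [] := @cycle_edgeP t ltac:(lia).
Qed.

Lemma cycle_family_minimal : uniq cycle_family /\ minimal_infeasible c l cycle_family.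
Proof.
case: hcyc => /andP[lh hn] vv inj.
apply: (cycle_minimal (v := tr) (d := fun t => D (n - t) (tr t))) => //.
  by move=> t ht; have [] := @cycle_edgeP t ltac:(lia).
by apply: (trace_cycle_pos bad_lt) => //; rewrite lh.
Qed.

Lemma no_solution : ~ exists U, mult_solution M k c l U.
Proof.
case=> U hU; have [x hx] := solution_sound hM hz nowrap k1 hU.
have [_ [nf _]] := cycle_family_minimal; apply: nf; exists x => f.
by move/cycle_family_synthetic => [h _]; exact: hx.
Qed.

End Infeasible.

Lemma decision_runs m : inputs k c l lf fl fr hl hr m ->
  runs decision_prog m (100 * n * n) (correct_output M k c l).
Proof.
move=> hm.
(* [k < n] makes the walks, the only term that involves k, quadratic in n. *)
apply: (@runs_weaken _ _ ((n * (k * 6 + 21) + 2) + ((10 * n * n + 10 * n + 10) +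
  ((5 * n + 5) + (maxn ((10 * n + 5) + ((10 * n + 20) + (6 * n + 10))) (6 * n + 5)).+1)))
  _ _ _ _ (fun _ h => h)).
  have -> : maxn (10 * n + 5 + (10 * n + 20 + (6 * n + 10))) (6 * n + 5) =
    (10 * n + 5 + (10 * n + 20 + (6 * n + 10)))%N by lia.
  by nia.
apply: runs_seq; apply: (runs_weaken (leqnn _) _ (slots_runs hm)) => m1 r1.
apply: runs_seq; apply: (runs_weaken (leqnn _) _ (dist_runs r1)) => m2 [r2 b2 t2].
apply: runs_seq; apply: (runs_weaken (leqnn _) _ (check_runs n0 r2 b2 t2)).
move=> m3 [r3 b3 t3 h3]; apply: runs_if => /= c28.
  case: h3 => [[h _]|[bad [h28 lt]]]; first by rewrite h in c28.
  apply: runs_seq; apply: (runs_weaken (leqnn _) _ (trace_runs lt r3 b3 t3 h28)) => m4 [r4 t4].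
  apply: runs_seq; apply: (runs_weaken (leqnn _) _ (cycle_runs r4 t4)).
  move=> m5 [r5 t5 [lo [hi [e1 e2 hc]]]].
  apply: (runs_weaken (leqnn _) _ (family_runs t5 e1 e2 hc)) => m6 [o1 o2 o3].
  right; split=> //; first exact: no_solution lt hc.
  exists (cycle_family bad lo hi); have [u mi] := cycle_family_minimal lt hc.
  split=> //; first exact: cycle_family_synthetic lt hc.
  split; first by rewrite o2 size_map size_iota.
  move=> j x; rewrite size_map size_iota => jn.
  rewrite (nth_map 0%N) ?size_iota // nth_iota //.
  have [q1 q2 q3] := o3 j jn; have [/andP[? ?] _ _] := hc.
  have [p1 p2 _ p4 _] := @cycle_edgeP bad lt (lo + j)%N ltac:(lia).
  by rewrite /= p1 p2 p4 q1 q2 q3.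
case: h3 => [[_ h]|[v [h28 _]]]; last by rewrite h28 /code in c28; lia.
apply: (runs_weaken (leqnn _) _ (model_runs n0 r3 b3 t3)) => m4 [o1 o2].
left; split=> //; exists (solution M c l (lsol n0 c (D n.-1))); split.
  exact: decision_model.
have X0 : lsol n0 c (D n.-1) 0 = D n.-1 (Ordinal n0).
  rewrite /lsol div0z mulr0 addr0; congr (D _ _); apply/val_inj => /=.
  by rewrite mod0z.
have Xi (i : 'I_n) : lsol n0 c (D n.-1) (i : nat)%:Z = D n.-1 i.
  by rewrite /lsol res_id div_id // mulr0 addr0.
move=> i; have [-> ->] := o2 i.
by rewrite /= /solution_fin /solution_beg Xi X0.
Qed.

End Decision.

Theorem corollary1 (R : realType) (rep : model R -> int -> int)
    (hrep : reasonable rep) :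
  exists (p : cmd) (K : nat),
    forall (M : model R) (w k c l : nat),
      is_pca M -> zero_at_initial M -> is_omega M w -> (1 <= k < w)%N ->
      exists (t : nat) (m : memory),
        [/\ exec p (input k c l (rep M)) t m,
            (t <= K * narcs M ^ 2)%N &
            correct_output M k c l m].
Proof.
case: hrep => p0 [K0 hp].
(* As n > 0, n + 1 <= 2 n^2, which turns the linear cost of the tables into 2 K0 n^2; the 100 is the
   constant of [decision_runs]. *)
exists (Seq p0 decision_prog), (2 * K0 + 100)%N => M w k c l hM hz hw hk.
have [n0 [kn nowrap]] := omega_nowrap hM hz hw hk.
have [t0 [m0 [e0 l0 par [mn tab]]]] := hp M k c l hM.
have hin : inputs k c l (@Lf R M) (@Fl R M) (@Fr R M) (@Hl R M) (@Hr R M) m0.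
  split=> //; [exact: (par 0%N)|exact: (par 1%N)|exact: (par 2%N)|].
  by move=> i; have [q1 _ [q2 q3 q4 q5]] := tab i.
have k1 : (1 <= k)%N by case/andP: hk.
have [t1 [m1 [e1 l1 o1]]] := decision_runs hM hz kn k1 nowrap hin.
exists (t0 + t1)%N, m1; split=> //; first exact: ExSeq e0 e1.
rewrite -mulnn; apply: leq_trans (leq_add l0 l1) _; rewrite mulnDl -!mulnA.
by nia.
Qed.
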